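(* Fix an odd prime $p$, and let $(a_k,s_k)$, $k=1,2,\dots$, be the enumeration of the positive solutions of $a^2-ps^2=4$ described in the context, with associated units $\eta_k$ and maps $\psi_k$. Let $k$ and $l$ be positive integers and assume that $k\mid l$. Then there exists an embedding of $\mathcal H(a_l)$ into $\mathcal H(a_k)$ as a Lie subalgebra. Moreover, under this embedding the root space of a root $\beta$ of $\mathcal H(a_l)$ is embedded into the root space of $\alpha$ in $\mathcal H(a_k)$, where $\alpha$ is determined by $$\psi_l(\beta)=\eta_{kj}\,\psi_k(\alpha)\quad\text{if } l=2kj \text{ for some } j\in\mathbb N,$$ $$\psi_l(\beta)=\eta_{k(j-1)}\,\psi_k(\alpha)\quad\text{if } l=k(2j-1) \text{ for some } j\in\mathbb N.$$
   Context: For an integer $a\ge 3$, $\mathcal H(a)$ denotes the (hyperbolic) Kac-Moody Lie algebra over $\mathbb C$ with generalized Cartan matrix $\begin{pmatrix}2&-a\\-a&2\end{pmatrix}$, with Cartan subalgebra $\mathfrak h=\mathbb C h_1+\mathbb C h_2$ and simple roots $\alpha_1,\alpha_2\in\mathfrak h^*$. Let $p$ be an odd prime, $F=\mathbb Q(\sqrt p)\subset\mathbb R$, $\bar x$ the Galois conjugate of $x\in F$, $\mathcal O$ the ring of integers, and $\varepsilon_0>1$ the fundamental unit of $\mathcal O$. (If $p\equiv1\pmod 4$, then $\varepsilon_0$ has norm $-1$; if $p\equiv 3\pmod 4$, it has norm $1$.) The positive integer solutions $(a_k,s_k)$, $k=1,2,\dots$, of the Pell equation $a^2-ps^2=4$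 are enumerated so that $\eta_k:=\frac{a_k+s_k\sqrt p}{2}$ equals $\varepsilon_0^{2k}$ if $p\equiv1\pmod 4$ and equals $\varepsilon_0^{k}$ if $p\equiv3\pmod 4$. Put $\eta_0=1$. One has $\eta_k^j=\eta_{kj}$ and $\bar\eta_k=\eta_k^{-1}$. For each $k$, writing $\alpha_1,\alpha_2$ for the simple roots of $\mathcal H(a_k)$ and $\mathfrak h^*_{\mathbb Q}=\mathbb Q\alpha_1+\mathbb Q\alpha_2$, the map $\psi_k:\mathfrak h^*_{\mathbb Q}\to F$ is the $\mathbb Q$-linear isomorphism with $\psi_k(\alpha_1)=\frac{1}{\sqrt p}\eta_k$ and $\psi_k(\alpha_2)=-\frac1{\sqrt p}$. It is an isometry from the bilinear form on $\mathfrak h^*_{\mathbb Q}$ given by the Cartan matrix to the form $\langle x,y\rangle=-p\,\mathrm{tr}_{F/\mathbb Q}(x\bar y)$ on $F$. *)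

(* Defs.v *)
From HB Require Import structures.
From mathcomp Require Import all_boot all_order all_algebra.
From mathcomp Require Import generic_quotient.
From mathcomp Require Import boolp reals.
From mathcomp Require Import complex.

Set Implicit Arguments.
Unset Strict Implicit.
Unset Printing Implicit Defensive.

Import Order.TTheory GRing.Theory Num.Theory.
Local Open Scope ring_scope.
Local Open Scope quotient_scope.

HB.mixin Record Lmodule_isLieAlgebra (K : pzRingType) V of GRing.Lmodule K V := {
  lie : V -> V -> V;
  lieDl : forall x y z, lie (x + y) z = lie x z + lie y z;
  lieDr : forall x y z, lie z (x + y) = lie z x + lie z y;
  lieZl : forall c x y, lie (c *: x) y = c *: lie x y;
  lieZr : forall c x y, lie x (c *: y) = c *: lie x y;
  liexx : forall x, lie x x = 0;
  jacobi : forall x y z,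
    lie x (lie y z) + lie y (lie z x) + lie z (lie x y) = 0
}.

#[short(type="lieAlgType")]
HB.structure Definition LieAlgebra (K : pzRingType) :=
  {V of Lmodule_isLieAlgebra K V & GRing.Lmodule K V}.

Definition lie_ideal (K : pzRingType) (L : lieAlgType K) (I : L -> Prop) :=
  [/\ I 0,
      forall x y, I x -> I y -> I (x + y),
      forall (c : K) x, I x -> I (c *: x) &
      forall x y, I y -> I (lie x y)].

Definition lie_embedding (K : pzRingType) (L M : lieAlgType K)
    (f : {linear L -> M}) :=
  injective f /\ forall x y, f (lie x y) = lie (f x) (f y).

(* Lie algebras by generators and relations: formal expressions in the
   generators, modulo the least congruence that contains the relations and
   satisfies the Lie algebra axioms. *)
Section Presentation.
Variables (K : comNzRingType) (X : Type).

Inductive term :=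
  | Tgen of X
  | Tzero
  | Topp of term
  | Tadd of term & term
  | Tscale of K & term
  | Tlie of term & term.

HB.instance Definition _ := gen_eqMixin term.
HB.instance Definition _ := gen_choiceMixin term.

Variable relators : term -> term -> Prop.

Inductive cong : term -> term -> Prop :=
  | cong_rel t u : relators t u -> cong t u
  | cong_refl t : cong t t
  | cong_sym t u : cong t u -> cong u t
  | cong_trans t u v : cong t u -> cong u v -> cong t v
  | cong_opp t t' : cong t t' -> cong (Topp t) (Topp t')
  | cong_add t t' u u' :
      cong t t' -> cong u u' -> cong (Tadd t u) (Tadd t' u')
  | cong_scale c t t' : cong t t' -> cong (Tscale c t) (Tscale c t')
  | cong_lie t t' u u' :
      cong t t' -> cong u u' -> cong (Tlie t u) (Tlie t' u')
  | cong_addA t u v : cong (Tadd t (Tadd u v)) (Tadd (Tadd t u) v)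
  | cong_addC t u : cong (Tadd t u) (Tadd u t)
  | cong_add0 t : cong (Tadd Tzero t) t
  | cong_addN t : cong (Tadd (Topp t) t) Tzero
  | cong_scaleA a b t : cong (Tscale a (Tscale b t)) (Tscale (a * b) t)
  | cong_scale1 t : cong (Tscale 1 t) t
  | cong_scaleDr a t u :
      cong (Tscale a (Tadd t u)) (Tadd (Tscale a t) (Tscale a u))
  | cong_scaleDl a b t :
      cong (Tscale (a + b) t) (Tadd (Tscale a t) (Tscale b t))
  | cong_lieDl t u v : cong (Tlie (Tadd t u) v) (Tadd (Tlie t v) (Tlie u v))
  | cong_lieDr t u v : cong (Tlie v (Tadd t u)) (Tadd (Tlie v t) (Tlie v u))
  | cong_lieZl a t u : cong (Tlie (Tscale a t) u) (Tscale a (Tlie t u))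
  | cong_lieZr a t u : cong (Tlie t (Tscale a u)) (Tscale a (Tlie t u))
  | cong_liexx t : cong (Tlie t t) Tzero
  | cong_jacobi t u v :
      cong (Tadd (Tadd (Tlie t (Tlie u v)) (Tlie u (Tlie v t)))
                 (Tlie v (Tlie t u))) Tzero.

Definition congb : rel term := fun t u => `[< cong t u >].

Lemma congb_equiv : equiv_class_of congb.
Proof.
split=> [t|t u|t u v]; first by apply/asboolP; apply: cong_refl.
  by apply/asboolP/asboolP; apply: cong_sym.
by move=> /asboolP tu /asboolP uv; apply/asboolP; apply: cong_trans tu uv.
Qed.

Canonical congb_equivRel := EquivRelPack congb_equiv.

Definition presented := {eq_quot congb}.
HB.instance Definition _ := Choice.on presented.

Definition pclass (t : term) : presented := \pi_{eq_quot congb} t.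
Definition prepr (x : presented) : term := repr (x : {eq_quot congb}).
Definition pgen (g : X) : presented := pclass (Tgen g).

Lemma preprK x : pclass (prepr x) = x.
Proof. exact: reprK. Qed.

Lemma pclassP t u : pclass t = pclass u <-> cong t u.
Proof.
by split=> [/eqquotP/asboolP|tu] //; apply/eqquotP/asboolP.
Qed.

Lemma prepr_class t : cong (prepr (pclass t)) t.
Proof. by apply/pclassP; rewrite preprK. Qed.

Definition pzero := pclass Tzero.
Definition popp x := pclass (Topp (prepr x)).
Definition padd x y := pclass (Tadd (prepr x) (prepr y)).
Definition pscale c x := pclass (Tscale c (prepr x)).
Definition plie x y := pclass (Tlie (prepr x) (prepr y)).

Lemma pclass_opp t : popp (pclass t) = pclass (Topp t).
Proof. by apply/pclassP; apply: cong_opp; apply: prepr_class. Qed.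
Lemma pclass_add t u : padd (pclass t) (pclass u) = pclass (Tadd t u).
Proof. by apply/pclassP; apply: cong_add; apply: prepr_class. Qed.
Lemma pclass_scale c t : pscale c (pclass t) = pclass (Tscale c t).
Proof. by apply/pclassP; apply: cong_scale; apply: prepr_class. Qed.
Lemma pclass_lie t u : plie (pclass t) (pclass u) = pclass (Tlie t u).
Proof. by apply/pclassP; apply: cong_lie; apply: prepr_class. Qed.

Let pE := (pclass_opp, pclass_add, pclass_scale, pclass_lie).

Lemma paddA : associative padd.
Proof.
move=> x y z; rewrite -[x]preprK -[y]preprK -[z]preprK !pE.
exact/pclassP/cong_addA.
Qed.
Lemma paddC : commutative padd.
Proof.
by move=> x y; rewrite -[x]preprK -[y]preprK !pE; apply/pclassP/cong_addC.
Qed.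
Lemma padd0 : left_id pzero padd.
Proof. by move=> x; rewrite -[x]preprK /pzero !pE; apply/pclassP/cong_add0. Qed.
Lemma paddN : left_inverse pzero popp padd.
Proof. by move=> x; rewrite -[x]preprK /pzero !pE; apply/pclassP/cong_addN. Qed.

HB.instance Definition _ :=
  GRing.isZmodule.Build presented paddA paddC padd0 paddN.

Lemma pscaleA a b x : pscale a (pscale b x) = pscale (a * b) x.
Proof. by rewrite -[x]preprK !pE; apply/pclassP/cong_scaleA. Qed.
Lemma pscale1 : left_id 1 pscale.
Proof. by move=> x; rewrite -[x]preprK !pE; apply/pclassP/cong_scale1. Qed.
Lemma pscaleDr : right_distributive pscale +%R.
Proof.
move=> a x y; rewrite -[x]preprK -[y]preprK.
by rewrite /GRing.add /= !pE; apply/pclassP/cong_scaleDr.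
Qed.
Lemma pscaleDl x : {morph pscale^~ x : a b / a + b}.
Proof.
move=> a b; rewrite -[x]preprK [in RHS]/GRing.add /= !pE.
exact/pclassP/cong_scaleDl.
Qed.

HB.instance Definition _ :=
  GRing.Zmodule_isLmodule.Build K presented pscaleA pscale1 pscaleDr pscaleDl.

Lemma plieDl (x y z : presented) : plie (x + y) z = plie x z + plie y z.
Proof.
rewrite -[x]preprK -[y]preprK -[z]preprK /GRing.add /= !pE.
exact/pclassP/cong_lieDl.
Qed.
Lemma plieDr (x y z : presented) : plie z (x + y) = plie z x + plie z y.
Proof.
rewrite -[x]preprK -[y]preprK -[z]preprK /GRing.add /= !pE.
exact/pclassP/cong_lieDr.
Qed.
Lemma plieZl c (x y : presented) : plie (c *: x) y = c *: plie x y.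
Proof.
rewrite -[x]preprK -[y]preprK /GRing.scale /= !pE.
exact/pclassP/cong_lieZl.
Qed.
Lemma plieZr c (x y : presented) : plie x (c *: y) = c *: plie x y.
Proof.
rewrite -[x]preprK -[y]preprK /GRing.scale /= !pE.
exact/pclassP/cong_lieZr.
Qed.
Lemma pliexx (x : presented) : plie x x = 0.
Proof. by rewrite -[x]preprK !pE; apply/pclassP/cong_liexx. Qed.
Lemma pjacobi (x y z : presented) :
  plie x (plie y z) + plie y (plie z x) + plie z (plie x y) = 0.
Proof.
rewrite -[x]preprK -[y]preprK -[z]preprK /GRing.add /= !pE.
exact/pclassP/cong_jacobi.
Qed.

HB.instance Definition _ :=
  Lmodule_isLieAlgebra.Build K presented plieDl plieDr plieZl plieZr
    pliexx pjacobi.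

End Presentation.

Arguments Tgen {K X}.
Arguments Tzero {K X}.
Arguments pclass {K X relators}.
Arguments pgen {K X} relators.

(* Kac-Moody algebra of a matrix A, following Kac.  When det A != 0, the
   simple coroots form a basis of the Cartan subalgebra, so the latter needs no
   generators other than the coroots; A is only used in that case. *)
Section KacMoody.
Variables (K : fieldType) (n : nat) (A : 'M[int]_n).

Inductive chevalley := Ce of 'I_n | Cf of 'I_n | Ch of 'I_n.

Let e i : term K chevalley := Tgen (Ce i).
Let f i : term K chevalley := Tgen (Cf i).
Let h i : term K chevalley := Tgen (Ch i).

Inductive km_tilde_rel : term K chevalley -> term K chevalley -> Prop :=
  | km_hh i j : km_tilde_rel (Tlie (h i) (h j)) Tzero
  | km_ef i j :
      km_tilde_rel (Tlie (e i) (f j)) (if i == j then h i else Tzero)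
  | km_he i j :
      km_tilde_rel (Tlie (h i) (e j)) (Tscale (A i j)%:~R (e j))
  | km_hf i j :
      km_tilde_rel (Tlie (h i) (f j)) (Tscale (- (A i j)%:~R) (f j)).

Definition km_tilde := presented km_tilde_rel.

Definition km_tilde_cartan (c : 'rV[K]_n) : km_tilde :=
  \sum_i c 0 i *: pgen km_tilde_rel (Ch i).

(* No Serre relations: as in Kac's definition, one divides by the largest ideal
   meeting the Cartan subalgebra trivially.  Here every element of every such
   ideal is killed, i.e., one divides by the sum of these ideals. *)
Inductive km_rel : term K chevalley -> term K chevalley -> Prop :=
  | km_tildeW t u : km_tilde_rel t u -> km_rel t u
  | km_radical (I : km_tilde -> Prop) t :
      lie_ideal I ->
      (forall c, I (km_tilde_cartan c) -> km_tilde_cartan c = 0) ->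
      I (pclass t) -> km_rel t Tzero.

Definition kac_moody := presented km_rel.

Definition cartan (c : 'rV[K]_n) : kac_moody :=
  \sum_i c 0 i *: pgen km_rel (Ch i).

(* A vector v of rationals stands for the element \sum_j v_j alpha_j of the
   rational span of the simple roots; its value at h_i is \sum_j v_j A_(i, j),
   since alpha_j (h_i) = A_(i, j). *)
Definition weight_eval (v : 'rV[rat]_n) (c : 'rV[K]_n) : K :=
  \sum_i \sum_j c 0 i * ratr (v 0 j) * (A i j)%:~R.

Definition root_space (v : 'rV[rat]_n) (x : kac_moody) :=
  forall c, lie (cartan c) x = weight_eval v c *: x.

Definition is_root (v : 'rV[rat]_n) :=
  v != 0 /\ exists2 x, root_space v x & x != 0.

End KacMoody.

Definition rank2_cartan_matrix (a : nat) : 'M[int]_2 :=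
  \matrix_(i, j) (if i == j then 2 else - a%:Z).

Definition H (R : realType) (a : nat) : lieAlgType (complex R) :=
  kac_moody (complex R) (rank2_cartan_matrix a).

Section QuadraticField.
Variables (R : realType) (p : nat).

Let sqrtp : R := Num.sqrt p%:R.

Definition in_F (x : R) := exists u v : rat, x = ratr u + ratr v * sqrtp.

Definition in_O (x : R) := in_F x /\ integralOver (intr : int -> R) x.

Definition unit_O (x : R) := [/\ x != 0, in_O x & in_O x^-1].

Definition fundamental_unit (eps : R) :=
  [/\ 1 < eps, unit_O eps &
      forall x, unit_O x -> exists m : int, x = eps ^ m \/ x = - eps ^ m].

Definition pell_solution (a s : nat) :=
  [/\ (0 < a)%N, (0 < s)%N & (a ^ 2 = p * s ^ 2 + 4)%N].

(* Sequences are indexed by nat; their terms of index 0 are irrelevant. *)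
Variables a s : nat -> nat.

Definition eta (k : nat) : R :=
  if k == 0%N then 1 else ((a k)%:R + (s k)%:R * sqrtp) / 2.

Definition pell_enumeration (eps : R) :=
  [/\ forall k, (0 < k)%N -> pell_solution (a k) (s k),
      forall b t, pell_solution b t ->
        exists2 k, (0 < k)%N & (a k, s k) = (b, t) &
      forall k, (0 < k)%N ->
        eta k = eps ^+ (if (p %% 4 == 1)%N then 2 * k else k)].

Definition psi (k : nat) (v : 'rV[rat]_2) : R :=
  ratr (v 0 0) * (eta k / sqrtp) - ratr (v 0 1) * sqrtp^-1.

(* The linear map g sends each root space beta into the root space alpha for
   the unique alpha such that psi_l(beta) = u * psi_k(alpha). *)
Definition maps_root_spaces (k l : nat) (g : H R (a l) -> H R (a k)) (u : R) :=
  forall beta, is_root (complex R) (rank2_cartan_matrix (a l)) beta ->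
  exists alpha,
    [/\ forall alpha', psi l beta = u * psi k alpha' <-> alpha' = alpha,
        is_root (complex R) (rank2_cartan_matrix (a k)) alpha &
        forall x : H R (a l),
          root_space beta x -> root_space alpha (g x)].

End QuadraticField.

(* Main.v *)
From HB Require Import structures.
Require Import Defs.
From mathcomp Require Import all_boot all_order all_algebra.
From mathcomp Require Import boolp reals complex.
From mathcomp Require Import ring zify.

(** Write [H a] for the algebra of parameter [a] and put [m = l / k]. The real
    roots of [H (a k)] correspond under [psi k] to the elements
    [eta k ^ i / sqrt p] and their opposites, with [i] an integer; in coordinates
    they are pairs of consecutive Chebyshev polynomials [cheb]. Choose two positive
    ones whose images have quotient [- eta k ^ m = - eta l], which is the quotient
    of the images under [psi l] of the simple roots of [H (a l)]. Their Gram matrix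
    is the Cartan matrix of [H (a l)], and their difference is not a root. So real
    root vectors for them and for their opposites satisfy the defining relations of
    [H (a l)], except that one has to see that they kill the radical, the largest
    ideal that meets the Cartan subalgebra trivially. Injectivity is then automatic:
    the coroots of the two roots are independent, so the kernel is an ideal that
    meets the Cartan subalgebra trivially ([km_embedding]). All of this is carried
    out for symmetric Cartan matrices with nonzero determinant; rank two only enters
    with the choice of the roots.

    That the radical is killed is the theorem of Gabber and Kac, in the form
    [radical_integrable]: a homomorphism defined on the algebra without Serre
    relations kills the radical as soon as its target has no lowest weight vectors
    of positive weight for the images of the generators. The latter holds since
    real root vectors are locally nilpotent: simple ones by the Serre relations
    ([serre_radical]), the others because automorphisms that lift the simple
    reflections carry simple root vectors to them ([real_root_reflect]).

    The proof of [radical_integrable] rests on the standard cobracket of the Borel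
    subalgebra. With the invariant form, it is dual to the bracket of the opposite
    subalgebra; so the cobracket of an element of the radical is a sum of tensors
    with a factor in the radical ([tensor_radical]). On the other hand, bracket
    after cobracket is a derivation, hence a scalar on each weight space, and the
    part that does not involve the Cartan subalgebra gives the scalar
    [2 (rho, a) - (a, a)] on the space of weight [a] ([cobracket_tensor]). By
    induction on the degree, a radical element [x] of weight [a] is therefore
    killed unless this scalar is zero. If it is, [a] has positive norm and so is
    positive on some simple coroot; since the corresponding lowering operator takes
    [x] to a radical element of lower degree, which is killed, the image of [x] is a
    lowest weight vector of positive weight, so it is zero too ([radical_word]).

    This needs the invariant form on the algebra without Serre relations. Its graph,
    a set of pairs of a vector and a linear form, is generated from the pairs that
    the values on Chevalley generators prescribe; it is the graph of a map since a
    form in it is determined on generators by the vector ([graph_gens]). The forms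
    to start from exist because Verma modules, modelled on functions of words, give
    coordinates on the Cartan subalgebra ([tilde_coordinates]). *)

Set Implicit Arguments.
Unset Strict Implicit.
Unset Printing Implicit Defensive.

Import Order.TTheory GRing.Theory Num.Theory.
Local Open Scope ring_scope.

(** * Lie algebras *)

Section LieBasics.
Variables (K : pzRingType) (L : lieAlgType K).
Implicit Types x y z : L.

Lemma lie0l x : lie 0 x = 0.
Proof. by have := lieZl 0 0 x; rewrite !scale0r. Qed.

Lemma lie0r x : lie x 0 = 0.
Proof. by have := lieZr 0 x 0; rewrite !scale0r. Qed.

Lemma lieNl x y : lie (- x) y = - lie x y.
Proof. by rewrite -scaleN1r lieZl scaleN1r. Qed.

Lemma lieNr x y : lie x (- y) = - lie x y.
Proof. by rewrite -scaleN1r lieZr scaleN1r. Qed.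

Lemma lieBl x y z : lie (x - y) z = lie x z - lie y z.
Proof. by rewrite lieDl lieNl. Qed.

Lemma lieBr x y z : lie z (x - y) = lie z x - lie z y.
Proof. by rewrite lieDr lieNr. Qed.

Lemma lieC x y : lie x y = - lie y x.
Proof.
apply/eqP; rewrite -subr_eq0 opprK; apply/eqP.
by have := liexx (x + y); rewrite lieDl !lieDr !liexx add0r addr0.
Qed.

(** The Jacobi identity, as the statement that bracketing is a derivation. *)
Lemma lieA x y z : lie x (lie y z) = lie (lie x y) z + lie y (lie x z).
Proof.
have /eqP := jacobi x y z.
rewrite -addrA addr_eq0 => /eqP ->.
by rewrite (lieC z x) (lieC z (lie x y)) lieNr opprD !opprK addrC.
Qed.

Lemma lie_suml I (r : seq I) (P : pred I) F y :
  lie (\sum_(i <- r | P i) F i) y = \sum_(i <- r | P i) lie (F i) y.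
Proof.
exact: (big_morph (fun x => lie x y) (fun a b => lieDl a b y) (lie0l y)).
Qed.

Lemma lie_sumr I (r : seq I) (P : pred I) F y :
  lie y (\sum_(i <- r | P i) F i) = \sum_(i <- r | P i) lie y (F i).
Proof.
exact: (big_morph (lie y) (fun a b => lieDr a b y) (lie0r y)).
Qed.

Definition subspace (S : L -> Prop) :=
  [/\ S 0, forall x y, S x -> S y -> S (x + y) &
      forall (c : K) x, S x -> S (c *: x)].

Lemma subspaceN S x : subspace S -> S x -> S (- x).
Proof. by case=> _ _ SZ Sx; rewrite -scaleN1r; apply: SZ. Qed.

Lemma subspaceB S x y : subspace S -> S x -> S y -> S (x - y).
Proof. by move=> SS Sx Sy; case: (SS) => _ + _; apply=> //; apply: subspaceN. Qed.

Lemma subspace_sum S I (r : seq I) (P : pred I) F :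
  subspace S -> (forall i, P i -> S (F i)) -> S (\sum_(i <- r | P i) F i).
Proof. by case=> S0 SD _ SF; elim/big_ind: _. Qed.

Definition subalgebra (S : L -> Prop) :=
  subspace S /\ forall x y, S x -> S y -> S (lie x y).

Lemma lie_ideal_subspace I : lie_ideal I -> subspace I.
Proof. by case. Qed.

(** This is what makes it enough to test the stability of a subspace on
    generators. *)
Lemma stabilizer_subalgebra (S : L -> Prop) :
  subspace S -> subalgebra (fun u => forall x, S x -> S (lie u x)).
Proof.
move=> SS; case: (SS) => S0 SD SZ; split; first split.
- by move=> x _; rewrite lie0l.
- by move=> u v Su Sv x Sx; rewrite lieDl; apply: SD; [apply: Su|apply: Sv].
- by move=> c u Su x Sx; rewrite lieZl; apply/SZ/Su.
move=> u v Su Sv x Sx.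
have -> : lie (lie u v) x = lie u (lie v x) - lie v (lie u x).
  by rewrite lieA addrK.
by apply: subspaceB => //; [apply/Su/Sv|apply/Sv/Su].
Qed.

Lemma subspace0 : subspace (fun x : L => x = 0).
Proof.
split=> [//|x y -> ->|c x ->]; first by rewrite addr0.
by rewrite scaler0.
Qed.

End LieBasics.

(** * Lie algebras given by generators and relations *)

Section Universal.
Variables (K : comNzRingType) (X : Type) (rel : term K X -> term K X -> Prop).

Lemma presented_addE t u :
  pclass (Tadd t u) = pclass t + pclass u :> presented rel.
Proof. by rewrite -pclass_add. Qed.

Lemma presented_oppE t : pclass (Topp t) = - pclass t :> presented rel.
Proof. by rewrite -pclass_opp. Qed.

Lemma presented_scaleE c t :
  pclass (Tscale c t) = c *: pclass t :> presented rel.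
Proof. by rewrite -pclass_scale. Qed.

Lemma presented_lieE t u :
  pclass (Tlie t u) = lie (pclass t) (pclass u) :> presented rel.
Proof. by rewrite /lie /= pclass_lie. Qed.

Lemma presented_0E : pclass Tzero = 0 :> presented rel.
Proof. by []. Qed.

Definition presentedE := (presented_addE, presented_oppE, presented_scaleE,
  presented_lieE, presented_0E).

Lemma presented_ind (S : presented rel -> Prop) :
  subalgebra S -> (forall g, S (pgen rel g)) -> forall x, S x.
Proof.
move=> [SS SL] Sg x; rewrite -[x]preprK.
case: (SS) => S0 SD SZ.
elim: (prepr x) => [g|//|t St|t St u Su|c t St|t St u Su].
- exact: Sg.
- by rewrite presentedE; apply: subspaceN.
- by rewrite presentedE; apply: SD.
- by rewrite presentedE; apply: SZ.
- by rewrite presentedE; apply: SL.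
Qed.

Variables (M : lieAlgType K) (g : X -> M).

Fixpoint eval (t : term K X) : M :=
  match t with
  | Tgen x => g x
  | Tzero => 0
  | Topp t => - eval t
  | Tadd t u => eval t + eval u
  | Tscale c t => c *: eval t
  | Tlie t u => lie (eval t) (eval u)
  end.

Hypothesis eval_rel : forall t u, rel t u -> eval t = eval u.

Lemma eval_cong t u : cong rel t u -> eval t = eval u.
Proof.
elim=> //= {t u}.
- by move=> t u v _ -> _ ->.
- by move=> t t' _ ->.
- by move=> t t' u u' _ -> _ ->.
- by move=> c t t' _ ->.
- by move=> t t' u u' _ -> _ ->.
- by move=> t u v; rewrite addrA.
- by move=> t u; rewrite addrC.
- by move=> t; rewrite add0r.
- by move=> t; rewrite addNr.
- by move=> a b t; rewrite scalerA.
- by move=> t; rewrite scale1r.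
- by move=> a t u; rewrite scalerDr.
- by move=> a b t; rewrite scalerDl.
- by move=> t u v; rewrite lieDl.
- by move=> t u v; rewrite lieDr.
- by move=> a t u; rewrite lieZl.
- by move=> a t u; rewrite lieZr.
- by move=> t; rewrite liexx.
- by move=> t u v; rewrite jacobi.
Qed.

Lemma presented_universal : exists phi : {linear presented rel -> M},
  (forall x y, phi (lie x y) = lie (phi x) (phi y)) /\
  (forall t, phi (pclass t) = eval t).
Proof.
pose f (x : presented rel) := eval (prepr x).
have fE t : f (pclass t) = eval t by apply/eval_cong/prepr_class.
have f_lin : linear f.
  move=> c x y; rewrite -[x]preprK -[y]preprK -presented_scaleE.
  by rewrite -presented_addE !fE.
pose phi : {linear presented rel -> M} :=
  HB.pack f (GRing.isLinear.Build _ _ _ _ f f_lin).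
exists phi.
split=> [x y|t] //=.
by rewrite -[x]preprK -[y]preprK -presented_lieE !fE.
Qed.

End Universal.

(** * Chevalley generators and the triangular decomposition *)

Section Weights.
Variables (n : nat) (A : 'M[int]_n).
Implicit Types a b : 'rV[int]_n.

Definition simple_root (i : 'I_n) : 'rV[int]_n := delta_mx 0 i.

(** The value of the weight [a] on the simple coroot [k]. *)
Definition pairing (k : 'I_n) a : int := \sum_j A k j * a 0 j.

Definition weight_form a b : int := \sum_i a 0 i * pairing i b.

Lemma pairingD k a b : pairing k (a + b) = pairing k a + pairing k b.
Proof.
by rewrite /pairing -big_split; apply: eq_bigr => j _; rewrite mxE mulrDr.
Qed.

Lemma pairingN k a : pairing k (- a) = - pairing k a.
Proof.
by rewrite /pairing -sumrN; apply: eq_bigr => j _; rewrite mxE mulrN.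
Qed.

Lemma pairing0 k : pairing k 0 = 0.
Proof. by rewrite /pairing big1 // => j _; rewrite mxE mulr0. Qed.

Lemma pairing_simple k i : pairing k (simple_root i) = A k i.
Proof.
rewrite /pairing (bigD1 i) //= mxE !eqxx mulr1 big1 ?addr0 // => j /negPf ji.
by rewrite mxE ji andbF mulr0.
Qed.

Lemma weight_form_simplel i b : weight_form (simple_root i) b = pairing i b.
Proof.
rewrite /weight_form (bigD1 i) //= mxE !eqxx mul1r big1 ?addr0 // => j /negPf ji.
by rewrite mxE ji andbF mul0r.
Qed.

Lemma weight_formDl a b c : weight_form (a + b) c = weight_form a c + weight_form b c.
Proof.
by rewrite /weight_form -big_split; apply: eq_bigr => j _; rewrite mxE mulrDl.
Qed.

Lemma weight_formDr a b c : weight_form c (a + b) = weight_form c a + weight_form c b.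
Proof.
by rewrite /weight_form -big_split; apply: eq_bigr => j _; rewrite pairingD mulrDr.
Qed.

Lemma weight_formC a b : (forall i j, A i j = A j i) -> weight_form a b = weight_form b a.
Proof.
move=> symA; rewrite /weight_form /pairing.
under eq_bigr do rewrite mulr_sumr; rewrite exchange_big /=.
apply: eq_bigr => j _; rewrite mulr_sumr; apply: eq_bigr => i _.
by rewrite (symA i j) mulrC mulrAC mulrC.
Qed.

(** A weight is determined by its values on the coroots, which is where the
    determinant matters: the coroots then suffice to tell weights apart. *)
Lemma pairing_inj : \det A != 0 -> injective (fun a k => pairing k a).
Proof.
move=> detA a b eqab; apply/eqP; rewrite -subr_eq0; apply/eqP.
set v := a - b.
have Av : A *m v^T = 0.
  apply/matrixP=> k j; rewrite !mxE ord1.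
  transitivity (pairing k v); first by apply: eq_bigr => i _; rewrite !mxE.
  by rewrite pairingD pairingN (congr1 (fun u => u k) eqab) subrr.
have : \adj A *m (A *m v^T) = 0 by rewrite Av mulmx0.
rewrite mulmxA mul_adj_mx mul_scalar_mx => /matrixP dv.
apply/rowP=> j; have := dv j 0; rewrite !mxE => /eqP.
by rewrite mulf_eq0 (negPf detA) => /eqP.
Qed.

End Weights.

Section Chevalley.
Variables (K : fieldType) (n : nat) (A : 'M[int]_n) (M : lieAlgType K).
Implicit Types (e f h : 'I_n -> M) (x y z : M).

Record chevalley_gens e f h : Prop := ChevalleyGens {
  gens_hh : forall i j, lie (h i) (h j) = 0;
  gens_ef : forall i j, lie (e i) (f j) = if i == j then h i else 0;
  gens_he : forall i j, lie (h i) (e j) = (A i j)%:~R *: e j;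
  gens_hf : forall i j, lie (h i) (f j) = (- (A i j)%:~R) *: f j }.

(** Exchanging positive and negative generators turns every statement about
    positive weights into one about negative weights. *)
Lemma gens_swap e f h : chevalley_gens e f h -> chevalley_gens f e (\- h).
Proof.
move=> [hh ef he hf]; split=> i j /=.
- by rewrite lieNl lieNr hh !oppr0.
- by rewrite lieC ef eq_sym; case: eqP => [->|]; rewrite ?oppr0.
- by rewrite lieNl hf scaleNr opprK.
- by rewrite lieNl he scaleNr.
Qed.

Lemma opp_fun2 h : (\- (\- h)) = h.
Proof. by apply/funext=> i /=; rewrite opprK. Qed.

Definition generated e f h := forall S : M -> Prop, subalgebra S ->
  (forall i, [/\ S (e i), S (f i) & S (h i)]) -> forall x, S x.

Lemma generated_swap e f h : generated e f h -> generated f e (\- h).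
Proof.
move=> gen S SS Sg; apply: gen => // i; have [Sf Se Sh] := Sg i; split=> //.
by rewrite -[h i]opprK; apply: subspaceN => //; case: SS.
Qed.

Lemma generated_stable e f h (S : M -> Prop) : generated e f h ->
  subspace S ->
  (forall i x, S x -> [/\ S (lie (e i) x), S (lie (f i) x) & S (lie (h i) x)]) ->
  forall u x, S x -> S (lie u x).
Proof.
move=> gen SS Sg; apply: gen; first exact: stabilizer_subalgebra.
by move=> i; split=> x Sx; have [] := Sg i x Sx.
Qed.

Lemma generated_total e f h (S : M -> Prop) : generated e f h ->
  subspace S -> (forall i, [/\ S (e i), S (f i) & S (h i)]) ->
  (forall i x, S x -> [/\ S (lie (e i) x), S (lie (f i) x) & S (lie (h i) x)]) ->
  forall x, S x.
Proof.
move=> gen SS Sg Sst; apply: (gen) => //; split=> // x y _.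
exact: (generated_stable gen SS Sst).
Qed.

(** Zero counts as a vector of every weight, so that the vectors of a given
    weight form a subspace. *)
Definition weight_vector h (a : 'rV[int]_n) x :=
  forall k, lie (h k) x = (pairing A k a)%:~R *: x.

Lemma weight_subspace h a : subspace (weight_vector h a).
Proof.
split=> [k|x y wx wy k|c x wx k]; first by rewrite lie0r scaler0.
  by rewrite lieDr wx wy scalerDr.
by rewrite lieZr wx !scalerA mulrC.
Qed.

Lemma weight_lie h a b x y : weight_vector h a x -> weight_vector h b y ->
  weight_vector h (a + b) (lie x y).
Proof.
move=> wx wy k.
by rewrite lieA wx wy lieZl lieZr -scalerDl pairingD intrD.
Qed.

Lemma weight_swap h a x :
  weight_vector (\- h) a x <-> weight_vector h (- a) x.
Proof.
split=> wx k; have := wx k; rewrite lieNl pairingN mulrNz scaleNr.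
  by move=> <-; rewrite opprK.
by move=> ->; rewrite opprK.
Qed.

(** Brackets are nested to the right: by the Jacobi identity, such brackets span
    the subalgebra generated by the [e i]. The index is one less than the number
    of letters, which excludes the empty word; like the weight, it is arbitrary
    for [0], so that the elements of a given index and weight form a subspace. *)
Inductive word e : nat -> 'rV[int]_n -> M -> Prop :=
  | word_gen i : word e 0 (simple_root i) (e i)
  | word_0 k a : word e k a 0
  | word_add k a x y : word e k a x -> word e k a y -> word e k a (x + y)
  | word_scale k a c x : word e k a x -> word e k a (c *: x)
  | word_lie i k a x :
      word e k a x -> word e k.+1 (a + simple_root i) (lie (e i) x).

(** The elements of lower degree in inductions on the degree; the terms of a sum
    may have different weights. *)
Inductive words e (k : nat) : M -> Prop :=
  | words_0 : words e k 0
  | words_add j a x y :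
      (j < k)%N -> word e j a x -> words e k y -> words e k (x + y).

Lemma word_words e j k a x : (j < k)%N -> word e j a x -> words e k x.
Proof.
by move=> jk wx; rewrite -[x]addr0; apply: words_add jk wx _; apply: words_0.
Qed.

Lemma wordsW e j k x : (j <= k)%N -> words e j x -> words e k x.
Proof.
move=> jk; elim=> [|i a {}x y ij wx _]; first exact: words_0.
exact: words_add (leq_trans ij jk) wx.
Qed.

Lemma words_subspace e k : subspace (words e k).
Proof.
split; first exact: words_0.
- move=> x y; elim=> [|j a {}x z jk wx _ IH] wy; first by rewrite add0r.
  by rewrite -addrA; apply: words_add jk wx (IH wy).
- move=> c x; elim=> [|j a {}x z jk wx _ IH]; first by rewrite scaler0; left.
  by rewrite scalerDr; apply: words_add jk (word_scale c wx) IH.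
Qed.

Lemma words_lie e k i x : words e k x -> words e k.+1 (lie (e i) x).
Proof.
elim=> [|j a {}x y jk wx _ IH]; first by rewrite lie0r; left.
by rewrite lieDr; apply: words_add IH; last exact: word_lie wx.
Qed.

(** The subalgebra generated by the [e i]. *)
Definition npart e x := exists k, words e k x.

Lemma npart_word e k a x : word e k a x -> npart e x.
Proof. by move=> wx; exists k.+1; apply: word_words wx. Qed.

Lemma npart_subspace e : subspace (npart e).
Proof.
split; first by exists 0%N; left.
- move=> x y [k wx] [j wy]; exists (k + j)%N.
  have [_ D _] := words_subspace e (k + j).
  by apply: D; [apply: wordsW wx|apply: wordsW wy]; rewrite ?leq_addr ?leq_addl.
- by move=> c x [k wx]; exists k; have [_ _ Z] := words_subspace e k; apply: Z.
Qed.

Lemma npart_gen e i : npart e (e i).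
Proof. exact: npart_word (word_gen e i). Qed.

Lemma npart_lie e i x : npart e x -> npart e (lie (e i) x).
Proof. by case=> k wx; exists k.+1; apply: words_lie. Qed.

Lemma npart_ind e (S : M -> Prop) : subspace S ->
  (forall i, S (e i)) ->
  (forall i x, npart e x -> S x -> S (lie (e i) x)) ->
  forall x, npart e x -> S x.
Proof.
move=> [S0 SD SZ] Sg Sl.
suff Sw k a x : word e k a x -> S x.
  by move=> x [k]; elim=> [//|j a {}x y _ /Sw Sx _ Sy]; apply: SD.
elim=> // {k a x}; [by move=> *; apply: SD|by move=> *; apply: SZ|].
by move=> i k a x /npart_word nx Sx; apply: Sl.
Qed.

Section Gens.
Variables (e f h : 'I_n -> M).
Hypothesis gens : chevalley_gens e f h.

Lemma word_weight k a x : word e k a x -> weight_vector h a x.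
Proof.
elim=> {k a x}.
- by move=> i k; rewrite (gens_he gens) pairing_simple.
- by move=> k a; case: (weight_subspace h a).
- by move=> k a x y _ wx _ wy; case: (weight_subspace h a) => _ + _; apply.
- by move=> k a c x _ wx; case: (weight_subspace h a) => _ _; apply.
- move=> i k a x _ wx; rewrite addrC; apply: weight_lie => // j.
  by rewrite (gens_he gens) pairing_simple.
Qed.

Lemma words_lieh j k x : words e k x -> words e k (lie (h j) x).
Proof.
have [_ D Z] := words_subspace e k.
elim=> [|i a {}x y ik wx _ IH]; first by rewrite lie0r; left.
rewrite lieDr; apply: (D) => //; rewrite (word_weight wx).
exact/Z/word_words/wx.
Qed.

Lemma npart_lieh k x : npart e x -> npart e (lie (h k) x).
Proof. by case=> m wx; exists m; apply: words_lieh. Qed.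

Lemma words_lieef i j k x c y : words e k.+1 x ->
  lie (f i) x = c *: h i + y -> words e k y ->
  words e k.+1 (lie (f i) (lie (e j) x)).
Proof.
move=> wx fx wy; rewrite lieA fx lieDr.
have [_ D Z] := words_subspace e k.+1.
apply: (D); last apply: (D); last exact: words_lie.
  rewrite (lieC (f i) (e j)) (gens_ef gens) lieNl; case: eqP => _; last first.
    by rewrite lie0l oppr0; left.
  rewrite -scaleN1r; apply: (Z); exact: words_lieh.
rewrite lieZr (lieC (e j)) (gens_he gens) -scaleNr.
by apply/Z/Z; apply: word_words (ltn0Sn k) (word_gen e j).
Qed.

(** Lowering loses one letter; the last letter leaves a coroot. *)
Lemma word_lower i k a x : word e k a x ->
  exists c y, lie (f i) x = c *: h i + y /\ words e k y.
Proof.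
elim=> {k a x}.
- move=> j; exists (if j == i then -1 else 0), 0; split; last by left.
  rewrite (lieC (f i)) (gens_ef gens) addr0; case: eqP => [->|_].
    by rewrite scaleN1r.
  by rewrite scale0r oppr0.
- by move=> k a; exists 0, 0; rewrite lie0r scale0r addr0; split=> //; left.
- move=> k a x y _ [c [u [fx wu]]] _ [d [v [fy wv]]]; exists (c + d), (u + v).
  rewrite lieDr fx fy addrACA -scalerDl; split=> //.
  by have [_ D _] := words_subspace e k; apply: D.
- move=> k a c x _ [d [u [fx wu]]]; exists (c * d), (c *: u).
  rewrite lieZr fx scalerDr scalerA; split=> //.
  by have [_ _ Z] := words_subspace e k; apply: Z.
- move=> j k a x wx [c [u [fx wu]]]; exists 0, (lie (f i) (lie (e j) x)).
  rewrite scale0r add0r; split=> //.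
  apply: (@words_lieef _ _ _ _ c u) => //; exact: word_words wx.
Qed.

Lemma npart_lower i x : npart e x ->
  exists c y, lie (f i) x = c *: h i + y /\ npart e y.
Proof.
case=> m; elim=> [|j a {}x y _ wx _ [d [v [fy nv]]]].
  exists 0, 0; rewrite lie0r scale0r addr0; split=> //.
  by have [] := npart_subspace e.
have [c [u [fx wu]]] := word_lower i wx.
exists (c + d), (u + v); rewrite lieDr fx fy addrACA -scalerDl; split=> //.
by have [_ D _] := npart_subspace e; apply: D => //; exists j.
Qed.

Lemma npart_lieef i j x : npart e x -> npart e (lie (f i) (lie (e j) x)).
Proof.
move=> nx; have [c [y [fx ny]]] := npart_lower i nx.
rewrite lieA fx lieDr; have [_ D Z] := npart_subspace e.
apply: (D); last apply: (D); last exact: npart_lie.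
  rewrite (lieC (f i) (e j)) (gens_ef gens) lieNl.
  case: eqP => _; last by rewrite lie0l oppr0 -(scale0r x); apply: Z.
  by rewrite -scaleN1r; apply/Z/npart_lieh.
by rewrite lieZr (lieC (e j)) (gens_he gens) -scaleNr; apply/Z/Z/npart_gen.
Qed.

Definition cartan_part (x : M) := exists c : 'rV[K]_n, x = \sum_k c 0 k *: h k.

Lemma cartan_subspace : subspace cartan_part.
Proof.
split; first by exists 0; rewrite big1 // => k _; rewrite mxE scale0r.
- move=> _ _ [c ->] [d ->]; exists (c + d); rewrite -big_split /=.
  by apply: eq_bigr => k _; rewrite mxE scalerDl.
- move=> a _ [c ->]; exists (a *: c); rewrite scaler_sumr.
  by apply: eq_bigr => k _; rewrite mxE scalerA.
Qed.

Lemma cartan_gen k : cartan_part (h k).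
Proof.
exists (delta_mx 0 k); rewrite (bigD1 k) //= big1 ?addr0 => [|i ik].
  by rewrite mxE !eqxx scale1r.
by rewrite mxE (negPf ik) andbF scale0r.
Qed.

Lemma cartan_ind (S : M -> Prop) : subspace S -> (forall k, S (h k)) ->
  forall x, cartan_part x -> S x.
Proof.
move=> SS Sh _ [c ->]; apply: subspace_sum => // k _.
by have [_ _ Z] := SS; apply: Z.
Qed.

Lemma cartan_weight x : cartan_part x -> weight_vector h 0 x.
Proof.
apply: cartan_ind; first exact: weight_subspace.
by move=> k j; rewrite (gens_hh gens) pairing0 scale0r.
Qed.

End Gens.

(** ** Spanning by the three parts *)

Section Triangular.
Variables (e f h : 'I_n -> M).

Definition trisum x := exists u v w,
  [/\ x = u + v + w, npart f u, cartan_part h v & npart e w].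

Lemma trisum_subspace : subspace trisum.
Proof.
have [e0 eD eZ] := npart_subspace e; have [f0 fD fZ] := npart_subspace f.
have [h0 hD hZ] := cartan_subspace h; split.
- by exists 0, 0, 0; rewrite !addr0; split.
- move=> _ _ [u [v [w [-> nu cv nw]]]] [u' [v' [w' [-> nu' cv' nw']]]].
  exists (u + u'), (v + v'), (w + w').
  by split; [rewrite addrACA (addrACA u)|apply: fD|apply: hD|apply: eD].
- move=> c _ [u [v [w [-> nu cv nw]]]]; exists (c *: u), (c *: v), (c *: w).
  by split; [rewrite !scalerDr|apply: fZ|apply: hZ|apply: eZ].
Qed.

Lemma trisum_neg u : npart f u -> trisum u.
Proof.
move=> nu; exists u, 0, 0; rewrite !addr0; split=> //.
  by have [] := cartan_subspace h.
by have [] := npart_subspace e.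
Qed.

Lemma trisum_cartan v : cartan_part h v -> trisum v.
Proof.
move=> cv; exists 0, v, 0; rewrite addr0 add0r; split=> //.
  by have [] := npart_subspace f.
by have [] := npart_subspace e.
Qed.

Lemma trisum_pos w : npart e w -> trisum w.
Proof.
move=> nw; exists 0, 0, w; rewrite !add0r; split=> //.
  by have [] := npart_subspace f.
by have [] := cartan_subspace h.
Qed.

End Triangular.

Lemma cartan_swap h x : cartan_part h x -> cartan_part (\- h) x.
Proof.
move=> [c ->]; exists (- c); apply: eq_bigr => k _.
by rewrite mxE scaleNr scalerN opprK.
Qed.

Lemma trisum_swap e f h x : trisum e f h x -> trisum f e (\- h) x.
Proof.
move=> [u [v [w [-> nu /cartan_swap cv nw]]]]; exists w, v, u; split=> //.
by rewrite addrC addrA addrAC addrC addrA.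
Qed.

Lemma trisum_lower e f h i x : chevalley_gens e f h ->
  trisum e f h x -> trisum e f h (lie (f i) x).
Proof.
move=> gens [u [v [w [-> nu cv nw]]]]; rewrite !lieDr.
have [T0 D Z] := trisum_subspace e f h.
apply: (D); first apply: (D).
- exact/trisum_neg/npart_lie.
- apply: (cartan_ind (S := fun v => trisum e f h (lie (f i) v))) cv.
    split=> [|x1 x2 S1 S2|c x1 S1]; first by rewrite lie0r.
      by rewrite lieDr; apply: D.
    by rewrite lieZr; apply: Z.
  move=> k; rewrite lieC (gens_hf gens) -scaleNr.
  exact/Z/trisum_neg/npart_gen.
- have [c [y [-> ny]]] := npart_lower gens i nw.
  apply: D; last exact: trisum_pos ny.
  exact/Z/trisum_cartan/cartan_gen.
Qed.

Lemma trisum_weight e f h k x : chevalley_gens e f h ->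
  trisum e f h x -> trisum e f h (lie (h k) x).
Proof.
move=> gens [u [v [w [-> nu cv nw]]]]; rewrite !lieDr.
have [T0 D Z] := trisum_subspace e f h.
apply: (D); first apply: (D).
- have := npart_lieh (gens_swap gens) k nu; rewrite lieNl => nhu.
  by rewrite -[lie _ _]opprK -scaleN1r; apply/Z/trisum_neg.
- by rewrite (cartan_weight gens cv) pairing0 scale0r.
- exact/trisum_pos/(npart_lieh gens).
Qed.

(** Lowering a sum of three parts gives one, and so does raising, by symmetry;
    so these sums make up the whole algebra. *)
Theorem triangular_span e f h : chevalley_gens e f h -> generated e f h ->
  forall x, trisum e f h x.
Proof.
move=> gens gen; apply: (generated_total gen); first exact: trisum_subspace.
  move=> i; split; first exact/trisum_pos/npart_gen.
    exact/trisum_neg/npart_gen.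
  exact/trisum_cartan/cartan_gen.
move=> i x tx; split; last exact: trisum_weight.
  have := trisum_lower i (gens_swap gens) (trisum_swap tx).
  by move/trisum_swap; rewrite opp_fun2.
exact: trisum_lower.
Qed.

End Chevalley.

(** * Verma modules and coordinates on the Cartan subalgebra *)

Section Coordinates.
Variables (K : fieldType) (n : nat) (A : 'M[int]_n) (M : lieAlgType K).

(** Linear forms that project the triangular decomposition onto the Cartan
    part; their existence makes the simple coroots independent. *)
Record coordinates (e f h : 'I_n -> M) (p : 'I_n -> M -> K) : Prop :=
  Coordinates {
    coord_lin : forall k c x y, p k (c *: x + y) = c * p k x + p k y;
    coord_h : forall k j, p k (h j) = (j == k)%:R;
    coord_e : forall k x, npart e x -> p k x = 0;
    coord_f : forall k x, npart f x -> p k x = 0 }.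

Lemma coordinates_swap e f h p : coordinates e f h p ->
  coordinates f e (\- h) (fun k x => - p k x).
Proof.
move=> [lin ph pe pf].
have p0 k : p k 0 = 0.
  by have := lin k (-1) 0 0; rewrite scaler0 addr0 mulN1r addNr.
split=> [k c x y|k j|k x nx|k x nx].
- by rewrite lin opprD mulrN.
- have := lin k (-1) (h j) 0; rewrite !addr0 scaleN1r p0 addr0 mulN1r => ->.
  by rewrite opprK ph.
- by rewrite pf ?oppr0.
- by rewrite pe ?oppr0.
Qed.

End Coordinates.

Section Verma.
Variables (K : fieldType) (n : nat) (A : 'M[int]_n) (lam : 'I_n -> K).
Implicit Types (g : seq 'I_n -> K) (w : seq 'I_n) (t u : term K (chevalley n)).

Fixpoint word_pairing (k : 'I_n) w : K :=
  if w is j :: w' then (A k j)%:~R + word_pairing k w' else 0.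

(** The completed Verma module of highest weight [lam]: a function [g] stands
    for the formal sum of the [g w *: f_w], where [f_w] is the monomial in the
    [f i] spelled by [w], applied to the highest weight vector. *)
Definition verma_f (i : 'I_n) g w : K :=
  if w is j :: w' then (if j == i then g w' else 0) else 0.

Definition verma_h (k : 'I_n) g w : K := (lam k - word_pairing k w) * g w.

(** The coefficient of [f_w] in the image: the letter [i] that [e i] cancels
    stood in front of [w] or further inside. *)
Fixpoint verma_e (i : 'I_n) g w : K :=
  (lam i - word_pairing i w) * g (i :: w) +
  (if w is j :: w' then verma_e i (fun v => g (j :: v)) w' else 0).

Lemma verma_e_lin i c g g' w :
  verma_e i (fun v => c * g v + g' v) w = c * verma_e i g w + verma_e i g' w.
Proof. by elim: w g g' => [|j w IH] g g' /=; rewrite ?IH; ring. Qed.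

Lemma verma_e0 i w : verma_e i (fun=> 0) w = 0.
Proof. by elim: w => [|j w IH] /=; rewrite ?IH mulr0 addr0. Qed.

Lemma verma_e_vacuum i : verma_e i (fun w => (nilp w)%:R) = (fun=> 0).
Proof.
apply/funext=> -[|j w] /=; first by rewrite mulr0 addr0.
by rewrite mulr0 verma_e0 addr0.
Qed.

Lemma verma_e_ext i g g' w : g =1 g' -> verma_e i g w = verma_e i g' w.
Proof. by move/funext->. Qed.

Lemma verma_he k i g w :
  verma_h k (verma_e i g) w - verma_e i (verma_h k g) w =
  (A k i)%:~R * verma_e i g w.
Proof.
have H (d : K) : (d - word_pairing k w) * verma_e i g w -
   verma_e i (fun v => (d - word_pairing k v) * g v) w =
   (A k i)%:~R * verma_e i g w.
  elim: w d g => [|j w IH] d g /=; first by ring.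
  have := IH (d - (A k j)%:~R) (fun v => g (j :: v)).
  rewrite [X in _ - X](@verma_e_ext _ _ (fun v => (d - ((A k j)%:~R + word_pairing k v)) *
     g (j :: v))) => [E|v]; last by rewrite opprD addrA.
  by rewrite [RHS]mulrDr -E; ring.
exact: H.
Qed.

Lemma verma_hf k i g w :
  verma_h k (verma_f i g) w - verma_f i (verma_h k g) w =
  - (A k i)%:~R * verma_f i g w.
Proof.
case: w => [|j w] /=; first by rewrite /verma_h /=; ring.
by rewrite /verma_h /=; case: eqP => [->|_]; ring.
Qed.

Lemma verma_ef i j g w :
  verma_e i (verma_f j g) w - verma_f j (verma_e i g) w =
  if i == j then verma_h i g w else 0.
Proof.
case: w => [|k w] /=; first by rewrite /verma_h /=; case: eqP => _; ring.
rewrite /verma_h; case: (k =P j) => [->|_] /=; first by case: eqP => _; ring.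
by rewrite verma_e0; case: (i =P j) => [->|_]; ring.
Qed.


Fixpoint verma_act t : (seq 'I_n -> K) -> seq 'I_n -> K :=
  match t with
  | Tgen (Ce i) => verma_e i
  | Tgen (Cf i) => verma_f i
  | Tgen (Ch i) => verma_h i
  | Tzero => fun g w => 0
  | Topp t => fun g w => - verma_act t g w
  | Tadd t u => fun g w => verma_act t g w + verma_act u g w
  | Tscale c t => fun g w => c * verma_act t g w
  | Tlie t u => fun g w =>
      verma_act t (verma_act u g) w - verma_act u (verma_act t g) w
  end.

Lemma verma_act_ext t g g' w :
  g =1 g' -> verma_act t g w = verma_act t g' w.
Proof. by move/funext->. Qed.

Lemma verma_act_lin t c g g' w :
  verma_act t (fun v => c * g v + g' v) w =
  c * verma_act t g w + verma_act t g' w.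
Proof.
elim: t g g' w => [[i|i|i]||t IH|t IHt u IHu|d t IH|t IHt u IHu] g g' w /=.
- exact: verma_e_lin.
- by case: w => [|j w] /=; [ring|case: eqP => _; ring].
- by rewrite /verma_h; ring.
- by rewrite mulr0 addr0.
- by rewrite IH; ring.
- by rewrite IHt IHu; ring.
- by rewrite IH; ring.
- rewrite (verma_act_ext _ _ (IHu g g')) (verma_act_ext _ _ (IHt g g')).
  by rewrite IHt IHu; ring.
Qed.

Lemma verma_actD t g g' w :
  verma_act t (fun v => g v + g' v) w = verma_act t g w + verma_act t g' w.
Proof.
rewrite -[X in X + _]mul1r -verma_act_lin.
by apply: verma_act_ext => v; rewrite mul1r.
Qed.

Lemma verma_act0 t w : verma_act t (fun=> 0) w = 0.
Proof.
have := verma_act_lin t (-1) (fun=> 0) (fun=> 0) w.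
rewrite [X in _ = X + _]mulN1r [X in _ = X]addNr => E; rewrite -[RHS]E.
by apply: verma_act_ext => v; rewrite mulr0 addr0.
Qed.

Lemma verma_actZ t c g w :
  verma_act t (fun v => c * g v) w = c * verma_act t g w.
Proof.
rewrite -[RHS]addr0 -(verma_act0 t w) -verma_act_lin.
by apply: verma_act_ext => v; rewrite addr0.
Qed.

Lemma verma_actN t g w :
  verma_act t (fun v => - g v) w = - verma_act t g w.
Proof.
by rewrite -mulN1r -verma_actZ; apply: verma_act_ext => v; rewrite mulN1r.
Qed.

Lemma verma_cong t u :
  cong (@km_tilde_rel K n A) t u -> verma_act t = verma_act u.
Proof.
have D t' g g' : verma_act t' (fun v => g v + g' v) =
    fun w => verma_act t' g w + verma_act t' g' w.
  by apply/funext=> w; apply: verma_actD.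
have N t' g : verma_act t' (fun v => - g v) = fun w => - verma_act t' g w.
  by apply/funext=> w; apply: verma_actN.
have Z t' c g : verma_act t' (fun v => c * g v) = fun w => c * verma_act t' g w.
  by apply/funext=> w; apply: verma_actZ.
elim=> {t u} //.
- move=> t u [] /= i j; apply/funext=> g; apply/funext=> w /=.
  + by rewrite /verma_h; ring.
  + by rewrite verma_ef; case: eqP.
  + by rewrite verma_he.
  + by rewrite verma_hf.
- by move=> t u v _ -> _ ->.
- by move=> t t' _ /= ->.
- by move=> t t' u u' _ /= -> _ ->.
- by move=> c t t' _ /= ->.
- by move=> t t' u u' _ /= -> _ ->.
- by move=> t u v; apply/funext=> g; apply/funext=> w /=; ring.
- by move=> t u; apply/funext=> g; apply/funext=> w /=; ring.
- by move=> t; apply/funext=> g; apply/funext=> w /=; ring.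
- by move=> t; apply/funext=> g; apply/funext=> w /=; ring.
- by move=> a b t; apply/funext=> g; apply/funext=> w /=; ring.
- by move=> t; apply/funext=> g; apply/funext=> w /=; ring.
- by move=> a t u; apply/funext=> g; apply/funext=> w /=; ring.
- by move=> a b t; apply/funext=> g; apply/funext=> w /=; ring.
- by move=> t u v; apply/funext=> g; apply/funext=> w /=; rewrite D; ring.
- by move=> t u v; apply/funext=> g; apply/funext=> w /=; rewrite D; ring.
- by move=> a t u; apply/funext=> g; apply/funext=> w /=; rewrite Z; ring.
- by move=> a t u; apply/funext=> g; apply/funext=> w /=; rewrite Z; ring.
- by move=> t; apply/funext=> g; apply/funext=> w /=; ring.
- move=> t u v; apply/funext=> g; apply/funext=> w /=.
  by rewrite !D !N; ring.
Qed.

End Verma.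

Section KacMoodyGenerators.
Variables (K : fieldType) (n : nat) (A : 'M[int]_n).

Definition km_gen (rel : term K (chevalley n) -> term K (chevalley n) -> Prop)
    (g : 'I_n -> chevalley n) (i : 'I_n) : presented rel := pgen rel (g i).

Lemma presented_gens (rel : term K (chevalley n) -> term K (chevalley n) -> Prop) :
  (forall t u, km_tilde_rel A t u -> rel t u) ->
  chevalley_gens A (km_gen rel (@Ce n)) (km_gen rel (@Cf n))
    (km_gen rel (@Ch n)).
Proof.
move=> sub; split=> i j; rewrite /km_gen /pgen -presented_lieE.
- by rewrite -presented_0E; apply/pclassP/cong_rel/sub; constructor.
- rewrite (_ : (if _ then _ else _) =
    pclass (if i == j then Tgen (Ch i) else Tzero)); last by case: eqP.
  by apply/pclassP/cong_rel/sub; constructor.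
- by rewrite -presented_scaleE; apply/pclassP/cong_rel/sub; constructor.
- by rewrite -presented_scaleE; apply/pclassP/cong_rel/sub; constructor.
Qed.

Lemma presented_generated
    (rel : term K (chevalley n) -> term K (chevalley n) -> Prop) :
  generated (km_gen rel (@Ce n)) (km_gen rel (@Cf n)) (km_gen rel (@Ch n)).
Proof.
move=> S SS Sg; apply: presented_ind => // -[] i; have [Se Sf Sh] := Sg i;
  [exact: Se|exact: Sf|exact: Sh].
Qed.

Definition tilde_coord (k : 'I_n) (x : km_tilde K A) : K :=
  verma_act A (fun j => (j == k)%:R) (prepr x) (fun w => (nilp w)%:R) [::].

Lemma tilde_coord_class k t : tilde_coord k (pclass t) =
  verma_act A (fun j => (j == k)%:R) t (fun w => (nilp w)%:R) [::].
Proof. by rewrite /tilde_coord (verma_cong _ (prepr_class _ t)). Qed.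

(** The coefficient of the highest weight vector [v] in [x v], in the Verma
    modules whose highest weights are dual to the simple coroots. *)
Lemma tilde_coordinates :
  coordinates (km_gen (@km_tilde_rel K n A) (@Ce n))
    (km_gen (@km_tilde_rel K n A) (@Cf n))
    (km_gen (@km_tilde_rel K n A) (@Ch n)) tilde_coord.
Proof.
pose act k (x : km_tilde K A) := verma_act A (fun j => (j == k)%:R : K) (prepr x).
have actE k t : act k (pclass t) = verma_act A (fun j => (j == k)%:R) t.
  exact/verma_cong/prepr_class.
have actL k c x y g w : act k (c *: x + y) g w = c * act k x g w + act k y g w.
  by rewrite -[x]preprK -[y]preprK -presented_scaleE -presented_addE !actE.
have act_lie k x y g w :
    act k (lie x y) g w = act k x (act k y g) w - act k y (act k x g) w.
  by rewrite -[x]preprK -[y]preprK -presented_lieE !actE.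
have act0 k g w : act k 0 g w = 0 by rewrite -presented_0E actE.
have act_g0 k x w : act k x (fun=> 0) w = 0 by apply: verma_act0.
have lin_sub k (g : seq 'I_n -> K) w : subspace (fun x => act k x g w = 0).
  split=> [//|x y xg yg|c x xg].
    by rewrite -[x]scale1r actL xg yg mulr0 addr0.
  by rewrite -[_ *: _]addr0 actL xg act0 mulr0 addr0.
have actg k i g : act k (km_gen _ (@Ce n) i) g = verma_e A (fun j => (j == k)%:R) i g.
  by rewrite /km_gen /pgen actE.
split.
- by move=> k c x y; apply: actL.
- move=> k j; rewrite tilde_coord_class /= /verma_h /=.
  by rewrite subr0 mulr1.
- move=> k x nx; suff /(_ [::]) : forall w, act k x (fun w => (nilp w)%:R) w = 0 by [].
  move: x nx; apply: npart_ind.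
  + split=> [w|x y xg yg w|c x xg w].
    * exact: act0.
    * by have [_ D _] := lin_sub k (fun w => (nilp w)%:R) w; apply: D.
    * by have [_ _ Z] := lin_sub k (fun w => (nilp w)%:R) w; apply: Z.
  + by move=> i w; rewrite actg verma_e_vacuum.
  + move=> i x _ xg w; rewrite act_lie.
    have -> : act k x (fun w => (nilp w)%:R) = (fun=> 0) by apply/funext.
    rewrite act_g0 sub0r actg.
    by rewrite verma_e_vacuum act_g0 oppr0.
- move=> k x nx; suff /(_ (fun w => (nilp w)%:R)) : forall g, act k x g [::] = 0 by [].
  move: x nx; apply: npart_ind.
  + split=> [g|x y xg yg g|c x xg g].
    * exact: act0.
    * by have [_ D _] := lin_sub k g [::]; apply: D.
    * by have [_ _ Z] := lin_sub k g [::]; apply: Z.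
  + by move=> i g; rewrite /km_gen /pgen actE.
  + by move=> i x _ xg g; rewrite act_lie xg subr0 /km_gen /pgen actE.
Qed.

End KacMoodyGenerators.

(** * The invariant bilinear form *)

Section LinearForms.
Variables (K : fieldType) (M : lieAlgType K).
Implicit Types (x y z u v : M) (t s : M -> K).

Definition lin_form t := forall c x y, t (c *: x + y) = c * t x + t y.

Lemma lin_formD t x y : lin_form t -> t (x + y) = t x + t y.
Proof. by move=> lt; rewrite -[x]scale1r lt mul1r scale1r. Qed.

Lemma lin_form0 t : lin_form t -> t 0 = 0.
Proof. by move=> lt; have := lt (-1) 0 0; rewrite scaler0 addr0 mulN1r addNr. Qed.

Lemma lin_formZ t c x : lin_form t -> t (c *: x) = c * t x.
Proof. by move=> lt; rewrite -[_ *: _]addr0 lt lin_form0 ?addr0. Qed.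

Lemma lin_formN t x : lin_form t -> t (- x) = - t x.
Proof. by move=> lt; rewrite -scaleN1r lin_formZ ?mulN1r. Qed.

Lemma lin_form_ker t : lin_form t -> subspace (fun x => t x = 0).
Proof.
move=> lt; split=> [|x y tx ty|c x tx]; first exact: lin_form0.
  by rewrite lin_formD ?tx ?ty ?addr0.
by rewrite lin_formZ ?tx ?mulr0.
Qed.

Lemma lin_form_eq t s : lin_form t -> lin_form s ->
  subspace (fun x => t x = s x).
Proof.
move=> lt ls; split=> [|x y tx ty|c x tx]; first by rewrite !lin_form0.
  by rewrite !lin_formD ?tx ?ty.
by rewrite !lin_formZ ?tx.
Qed.

(** The coadjoint action. *)
Definition coact u t : M -> K := fun y => t (lie y u).

Lemma coact_lin u t : lin_form t -> lin_form (coact u t).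
Proof. by move=> lt c x y; rewrite /coact lieDl lieZl lt. Qed.

Lemma coact_lie u v t : lin_form t ->
  coact (lie u v) t = fun y => coact u (coact v t) y - coact v (coact u t) y.
Proof.
move=> lt; apply/funext=> y; rewrite /coact.
rewrite -lin_formN // -lin_formD //; congr t.
by rewrite (lieA y u v) (lieC u (lie y v)).
Qed.

(** The invariant form is constructed as a map from vectors to linear forms, and
    that map through its graph, a set of this kind. *)
Definition pair_subspace (S : M -> (M -> K) -> Prop) :=
  [/\ S 0 (fun=> 0),
      forall x t y s, S x t -> S y s -> S (x + y) (fun z => t z + s z) &
      forall c x t, S x t -> S (c *: x) (fun z => c * t z)].

Inductive pair_span (S : M -> (M -> K) -> Prop) : M -> (M -> K) -> Prop :=
  | span_in x t : S x t -> pair_span S x t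
  | span_0 : pair_span S 0 (fun=> 0)
  | span_add x t y s : pair_span S x t -> pair_span S y s ->
      pair_span S (x + y) (fun z => t z + s z)
  | span_scale c x t : pair_span S x t ->
      pair_span S (c *: x) (fun z => c * t z).

Lemma pair_span_subspace S : pair_subspace (pair_span S).
Proof. by split; [exact: span_0|exact: span_add|exact: span_scale]. Qed.

Lemma pair_span_min S T : pair_subspace T -> (forall x t, S x t -> T x t) ->
  forall x t, pair_span S x t -> T x t.
Proof.
move=> [T0 TD TZ] ST x t.
by elim=> {x t} [x t /ST|//|x t y s _ Tx _ Ty|c x t _ Tx];
  [|exact: TD|exact: TZ].
Qed.

Lemma pair_span_coact S T u : pair_subspace T ->
  (forall x t, S x t -> T (lie u x) (coact u t)) ->
  forall x t, pair_span S x t -> T (lie u x) (coact u t).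
Proof.
move=> [T0 TD TZ] ST; apply: pair_span_min => //; split=> [|x t y s Tx Ty|c x t Tx].
- by rewrite lie0r; apply: T0.
- by rewrite lieDr; apply: TD Tx Ty.
- by rewrite lieZr; apply: TZ Tx.
Qed.

End LinearForms.

Section Form.
Variables (K : fieldType) (n : nat) (A : 'M[int]_n) (M : lieAlgType K).
Hypothesis symA : forall i j, A i j = A j i.

Record contragredient (e f h : 'I_n -> M) (p : 'I_n -> M -> K) : Prop :=
  Contragredient {
    contra_gens : chevalley_gens A e f h;
    contra_generated : generated e f h;
    contra_coord : coordinates e f h p }.

Lemma contra_swap e f h p : contragredient e f h p ->
  contragredient f e (\- h) (fun k x => - p k x).
Proof.
move=> [g1 g2 g3]; split; first exact: gens_swap.
  exact: generated_swap.
exact: coordinates_swap.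
Qed.

(** The forms that the invariant form pairs with [h i] and with [e i]; the one
    for [f i] is the second under exchange of the signs. *)
Definition dual_h (p : 'I_n -> M -> K) i y : K := \sum_k (A i k)%:~R * p k y.
Definition dual_e (e : 'I_n -> M) (p : 'I_n -> M -> K) i y : K :=
  p i (lie (e i) y).

(** The graph of the form on the positive part: invariance forces the form that
    is paired with a bracket to be the coadjoint translate. *)
Inductive graph_e (e : 'I_n -> M) (p : 'I_n -> M -> K) : M -> (M -> K) -> Prop :=
  | graph_gen i : graph_e e p (e i) (dual_e e p i)
  | graph_0 : graph_e e p 0 (fun=> 0)
  | graph_add x t y s : graph_e e p x t -> graph_e e p y s ->
      graph_e e p (x + y) (fun z => t z + s z)
  | graph_scale c x t : graph_e e p x t ->
      graph_e e p (c *: x) (fun z => c * t z)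
  | graph_lie i x t : graph_e e p x t ->
      graph_e e p (lie (e i) x) (coact (e i) t).

Section Relations.
Variables (e f h : 'I_n -> M) (p : 'I_n -> M -> K).
Hypothesis data : contragredient e f h p.

Let gens := contra_gens data.
Let coord := contra_coord data.

Lemma coord_cartan k c : p k (\sum_j c j *: h j) = c k.
Proof.
have lp := coord_lin coord k.
have pD x y : p k (x + y) = p k x + p k y by apply: lin_formD.
rewrite (big_morph _ pD (lin_form0 lp)) (bigD1 k) //= lin_formZ //.
rewrite (coord_h coord) eqxx mulr1 big1 ?addr0 // => j jk.
by rewrite lin_formZ // (coord_h coord) (negPf jk) mulr0.
Qed.

Lemma dual_h_lin i : lin_form (dual_h p i).
Proof.
move=> c x y; rewrite /dual_h mulr_sumr -big_split; apply: eq_bigr => k _ /=.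
by rewrite (coord_lin coord); ring.
Qed.

Lemma dual_e_lin i : lin_form (dual_e e p i).
Proof. by move=> c x y; rewrite /dual_e lieDr lieZr (coord_lin coord). Qed.

Lemma dual_h_h i j : dual_h p i (h j) = (A i j)%:~R.
Proof.
rewrite /dual_h (bigD1 j) //= (coord_h coord) eqxx mulr1 big1 ?addr0 // => k kj.
by rewrite (coord_h coord) eq_sym (negPf kj) mulr0.
Qed.

Lemma dual_h_e i x : npart e x -> dual_h p i x = 0.
Proof. by move=> nx; apply: big1 => k _; rewrite (coord_e coord) ?mulr0. Qed.

Lemma dual_h_f i x : npart f x -> dual_h p i x = 0.
Proof. by move=> nx; apply: big1 => k _; rewrite (coord_f coord) ?mulr0. Qed.

Lemma dual_e_e i x : npart e x -> dual_e e p i x = 0.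
Proof. by move=> nx; rewrite /dual_e (coord_e coord) //; apply: npart_lie. Qed.

Lemma dual_e_h i j : dual_e e p i (h j) = 0.
Proof.
rewrite /dual_e lieC (gens_he gens) -scaleNr (coord_e coord) //.
by have [_ _ Z] := npart_subspace e; apply/Z/npart_gen.
Qed.

Lemma dual_e_f i j : dual_e e p i (f j) = (i == j)%:R.
Proof.
rewrite /dual_e (gens_ef gens); case: eqP => _.
  by rewrite (coord_h coord) eqxx.
by rewrite (lin_form0 (coord_lin coord i)).
Qed.

Lemma dual_e_ff i j x : npart f x -> dual_e e p i (lie (f j) x) = 0.
Proof.
move=> nx; rewrite /dual_e (coord_f coord) //.
exact: npart_lieef (gens_swap gens) _ _ _ nx.
Qed.

(** The negative part is split into generators and proper brackets, since the
    dual forms of the generators vanish on the latter. *)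
Lemma eq_lin_form t s : lin_form t -> lin_form s ->
  (forall x, npart e x -> t x = s x) -> (forall k, t (h k) = s (h k)) ->
  (forall k, t (f k) = s (f k)) ->
  (forall k x, npart f x -> t (lie (f k) x) = s (lie (f k) x)) -> t =1 s.
Proof.
move=> lt ls Ee Eh Ef Eff x.
have [u [v [w [-> nu cv nw]]]] := triangular_span gens (contra_generated data) x.
rewrite !(lin_formD _ _ lt) !(lin_formD _ _ ls) (Ee w) //; congr (_ + _ + _).
  apply: (npart_ind (S := fun x => t x = s x)) nu => //.
    exact: lin_form_eq.
  by move=> k y ny _; apply: Eff.
by apply: (cartan_ind (S := fun x => t x = s x)) cv => //; apply: lin_form_eq.
Qed.

(** The next four lemmas say that the dual forms transform under the generators
    as the generators themselves do. *)
Lemma dual_h_ad_h i k y : dual_h p i (lie y (h k)) = 0.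
Proof.
apply: (eq_lin_form (coact_lin (h k) (dual_h_lin i)) (s := fun=> 0)).
- by move=> c x z; rewrite mulr0 addr0.
- move=> x nx; rewrite /coact lieC (lin_formN _ (dual_h_lin i)).
  by rewrite dual_h_e ?oppr0 //; apply: npart_lieh gens _ _ nx.
- by move=> j; rewrite /coact (gens_hh gens) (lin_form0 (dual_h_lin i)).
- move=> j; rewrite /coact lieC (gens_hf gens) (lin_formN _ (dual_h_lin i)).
  rewrite (lin_formZ _ _ (dual_h_lin i)) dual_h_f ?mulr0 ?oppr0 //.
  exact: npart_gen.
- move=> j x nx; rewrite /coact lieC -lieNl dual_h_f //.
  exact/(npart_lieh (gens_swap gens))/npart_lie.
Qed.

Lemma dual_e_ad_h i k y :
  dual_e e p i (lie y (h k)) = (A k i)%:~R * dual_e e p i y.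
Proof.
have le := dual_e_lin i.
apply: (eq_lin_form (coact_lin (h k) le)
   (s := fun y => (A k i)%:~R * dual_e e p i y)) => [c x z|x nx|j|j|j x nx];
  rewrite /coact.
- by rewrite le; ring.
- rewrite lieC (lin_formN _ le) !dual_e_e ?mulr0 ?oppr0 //.
  exact: npart_lieh gens _ _ nx.
- by rewrite (gens_hh gens) (lin_form0 le) dual_e_h mulr0.
- rewrite lieC (gens_hf gens) (lin_formN _ le) (lin_formZ _ _ le) dual_e_f.
  by case: eqP => [->|_] /=; ring.
- rewrite dual_e_ff // mulr0 lieC (lin_formN _ le) lieA (gens_hf gens) lieZl.
  rewrite (lin_formD _ _ le) (lin_formZ _ _ le) !dual_e_ff //.
    by rewrite mulr0 addr0 oppr0.
  have := npart_lieh (gens_swap gens) k nx; rewrite lieNl => H.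
  by rewrite -[lie _ _]opprK; apply: subspaceN => //; apply: npart_subspace.
Qed.

Lemma dual_h_ad_e i k y :
  dual_h p i (lie y (e k)) = - (A i k)%:~R * dual_e e p k y.
Proof.
have [le lh] := (dual_e_lin k, dual_h_lin i).
apply: (eq_lin_form (coact_lin (e k) lh)
   (s := fun y => - (A i k)%:~R * dual_e e p k y)) => [c x z|x nx|j|j|j x nx];
  rewrite /coact.
- by rewrite le; ring.
- rewrite lieC (lin_formN _ lh) dual_h_e ?dual_e_e ?oppr0 ?mulr0 //.
  exact: npart_lie.
- rewrite (gens_he gens) (lin_formZ _ _ lh) dual_e_h dual_h_e ?mulr0 //.
  exact: npart_gen.
- rewrite lieC (gens_ef gens) (lin_formN _ lh) dual_e_f.
  by case: eqP => [->|_] /=; rewrite ?dual_h_h ?(lin_form0 lh); ring.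
- rewrite dual_e_ff // mulr0 lieC (lin_formN _ lh) dual_h_f ?oppr0 //.
  exact: npart_lieef (gens_swap gens) _ _ _ nx.
Qed.

Lemma dual_e_ad_f i k y :
  dual_e e p i (lie y (f k)) = - (i == k)%:R * dual_h p i y.
Proof.
have [le lh] := (dual_e_lin i, dual_h_lin i).
apply: (eq_lin_form (coact_lin (f k) le)
   (s := fun y => - (i == k)%:R * dual_h p i y)) => [c x z|x nx|j|j|j x nx];
  rewrite /coact.
- by rewrite lh; ring.
- rewrite dual_h_e // mulr0 lieC (lin_formN _ le).
  have [c [z [-> nz]]] := npart_lower gens k nx.
  rewrite (lin_formD _ _ le) (lin_formZ _ _ le) dual_e_h dual_e_e //.
  by rewrite mulr0 addr0 oppr0.
- rewrite (gens_hf gens) (lin_formZ _ _ le) dual_e_f dual_h_h symA.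
  by case: eqP => [->|_] /=; ring.
- rewrite lieC (lin_formN _ le) dual_e_ff ?oppr0 ?dual_h_f ?mulr0 //;
    exact: npart_gen.
- rewrite lieC (lin_formN _ le) dual_e_ff ?oppr0 ?dual_h_f ?mulr0 //;
    exact: npart_lie.
Qed.

End Relations.
End Form.

Section FormConstruction.
Variables (K : fieldType) (n : nat) (A : 'M[int]_n) (M : lieAlgType K).
Hypothesis symA : forall i j, A i j = A j i.

Implicit Types (e f h : 'I_n -> M) (p : 'I_n -> M -> K) (t s : M -> K).

Section OneSign.
Variables (e f h : 'I_n -> M) (p : 'I_n -> M -> K).
Hypothesis data : contragredient A e f h p.

Let gens := contra_gens data.
Let dataC := contra_swap data.

Lemma graph_lin x t : graph_e e p x t -> lin_form t.
Proof.
elim=> {x t} [i|c x y|x t y s _ lt _ ls c u v|c x t _ lt d u v|i x t _ lt].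
- exact: dual_e_lin data i.
- by rewrite mulr0 addr0.
- by rewrite lt ls; ring.
- by rewrite lt; ring.
- exact: coact_lin.
Qed.

Lemma graph_npart x t : graph_e e p x t -> npart e x.
Proof.
have [n0 nD nZ] := npart_subspace e.
elim=> {x t} [i|//|x t y s _ nx _ ny|c x t _ nx|i x t _ nx].
- exact: npart_gen.
- exact: nD.
- exact: nZ.
- exact: npart_lie.
Qed.

Lemma graph_vanish_e x t : graph_e e p x t -> forall y, npart e y -> t y = 0.
Proof.
elim=> {x t} [i y ny|//|x t y s _ tx _ sx z nz|c x t _ tx z nz|i x t g tx y ny].
- exact: dual_e_e data _ _ ny.
- by rewrite tx // sx // addr0.
- by rewrite tx // mulr0.
- rewrite /coact lieC (lin_formN _ (graph_lin g)) tx ?oppr0 //.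
  exact: npart_lie.
Qed.

Lemma graph_vanish_h x t k : graph_e e p x t -> t (h k) = 0.
Proof.
elim=> {x t} [i|//|x t y s _ tx _ sx|c x t _ tx|i x t g tx].
- exact: dual_e_h data _ _.
- by rewrite tx // sx // addr0.
- by rewrite tx // mulr0.
- rewrite /coact (gens_he gens) (lin_formZ _ _ (graph_lin g)).
  by rewrite (graph_vanish_e g) ?mulr0 //; apply: npart_gen.
Qed.

Lemma graph_vanish_cartan x t v : graph_e e p x t -> cartan_part h v -> t v = 0.
Proof.
move=> g; apply: (cartan_ind (S := fun v => t v = 0)).
  exact/lin_form_ker/(graph_lin g).
by move=> k; apply: graph_vanish_h g.
Qed.

Lemma graph_sym_f x t k : graph_e e p x t ->
  t (f k) = dual_e f (fun k x => - p k x) k x.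
Proof.
have lf := dual_e_lin dataC k.
elim=> {x t} [i||x t y s _ tx _ sx|c x t _ tx|i x t g tx].
- by rewrite (dual_e_f data) (dual_e_f dataC) eq_sym.
- by rewrite (lin_form0 lf).
- by rewrite (lin_formD _ _ lf) tx sx.
- by rewrite (lin_formZ _ _ lf) tx.
- rewrite (dual_e_ff dataC) ?(graph_npart g) //; last exact: graph_npart g.
  rewrite /coact lieC (gens_ef gens) (lin_formN _ (graph_lin g)).
  case: eqP => _; first by rewrite (graph_vanish_h _ g) oppr0.
  by rewrite (lin_form0 (graph_lin g)) oppr0.
Qed.

Lemma graph_coact_h k x t :
  graph_e e p x t -> graph_e e p (lie (h k) x) (coact (h k) t).
Proof.
elim=> {x t} [i||x t y s _ gx _ gy|c x t _ gx|i x t g gx].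
- rewrite (gens_he gens) (_ : coact _ _ =
    fun y => (A k i)%:~R * dual_e e p i y); first exact/graph_scale/graph_gen.
  by apply/funext=> y; rewrite /coact (dual_e_ad_h data).
- by rewrite lie0r; apply: graph_0.
- by rewrite lieDr; apply: graph_add gx gy.
- by rewrite lieZr; apply: graph_scale gx.
- rewrite lieA (gens_he gens) lieZl (_ : coact _ _ = fun y =>
    (A k i)%:~R * coact (e i) t y + coact (e i) (coact (h k) t) y).
    by apply: graph_add; [exact/graph_scale/graph_lie|exact: graph_lie].
  have lt := graph_lin g.
  have := coact_lie (h k) (e i) lt => E.
  apply/funext=> y; apply/eqP; rewrite -subr_eq; apply/eqP.
  have := congr1 (fun t => t y) E; rewrite /= => <-.
  by rewrite /coact (gens_he gens) lieZr (lin_formZ _ _ lt).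
Qed.

(** The graph of the form on the nonnegative half. *)
Definition graph_eh := pair_span
  (fun x t => graph_e e p x t \/ exists k, x = h k /\ t = dual_h A p k).

Lemma graph_eh_h k : graph_eh (h k) (dual_h A p k).
Proof. by apply: span_in; right; exists k. Qed.

Lemma graph_eh_coact_e i x t :
  graph_eh x t -> graph_eh (lie (e i) x) (coact (e i) t).
Proof.
move: x t; apply: pair_span_coact; first exact: pair_span_subspace.
move=> x t [g|[k [-> ->]]]; first by apply: span_in; left; apply: graph_lie.
rewrite lieC (gens_he gens) -scaleNr (_ : coact _ _ =
    fun y => - (A k i)%:~R * dual_e e p i y).
  by apply: span_in; left; apply/graph_scale/graph_gen.
by apply/funext=> y; rewrite /coact (dual_h_ad_e data).
Qed.

(** Lowering a positive element keeps it positive, up to a Cartan part. As the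
    pairs are moved by the same relations as their first components, this holds
    for the graph as well. *)
Lemma graph_e_coact_f i x t :
  graph_e e p x t -> graph_eh (lie (f i) x) (coact (f i) t).
Proof.
have fe j : lie (f i) (e j) = - (j == i)%:R *: h j.
  rewrite lieC (gens_ef gens); case: eqP => _; first by rewrite scaleN1r.
  by rewrite mulr0n !oppr0 scale0r.
elim=> {x t} [j||x t y s _ gx _ gy|c x t _ gx|j x t g gx].
- rewrite fe (_ : coact _ _ = fun y => - (j == i)%:R * dual_h A p j y).
    exact/span_scale/graph_eh_h.
  by apply/funext=> y; rewrite /coact (dual_e_ad_f symA data).
- by rewrite lie0r; apply: span_0.
- by rewrite lieDr; apply: span_add gx gy.
- by rewrite lieZr; apply: span_scale gx.
- rewrite lieA fe lieZl (_ : coact _ _ = fun y =>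
    - (j == i)%:R * coact (h j) t y + coact (e j) (coact (f i) t) y).
    apply: span_add; last exact: graph_eh_coact_e.
    by apply: span_scale; apply: span_in; left; apply: graph_coact_h.
  have lt := graph_lin g.
  have E := coact_lie (f i) (e j) lt.
  apply/funext=> y; apply/eqP; rewrite -subr_eq; apply/eqP.
  have := congr1 (fun t => t y) E; rewrite /= => <-.
  by rewrite /coact fe lieZr (lin_formZ _ _ lt).
Qed.

End OneSign.

Definition graph e f h p := pair_span (fun x t => [\/ graph_e e p x t,
  graph_e f (fun k y => - p k y) x t | exists k, x = h k /\ t = dual_h A p k]).

Lemma graph_subspace e f h p : pair_subspace (graph e f h p).
Proof. exact: pair_span_subspace. Qed.

Lemma graph_h e f h p k : graph e f h p (h k) (dual_h A p k).
Proof. by apply: span_in; constructor 3; exists k. Qed.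

Lemma dual_h_opp p k : dual_h A (fun k x => - p k x) k = fun y => -1 * dual_h A p k y.
Proof.
apply/funext=> y; rewrite /dual_h mulN1r -sumrN.
by apply: eq_bigr => i _; rewrite mulrN.
Qed.

Lemma opp_coord p : (fun k (x : M) => - - p k x) = p.
Proof. by apply/funext=> k; apply/funext=> x; rewrite opprK. Qed.

Lemma graph_swap e f h p x t :
  graph f e (\- h) (fun k x => - p k x) x t -> graph e f h p x t.
Proof.
move: x t; apply: pair_span_min; first exact: graph_subspace.
move=> x t [g|g|[k [-> ->]]].
- by apply: span_in; constructor 2.
- by apply: span_in; constructor 1; rewrite opp_coord in g.
- by rewrite dual_h_opp /= -scaleN1r; apply/span_scale/graph_h.
Qed.

Lemma graph_coact_f e f h p i x t : contragredient A e f h p ->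
  graph e f h p x t -> graph e f h p (lie (f i) x) (coact (f i) t).
Proof.
move=> data; move: x t; apply: pair_span_coact; first exact: graph_subspace.
move=> x t [g|g|[k [-> ->]]].
- have := graph_e_coact_f data i g; apply: pair_span_min.
    exact: graph_subspace.
  by move=> {g}x {}t [g|g]; apply: span_in; [constructor 1|constructor 3].
- by apply: span_in; constructor 2; apply: graph_lie.
- rewrite lieC (gens_hf (contra_gens data)) -scaleNr opprK.
  rewrite (_ : coact _ _ = fun y =>
     (A k i)%:~R * dual_e f (fun k x => - p k x) i y).
    by apply: span_in; constructor 2; apply/graph_scale/graph_gen.
  apply/funext=> y; rewrite /coact; have := dual_h_ad_e (contra_swap data) k i y.
  rewrite dual_h_opp mulN1r => /eqP; rewrite mulNr eqr_opp => /eqP ->.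
  by [].
Qed.

(** The graph is spanned by pure words only, but it is stable under all
    generators: this is the triangular decomposition, for pairs. *)
Lemma graph_coact_gens e f h p i x t : contragredient A e f h p ->
  graph e f h p x t ->
  [/\ graph e f h p (lie (e i) x) (coact (e i) t),
      graph e f h p (lie (f i) x) (coact (f i) t) &
      graph e f h p (lie (h i) x) (coact (h i) t)].
Proof.
move=> data g; split; last 2 first.
- exact: graph_coact_f.
- move: x t g; apply: pair_span_coact; first exact: graph_subspace.
  move=> x t [g|g|[k [-> ->]]].
  + by apply: span_in; constructor 1; apply: (graph_coact_h data).
  + have := graph_coact_h (contra_swap data) i g; rewrite /= => g'.
    have : graph e f h p (-1 *: lie (- h i) x)
       (fun z => -1 * coact (- h i) t z).
      by apply: span_scale; apply: span_in; constructor 2.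
    rewrite lieNl scaleN1r opprK; congr graph; apply/funext=> z.
    by rewrite /coact lieNr (lin_formN _ (graph_lin (contra_swap data) g)); ring.
  + rewrite (gens_hh (contra_gens data)) (_ : coact _ _ = fun=> 0).
      exact: span_0.
    by apply/funext=> y; rewrite /coact (dual_h_ad_h data).
have g' : graph f e (\- h) (fun k x => - p k x) x t.
  by apply: graph_swap; rewrite opp_fun2 opp_coord.
exact/graph_swap/(graph_coact_f i (contra_swap data)).
Qed.

End FormConstruction.

Section InvariantForm.
Variables (K : fieldType) (n : nat) (A : 'M[int]_n) (M : lieAlgType K).
Implicit Types (e f h : 'I_n -> M) (B : M -> M -> K).

Record invariant_form e f h B : Prop := InvariantForm {
  inv_linl : forall y, lin_form (fun x => B x y);
  inv_linr : forall x, lin_form (B x);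
  inv_lie : forall u x y, B (lie u x) y = B x (lie y u);
  inv_ee : forall x y, npart e x -> npart e y -> B x y = 0;
  inv_eh : forall x y, npart e x -> cartan_part h y -> B x y = 0;
  inv_ff : forall x y, npart f x -> npart f y -> B x y = 0;
  inv_fh : forall x y, npart f x -> cartan_part h y -> B x y = 0;
  inv_he : forall x y, cartan_part h x -> npart e y -> B x y = 0;
  inv_hf : forall x y, cartan_part h x -> npart f y -> B x y = 0;
  inv_hh : forall i j, B (h i) (h j) = (A i j)%:~R }.

Lemma cartan_swapE h x : cartan_part (\- h) x -> cartan_part h x.
Proof. by move/cartan_swap; rewrite opp_fun2. Qed.

Lemma form_swap e f h B : invariant_form e f h B -> invariant_form f e (\- h) B.
Proof.
move=> [ll lr inv ee eh ff fh he hf hh]; split=> //.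
- by move=> x y nx /cartan_swapE; apply: fh.
- by move=> x y nx /cartan_swapE; apply: eh.
- by move=> x y /cartan_swapE; apply: hf.
- by move=> x y /cartan_swapE; apply: he.
- move=> i j /=; rewrite (lin_formN _ (lr _)) -hh.
  by rewrite (lin_formN (t := fun x => B x _)) ?opprK //; apply: ll.
Qed.

Hypothesis symA : forall i j, A i j = A j i.

Section Graph.
Variables (e f h : 'I_n -> M) (p : 'I_n -> M -> K).
Hypothesis data : contragredient A e f h p.

Let gens := contra_gens data.
Let gen := contra_generated data.
Let dataC := contra_swap data.
Let G := graph A e f h p.

Lemma graph_form_lin x t : G x t -> lin_form t.
Proof.
move: x t; apply: pair_span_min => [|x t [g|g|[k [_ ->]]]].
- split=> [c x y|x t y s lt ls c u v|c x t lt d u v].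
  + by rewrite mulr0 addr0.
  + by rewrite lt ls; ring.
  + by rewrite lt; ring.
- exact: graph_lin data _ _ g.
- exact: graph_lin dataC _ _ g.
- exact: dual_h_lin data k.
Qed.

(** The values of a form on the generators only depend on the vector that it is
    paired with: they are prescribed by the symmetry of the form that is being
    constructed. *)
Lemma graph_gens x t k : G x t ->
  [/\ t (e k) = dual_e e p k x,
      t (f k) = dual_e f (fun k x => - p k x) k x & t (h k) = dual_h A p k x].
Proof.
have le := dual_e_lin data k; have lf := dual_e_lin dataC k.
have lh := dual_h_lin data k.
move: x t; apply: pair_span_min => [|x t [g|g|[j [-> ->]]]].
- split=> [|x t y s [e1 f1 h1] [e2 f2 h2]|c x t [e1 f1 h1]].
  + by rewrite (lin_form0 le) (lin_form0 lf) (lin_form0 lh).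
  + rewrite (lin_formD _ _ le) (lin_formD _ _ lf) (lin_formD _ _ lh).
    by rewrite e1 e2 f1 f2 h1 h2.
  + rewrite (lin_formZ _ _ le) (lin_formZ _ _ lf) (lin_formZ _ _ lh).
    by rewrite e1 f1 h1.
- have nx := graph_npart g; split.
  + rewrite (graph_vanish_e data g) ?(dual_e_e data) //; exact: npart_gen.
  + exact: graph_sym_f data _ _ _ g.
  + by rewrite (graph_vanish_h data _ g) (dual_h_e data).
- have nx := graph_npart g; split.
  + by rewrite (graph_sym_f dataC _ g) opp_coord.
  + rewrite (graph_vanish_e dataC g) ?(dual_e_e dataC) //; exact: npart_gen.
  + have := graph_vanish_h dataC k g.
    rewrite /= (lin_formN _ (graph_lin dataC g)) => /eqP.
    by rewrite oppr_eq0 => /eqP ->; rewrite (dual_h_f data).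
- split.
  + by rewrite (dual_e_h data) (dual_h_e data) //; apply: npart_gen.
  + rewrite (dual_h_f data); last exact: npart_gen.
    have := dual_e_h dataC k j; rewrite /= (lin_formN _ lf) => /eqP.
    by rewrite oppr_eq0 => /eqP ->.
  + by rewrite !(dual_h_h data) symA.
Qed.

Lemma graph_coact u x t : G x t -> G (lie u x) (coact u t).
Proof.
have [G0 GD GZ] := graph_subspace A e f h p.
move: u x t; apply: gen => [|i]; last first.
  by split=> x t g; have [] := graph_coact_gens symA i data g.
split; first split.
- move=> x t g; rewrite lie0l (_ : coact _ _ = fun=> 0) //.
  by apply/funext=> y; rewrite /coact lie0r (lin_form0 (graph_form_lin g)).
- move=> u v Gu Gv x t g; rewrite lieDl (_ : coact _ _ =
    fun y => coact u t y + coact v t y); first by apply: GD; [exact: Gu|exact: Gv].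
  by apply/funext=> y; rewrite /coact lieDr (lin_formD _ _ (graph_form_lin g)).
- move=> c u Gu x t g; rewrite lieZl (_ : coact _ _ =
    fun y => c * coact u t y); first by apply: GZ; exact: Gu.
  by apply/funext=> y; rewrite /coact lieZr (lin_formZ _ _ (graph_form_lin g)).
- move=> u v Gu Gv x t g.
  have -> : lie (lie u v) x = lie u (lie v x) + -1 *: lie v (lie u x).
    by rewrite lieA scaleN1r addrK.
  rewrite (coact_lie _ _ (graph_form_lin g)).
  rewrite (_ : (fun y => _ - _) = fun y => coact u (coact v t) y +
    -1 * coact v (coact u t) y); last by apply/funext=> y; rewrite mulN1r.
  by apply: GD; [apply/Gu/Gv|apply/GZ/Gv/Gu].
Qed.

Lemma graph_zero t : G 0 t -> t = fun=> 0.
Proof.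
move=> g; apply/funext=> y; move: y t g.
apply: (gen (S := fun y => forall t, G 0 t -> t y = 0)) => [|i]; last first.
  split=> t g; have [E F H] := graph_gens i g.
  - by rewrite E (lin_form0 (dual_e_lin data i)).
  - by rewrite F (lin_form0 (dual_e_lin dataC i)).
  - by rewrite H (lin_form0 (dual_h_lin data i)).
split; first split.
- by move=> t g; rewrite (lin_form0 (graph_form_lin g)).
- move=> x y tx ty t g.
  by rewrite (lin_formD _ _ (graph_form_lin g)) tx // ty // addr0.
- by move=> c x tx t g; rewrite (lin_formZ _ _ (graph_form_lin g)) tx // mulr0.
- move=> x y tx _ t g; rewrite -[t _]/(coact y t x); apply: tx.
  by rewrite -(lie0r y); apply: graph_coact.
Qed.

Lemma graph_fun x t s : G x t -> G x s -> t = s.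
Proof.
move=> gt gs; have [G0 GD GZ] := graph_subspace A e f h p.
have /graph_zero E : G 0 (fun y => t y + -1 * s y).
  by rewrite -(subrr x) -scaleN1r; apply: GD => //; apply: GZ.
apply/funext=> y; apply/eqP; rewrite -subr_eq0 -mulN1r.
by rewrite (congr1 (fun t => t y) E).
Qed.

Lemma graph_total x : exists t, G x t.
Proof.
have [G0 GD GZ] := graph_subspace A e f h p.
move: x; apply: (generated_total gen).
- split; first by exists (fun=> 0).
    by move=> x y [t gt] [s gs]; exists (fun z => t z + s z); apply: GD.
  by move=> c x [t gt]; exists (fun z => c * t z); apply: GZ.
- move=> i; split.
  + by exists (dual_e e p i); apply: span_in; constructor 1; apply: graph_gen.
  + exists (dual_e f (fun k x => - p k x) i).
    by apply: span_in; constructor 2; apply: graph_gen.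
  + by exists (dual_h A p i); apply: graph_h.
- move=> i x [t g]; split.
  + by exists (coact (e i) t); apply: graph_coact.
  + by exists (coact (f i) t); apply: graph_coact.
  + by exists (coact (h i) t); apply: graph_coact.
Qed.

Lemma graph_word_e x : npart e x -> exists t, graph_e e p x t.
Proof.
move: x; apply: npart_ind.
- split; first by exists (fun=> 0); apply: graph_0.
    by move=> x y [t gt] [s gs]; exists (fun z => t z + s z); apply: graph_add.
  by move=> c x [t gt]; exists (fun z => c * t z); apply: graph_scale.
- by move=> i; exists (dual_e e p i); apply: graph_gen.
- by move=> i x _ [t g]; exists (coact (e i) t); apply: graph_lie.
Qed.

End Graph.

(** The invariant form exists because the pairs of a vector and a linear form
    that are generated from those prescribed on generators make up the graph
    of a map: a form paired with [0] vanishes on the generators, and it does so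
    along with its translates. *)
Theorem invariant_form_exists e f h p : contragredient A e f h p ->
  exists B, invariant_form e f h B.
Proof.
move=> data; have [B GB] := choice (graph_total data).
have Bval x t : graph A e f h p x t -> B x = t.
  by move=> g; apply: (graph_fun data) (GB x) g.
have [G0 GD GZ] := graph_subspace A e f h p.
have Be x : npart e x -> exists2 t, graph_e e p x t & B x = t.
  move=> nx; have [t g] := graph_word_e p nx; exists t => //.
  by apply: Bval; apply: span_in; constructor 1.
have Bf x : npart f x ->
    exists2 t, graph_e f (fun k x => - p k x) x t & B x = t.
  move=> nx; have [t g] := graph_word_e (fun k x => - p k x) nx; exists t => //.
  by apply: Bval; apply: span_in; constructor 2.
have Bh i : B (h i) = dual_h A p i by apply/Bval/graph_h.
have ll y : lin_form (fun x => B x y).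
  by move=> c x z; rewrite (Bval _ _ (GD _ _ _ _ (GZ c _ _ (GB x)) (GB z))).
have lr x : lin_form (B x) by apply: graph_form_lin (GB x).
exists B; split=> //.
- move=> u x y; rewrite (Bval _ _ (graph_coact data u (GB x))) //.
- by move=> x y /Be[t g ->]; apply: (graph_vanish_e data g).
- by move=> x y /Be[t g ->]; apply: (graph_vanish_cartan data g).
- by move=> x y /Bf[t g ->]; apply: (graph_vanish_e (contra_swap data) g).
- move=> x y /Bf[t g ->] /cartan_swap.
  exact: (graph_vanish_cartan (contra_swap data) g).
- move=> x y cx ny; apply: (cartan_ind (S := fun x => B x y = 0)) cx.
    exact: lin_form_ker.
  by move=> k; rewrite Bh (dual_h_e data).
- move=> x y cx ny; apply: (cartan_ind (S := fun x => B x y = 0)) cx.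
    exact: lin_form_ker.
  by move=> k; rewrite Bh (dual_h_f data).
- by move=> i j; rewrite Bh (dual_h_h data).
Qed.

End InvariantForm.

(** * Separating weights *)

Section CharZero.
Variable K : fieldType.
Hypothesis char0 : [pchar K] =i pred0.

Lemma intr_inj0 (m : int) : m%:~R = 0 :> K -> m = 0.
Proof.
have natz k : k%:R = 0 :> K -> k = 0%N by move/eqP; rewrite (pcharf0P K).1 // => /eqP.
case: m => m; first by move/natz ->.
by rewrite NegzE mulrNz => /eqP; rewrite oppr_eq0 => /eqP /natz.
Qed.

Lemma intr_neq (m d : int) : m != d -> (m%:~R - d%:~R : K) != 0.
Proof.
by move=> md; apply/eqP; rewrite -intrB => /intr_inj0 /eqP; rewrite subr_eq0 (negPf md).
Qed.

Variables (n : nat) (A : 'M[int]_n) (M : lieAlgType K).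
Hypothesis detA : \det A != 0.
Implicit Types (e f h : 'I_n -> M) (l : seq ('rV[int]_n * M)).

Lemma detK_neq0 : \det (map_mx intr A : 'M[K]_n) != 0.
Proof.
by rewrite det_map_mx; apply/eqP=> /intr_inj0 /eqP; rewrite (negPf detA).
Qed.

Section Separation.
Variables (h : 'I_n -> M) (T : M -> Prop).
Hypothesis T_sub : subspace T.
Hypothesis T_ad : forall k x, T x -> T (lie (h k) x).

(** Applying [ad (h k) - b k] for a weight [b] that occurs kills the vectors of
    that weight and rescales the others; so the foreign weights can be removed
    one after the other. *)
Lemma separate_weight a y l : weight_vector A h a y ->
  {in l, forall s, weight_vector A h s.1 s.2 /\ (s.2 = 0 \/ s.1 <> a)} ->
  T (y + \sum_(s <- l) s.2) -> T y.
Proof.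
move=> wy; have [T0 TD TZ] := T_sub.
suff H (d : K) (c : 'rV[int]_n -> K) : d != 0 ->
    {in l, forall s, weight_vector A h s.1 s.2 /\ (s.2 = 0 \/ s.1 <> a)} ->
    T (d *: y + \sum_(s <- l) c s.1 *: s.2) -> T y.
  move=> wl Ty; apply: (H 1 (fun=> 1)) => //; first exact: oner_neq0.
  by rewrite scale1r (eq_bigr (fun s => s.2)) // => s _; rewrite scale1r.
elim: l d c => [|s l IH] d c d0 wl.
  rewrite big_nil addr0 => /(TZ d^-1).
  by rewrite scalerA mulVf // scale1r.
have wl' : {in l, forall s, weight_vector A h s.1 s.2 /\ (s.2 = 0 \/ s.1 <> a)}.
  by move=> s' s'l; apply: wl; rewrite inE s'l orbT.
have [ws [s0|sa]] := wl s (mem_head _ _).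
  by rewrite big_cons s0 scaler0 add0r; apply: IH.
have [k ka] : exists k, pairing A k a != pairing A k s.1.
  apply: contrapT => nk; apply: sa; apply: (pairing_inj detA).
  apply/funext=> k; apply/esym/eqP; apply: contrapT => ka; apply: nk.
  by exists k; apply/negP.
pose r : K := (pairing A k s.1)%:~R; pose D x := lie (h k) x - r *: x.
have DD x z : D (x + z) = D x + D z.
  by rewrite /D lieDr scalerDr opprD addrACA.
have DZ u x : D (u *: x) = u *: D x.
  by rewrite /D lieZr scalerBr !scalerA mulrC.
have Dw b x : weight_vector A h b x -> D x = ((pairing A k b)%:~R - r) *: x.
  by move=> wx; rewrite /D wx scalerBl.
have D0 : D 0 = 0 by rewrite /D lie0r scaler0 subr0.
have TD' x : T x -> T (D x).
  by move=> Tx; apply: subspaceB => //; [apply: T_ad|apply: TZ].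
move/TD'; rewrite big_cons !DD !DZ (Dw _ _ wy) (Dw _ _ ws) subrr scale0r.
rewrite scaler0 add0r (big_morph D DD D0) scalerA.
pose c' (b : 'rV[int]_n) := c b * ((pairing A k b)%:~R - r).
rewrite (_ : \sum_(t <- l) _ = \sum_(t <- l) c' t.1 *: t.2).
  by apply: IH => //; rewrite mulf_neq0 // intr_neq.
rewrite big_seq [RHS]big_seq; apply: eq_bigr => t tl.
by have [wt _] := wl' t tl; rewrite DZ (Dw _ _ wt) scalerA.
Qed.

Lemma separate_weights a l :
  {in l, forall s, weight_vector A h s.1 s.2} ->
  T (\sum_(s <- l) s.2) -> T (\sum_(s <- l | s.1 == a) s.2).
Proof.
move=> wl; rewrite (bigID (fun s => s.1 == a)) /= -[X in _ + X]big_filter.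
apply: (@separate_weight a).
  rewrite big_seq_cond; apply: subspace_sum; first exact: weight_subspace.
  by move=> s /andP[sl /eqP <-]; apply: wl.
move=> s; rewrite mem_filter => /andP[/eqP sa sl]; split; first exact: wl.
by right.
Qed.

End Separation.

(** ** Homogeneous components of iterated brackets *)

Lemma words_list e k x : words e k x -> exists2 l,
  x = \sum_(s <- l) s.2 &
  {in l, forall s, exists2 j, (j < k)%N & word e j s.1 s.2}.
Proof.
elim=> [|j a {}x y jk wx _ [l -> wl]]; first by exists [::]; rewrite ?big_nil.
exists ((a, x) :: l); first by rewrite big_cons.
move=> s; rewrite inE => /orP[/eqP -> /=|]; last exact: wl.
by exists j.
Qed.

Lemma word_positive e k a x : word e k a x ->
  x = 0 \/ (forall i, 0 <= a 0 i) /\ \sum_i a 0 i = k.+1.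
Proof.
have s1 i : \sum_j simple_root i 0 j = 1.
  rewrite (bigD1 i) //= mxE !eqxx big1 ?addr0 // => j /negPf ji.
  by rewrite mxE ji andbF.
elim=> {k a x} [i|k a|k a x y _ [->|Hx] _ [->|Hy]|k a c x _ [->|Hx]|
                i k a x _ [->|[Hx sx]]].
- by right; split=> // j; rewrite mxE; case: (_ && _).
- by left.
- by left; rewrite addr0.
- by right.
- by right.
- by right.
- by left; rewrite scaler0.
- by right.
- by left; rewrite lie0r.
- right; split=> [j|]; first by rewrite !mxE addr_ge0 //; case: (_ && _).
  under eq_bigr do rewrite mxE.
  by rewrite big_split /= sx s1 -[in RHS]addn1 PoszD.
Qed.

Lemma word_neq0 e k a x : word e k a x -> x = 0 \/ a <> 0.
Proof.
move/word_positive=> [->|[_ sa]]; [by left|right=> a0].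
by move: sa; rewrite a0 big1 // => i _; rewrite mxE.
Qed.

(** The index in [word] of a nonzero element of weight [a]. *)
Definition degree (a : 'rV[int]_n) : nat := (absz (\sum_i a 0 i)).-1.

Lemma word_degree e k a x : word e k a x ->
  (x = 0 \/ degree a = k) /\ word e (degree a) a x.
Proof.
move=> wx; have [->|[_ sa]] := word_positive wx.
  by split; [left|apply: word_0].
by rewrite /degree sa; split; [right|].
Qed.

End CharZero.

(** * The radical of the form *)

Section Radical.
Variables (K : fieldType) (n : nat) (A : 'M[int]_n) (M : lieAlgType K).
Implicit Types (e f h : 'I_n -> M) (x y z : M) (I : M -> Prop).

Definition radical (B : M -> M -> K) x := forall y, B x y = 0.

Section OneForm.
Variables (e f h : 'I_n -> M) (B : M -> M -> K).
Hypothesis gens : chevalley_gens A e f h.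
Hypothesis gen : generated e f h.
Hypothesis formB : invariant_form A e f h B.

Let linl y := inv_linl formB y.
Let linr x := inv_linr formB x.

Lemma radical_subspace : subspace (radical B).
Proof.
split=> [y|x z Rx Rz y|c x Rx y].
- exact: lin_form0 (linl y).
- by rewrite (lin_formD _ _ (linl y)) Rx Rz addr0.
- by rewrite (lin_formZ _ _ (linl y)) Rx mulr0.
Qed.

Lemma radical_ideal : lie_ideal (radical B).
Proof.
have [R0 RD RZ] := radical_subspace.
by split=> // u x Rx y; rewrite (inv_lie formB).
Qed.

(** The positive part pairs with the negative part only; so each component of an
    element of the radical is in the radical. *)
Lemma radical_parts u v w : npart f u -> cartan_part h v -> npart e w ->
  radical B (u + v + w) -> [/\ radical B u, radical B v & radical B w].
Proof.
move=> nu cv nw R.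
have Ru : radical B u.
  move=> y; have [y1 [y2 [y3 [-> n1 c2 n3]]]] := triangular_span gens gen y.
  rewrite !(lin_formD _ _ (linr _)) (inv_ff formB nu n1) (inv_fh formB nu c2).
  have := R y3; rewrite !(lin_formD _ _ (linl y3)) (inv_he formB cv n3).
  by rewrite (inv_ee formB nw n3) !addr0 !add0r.
have Rw : radical B w.
  move=> y; have [y1 [y2 [y3 [-> n1 c2 n3]]]] := triangular_span gens gen y.
  rewrite !(lin_formD _ _ (linr _)) (inv_eh formB nw c2) (inv_ee formB nw n3).
  have := R y1; rewrite !(lin_formD _ _ (linl y1)) (inv_ff formB nu n1).
  by rewrite (inv_hf formB cv n1) !addr0 !add0r.
split=> // y; have := R y.
by rewrite !(lin_formD _ _ (linl y)) Ru Rw add0r addr0.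
Qed.

(** By invariance, in the pairing of [x] with a bracket the outer letter [f k]
    can be moved to [x], where it gives zero. *)
Lemma radical_singular x : [pchar K] =i pred0 ->
  (forall i, A i i = 2) -> npart e x ->
  (forall k, lie (f k) x = 0) -> radical B x.
Proof.
move=> char0 diagA nx fx y.
have [y1 [y2 [y3 [-> n1 c2 n3]]]] := triangular_span gens gen y.
rewrite !(lin_formD _ _ (linr _)) (inv_eh formB nx c2) (inv_ee formB nx n3) !addr0.
have low k z : B x (lie (f k) z) = 0.
  rewrite lieC (lin_formN _ (linr x)) -(inv_lie formB) fx.
  by rewrite (lin_form0 (linl z)) oppr0.
apply: (npart_ind (S := fun y => B x y = 0)) n1 => [|k|k z _ _]; last exact: low.
  exact/lin_form_ker/linr.
have := low k (h k); rewrite lieC (gens_hf gens) -scaleNr opprK.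
rewrite (lin_formZ _ _ (linr x)) => /eqP; rewrite mulf_eq0 diagA => /orP[|/eqP//].
by move/eqP/(intr_inj0 char0).
Qed.

Hypothesis char0 : [pchar K] =i pred0.
Hypothesis detA : \det A != 0.

Lemma radical_cartan x : cartan_part h x -> radical B x -> x = 0.
Proof.
move=> [c ->] R.
have cA : c *m map_mx intr A = 0.
  apply/rowP=> j; rewrite !mxE -[RHS](R (h j)).
  rewrite (big_morph (fun x => B x (h j)) (fun x y => lin_formD x y (linl _))
    (lin_form0 (linl _))).
  apply: eq_bigr => i _.
  by rewrite (lin_formZ _ _ (linl _)) (inv_hh formB) mxE.
have uA : (map_mx intr A : 'M[K]_n) \in unitmx.
  by rewrite unitmxE unitfE; apply: detK_neq0.
have -> : c = 0 by rewrite -[c](mulmxK uA) cA mul0mx.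
by rewrite big1 // => i _; rewrite mxE scale0r.
Qed.

Lemma npart_weights x : npart e x -> exists2 l,
  x = \sum_(s <- l) s.2 & {in l, forall s,
    weight_vector A h s.1 s.2 /\ (s.2 = 0 \/ s.1 <> 0)}.
Proof.
move=> [k /words_list[l -> wl]]; exists l => // s /wl[j _ ws]; split.
  exact: word_weight gens _ _ _ ws.
exact: word_neq0 ws.
Qed.

(** Ideals are graded by the weights; so an ideal that meets the Cartan
    subalgebra trivially has no component of weight zero, which makes it
    orthogonal to the Cartan subalgebra, and to everything by invariance. *)
Lemma ideal_radical I : (forall i, A i i = 2) ->
  lie_ideal I -> (forall x, cartan_part h x -> I x -> x = 0) ->
  forall x, I x -> radical B x.
Proof.
move=> diagA idI I0; have [i0 iD iZ iL] := idI.
(* Only the component of weight zero pairs with the Cartan subalgebra. *)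
have Bh x j : I x -> B x (h j) = 0.
  have [u [v [w [-> nu cv nw]]]] := triangular_span gens gen x.
  move=> Ix; rewrite !(lin_formD _ _ (linl _)).
  have hj := cartan_gen h j.
  rewrite (inv_fh formB nu hj) (inv_eh formB nw hj) add0r addr0.
  suff /(I0 _ cv) -> : I v by rewrite (lin_form0 (linl _)).
  have [lw Ew ww] := npart_weights nw.
  have [k /words_list[lu Eu wu]] := nu.
  apply: (separate_weight char0 detA (lie_ideal_subspace idI) (fun k x => iL (h k) x)
     (a := 0) (l := [seq (- s.1, s.2) | s <- lu] ++ lw)).
  - exact: cartan_weight gens _ cv.
  - move=> s; rewrite mem_cat => /orP[/mapP[t tl ->]|]; last exact: ww.
    have [i _ wt] := wu t tl; split; last first.
      have [->|a0] := word_neq0 wt; [by left|right=> /= /eqP].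
      by rewrite oppr_eq0 => /eqP.
    by apply/weight_swap; apply: word_weight (gens_swap gens) _ _ _ wt.
  - by rewrite big_cat big_map -Eu -Ew addrCA addrA.
(* As [h j] acts on [e j] by 2, invariance reduces [e j] to [h j]. *)
have Be x j : I x -> B x (e j) = 0.
  move=> Ix; have := Bh _ j (iL (e j) x Ix); rewrite (inv_lie formB).
  rewrite (gens_he gens) (lin_formZ _ _ (linr x)) diagA => /eqP.
  by rewrite mulf_eq0 => /orP[/eqP/(intr_inj0 char0)//|/eqP].
have Bf x j : I x -> B x (f j) = 0.
  move=> Ix; have := Bh _ j (iL (f j) x Ix); rewrite (inv_lie formB).
  rewrite (gens_hf gens) (lin_formZ _ _ (linr x)) diagA mulNr => /eqP.
  rewrite oppr_eq0.
  by rewrite mulf_eq0 => /orP[/eqP/(intr_inj0 char0)//|/eqP].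
move=> x Ix y; move: y x Ix.
apply: (gen (S := fun y => forall x, I x -> B x y = 0)) => [|i].
  split; first split.
  - by move=> x _; apply: lin_form0 (linr x).
  - by move=> y z Sy Sz x Ix; rewrite (lin_formD _ _ (linr x)) Sy // Sz // addr0.
  - by move=> c y Sy x Ix; rewrite (lin_formZ _ _ (linr x)) Sy // mulr0.
  - by move=> y z Sy _ x Ix; rewrite -(inv_lie formB); apply/Sy/iL.
by split=> x Ix; auto.
Qed.

End OneForm.
End Radical.

(** * The cobracket and the Gabber-Kac theorem *)

Section Elimination.
Variables (K : fieldType) (M L : lieAlgType K) (B : M -> M -> K).
Variable phi : {linear M -> L}.
Hypothesis linl : forall y, lin_form (fun x => B x y).

Lemma lin_form_sum (t : M -> K) I (r : seq I) (F : I -> M) : lin_form t ->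
  t (\sum_(i <- r) F i) = \sum_(i <- r) t (F i).
Proof.
by move=> lt; apply: (big_morph t (fun x y => lin_formD x y lt) (lin_form0 lt)).
Qed.

(** A tensor that is killed by all products of forms [B _ y] and [B _ z] lies in
    the sum of the two tensor products with the radical; so it dies under a map
    that kills the radical. The tensor is a list of pairs, and a term with first
    factor outside the radical can be eliminated: a form that does not vanish on
    that factor expresses the second factor, modulo the radical, through those of
    the other terms. *)
Lemma tensor_radical (U : M -> Prop) (Z : seq (M * M)) : subspace U ->
  (forall x, U x -> radical B x -> phi x = 0) ->
  {in Z, forall s, U s.1 /\ U s.2} ->
  (forall y z, \sum_(s <- Z) B s.1 y * B s.2 z = 0) ->
  \sum_(s <- Z) lie (phi s.1) (phi s.2) = 0.
Proof.
move=> US kerU; have [_ UD UZ] := US.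
have [m] := ubnP (size Z); elim: m Z => // m IH [|[a b] Z] /= szZ UZs BZ.
  by rewrite big_nil.
have [Ua Ub] := UZs _ (mem_head _ _); rewrite /= in Ua Ub.
have UZ' s : s \in Z -> U s.1 /\ U s.2.
  by move=> sZ; apply: UZs; rewrite inE sZ orbT.
rewrite big_cons /=; have [Ra|nRa] := pselect (radical B a).
  rewrite kerU // lie0l add0r; apply: IH => // y z.
  by have := BZ y z; rewrite big_cons /= Ra mul0r add0r.
have [y0 y0P] : exists y, B a y != 0.
  apply: contrapT => ny; apply: nRa => y; apply/eqP.
  by apply: contrapT => By; apply: ny; exists y; apply/negP.
pose r (s : M * M) := B s.1 y0 / B a y0.
have /kerU E : U (b + \sum_(s <- Z) r s *: s.2).
  apply: UD => //; rewrite big_seq; apply: subspace_sum => // s sZ.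
  by apply: UZ; have [] := UZ' s sZ.
have Rb : radical B (b + \sum_(s <- Z) r s *: s.2).
  move=> z; apply: (mulfI y0P); rewrite mulr0 -[RHS](BZ y0 z) big_cons /=.
  rewrite (lin_formD _ _ (linl z)) (lin_form_sum _ _ (linl z)) mulrDr mulr_sumr.
  congr (_ + _); apply: eq_bigr => s _.
  by rewrite (lin_formZ _ _ (linl z)) /r mulrA mulrCA mulfV // mulr1.
pose Z' := [seq (s.1 - r s *: a, s.2) | s <- Z].
have : \sum_(s <- Z') lie (phi s.1) (phi s.2) = 0.
  apply: IH => [|s /mapP[t tZ ->]|y z] /=; first by rewrite size_map.
    have [U1 U2] := UZ' t tZ; split=> //.
    by apply: subspaceB => //; apply: UZ.
  rewrite big_map /=.
  under eq_bigr do rewrite (lin_formD _ _ (linl y)) (lin_formN _ (linl y))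
    (lin_formZ _ _ (linl y)) mulrBl.
  rewrite sumrB; have /eqP := BZ y z; rewrite big_cons /= addrC addr_eq0.
  move=> /eqP ->; rewrite -opprD; apply/eqP; rewrite oppr_eq0.
  rewrite [X in _ + X](eq_bigr (fun s => B a y * (r s * B s.2 z))); last first.
    by move=> s _; ring.
  rewrite -mulr_sumr -mulrDr.
  have := Rb z; rewrite (lin_formD _ _ (linl z)) (lin_form_sum _ _ (linl z)).
  under eq_bigr do rewrite (lin_formZ _ _ (linl z)).
  by move=> ->; rewrite mulr0.
rewrite big_map /= => EZ.
have := congr1 (lie (phi a)) (E Rb); rewrite lie0r raddfD raddf_sum /= lieDr.
rewrite lie_sumr => Ea; rewrite -[RHS](addr0 0) -[X in _ = X + _]Ea.
rewrite -[X in _ = _ + X]EZ -addrA; congr (_ + _).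
rewrite -big_split; apply: eq_bigr => s _ /=.
by rewrite raddfB /= lieBl !linearZZ lieZl lieZr addrCA subrr addr0.
Qed.

End Elimination.

Section Cobracket.
Variables (K : fieldType) (n : nat) (A : 'M[int]_n) (M : lieAlgType K).
Hypothesis symA : forall i j, A i j = A j i.
Hypothesis diagA : forall i, A i i = 2.
Variables (e f h : 'I_n -> M) (B : M -> M -> K).
Hypothesis gens : chevalley_gens A e f h.
Hypothesis formB : invariant_form A e f h B.
Variables neg zer pos : M -> M.
Hypothesis parts : forall x, [/\ x = neg x + zer x + pos x, npart f (neg x),
  cartan_part h (zer x) & npart e (pos x)].

Let linl y := inv_linl formB y.
Let linr x := inv_linr formB x.

(** The projection [pos] need not be linear, but the form restricted to the
    positive part in its first argument is bilinear, by [half_formE]. *)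
Definition half_form u v := B (pos u) v.

Lemma half_formE u v : half_form u v = B u (neg v).
Proof.
have [_ nu cu pu] := parts u; have [Ev nv cv pv] := parts v.
rewrite /half_form {1}Ev !(lin_formD _ _ (linr _)).
rewrite (inv_eh formB pu cv) (inv_ee formB pu pv) !addr0.
have [Eu _ _ _] := parts u; rewrite [in RHS]Eu !(lin_formD _ _ (linl _)).
by rewrite (inv_ff formB nu nv) (inv_hf formB cu nv) !add0r.
Qed.

Lemma half_linr u : lin_form (half_form u).
Proof. exact: linr. Qed.

Lemma half_linl v : lin_form (fun u => half_form u v).
Proof. by move=> c x y; rewrite !half_formE (linl _). Qed.

Lemma half_e u v : npart e u -> half_form u v = B u v.
Proof.
move=> nu; rewrite half_formE; have [Ev nv cv pv] := parts v.
rewrite [in RHS]Ev !(lin_formD _ _ (linr _)).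
by rewrite (inv_eh formB nu cv) (inv_ee formB nu pv) !addr0.
Qed.

Lemma half_h u v : cartan_part h u -> half_form u v = 0.
Proof.
move=> cu; rewrite half_formE; have [_ nv _ _] := parts v.
exact: inv_hf formB _ _ cu nv.
Qed.

Lemma half_f u v : npart f u -> half_form u v = 0.
Proof.
move=> nu; rewrite half_formE; have [_ nv _ _] := parts v.
exact: inv_ff formB _ _ nu nv.
Qed.

(** The coboundary of the half form, as a form in two variables: the pairing
    with [y] and [z] of the standard cobracket of [x]. *)
Definition cobracket x y z := half_form (lie y x) z + half_form y (lie z x).

(** Coboundaries of bilinear forms are cocycles. *)
Lemma cobracket_lie x1 x2 y z : cobracket (lie x1 x2) y z =
  cobracket x2 (lie y x1) z + cobracket x2 y (lie z x1) -
  (cobracket x1 (lie y x2) z + cobracket x1 y (lie z x2)).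
Proof.
have J u : lie u (lie x1 x2) = lie (lie u x1) x2 - lie (lie u x2) x1.
  by rewrite lieA (lieC x1) .
rewrite /cobracket !J (lin_formD _ _ (half_linl z)) (lin_formD _ _ (half_linr y)).
rewrite (lin_formN _ (half_linl z)) (lin_formN _ (half_linr y)); ring.
Qed.

Lemma cobracketD x1 x2 y z :
  cobracket (x1 + x2) y z = cobracket x1 y z + cobracket x2 y z.
Proof.
rewrite /cobracket !lieDr (lin_formD _ _ (half_linl z)).
by rewrite (lin_formD _ _ (half_linr y)) addrACA.
Qed.

Lemma cobracketZ c x y z : cobracket (c *: x) y z = c * cobracket x y z.
Proof.
rewrite /cobracket !lieZr (lin_formZ _ _ (half_linl z)).
by rewrite (lin_formZ _ _ (half_linr y)) mulrDr.
Qed.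

(** On generators the half form fails to be invariant only where a bracket with
    [e i] leads from the Cartan subalgebra into the positive part. *)
Lemma cobracket_gen i y z :
  cobracket (e i) y z = B (h i) y * B (e i) z.
Proof.
have [Ey ny cy py] := parts y; have ci := cartan_gen h i.
have mul0 c : lin_form (fun y => B (h i) y * B (e i) c).
  by move=> d u v; rewrite (linr _); ring.
have cob z' : lin_form (fun y => cobracket (e i) y z').
  move=> d u v; rewrite /cobracket lieDl lieZl.
  by rewrite (half_linl _) (half_linl _); ring.
rewrite {1 2}Ey !(lin_formD _ _ (cob z)) !(lin_formD _ _ (mul0 z)).
rewrite (inv_hf formB ci ny) (inv_he formB ci py) !mul0r add0r addr0.
have -> : cobracket (e i) (neg y) z = 0.
  rewrite /cobracket (half_f _ ny) addr0.
  have [c [u [Eu nu]]] := npart_lower (gens_swap gens) i ny.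
  rewrite lieC (lin_formN _ (half_linl z)) Eu (lin_formD _ _ (half_linl z)).
  rewrite (half_f _ nu) addr0 (lin_formZ _ _ (half_linl z)) /=.
  by rewrite (lin_formN _ (half_linl z)) (half_h _ ci) oppr0 mulr0 oppr0.
have -> : cobracket (e i) (pos y) z = 0.
  rewrite /cobracket (half_e _ py) half_e; last first.
    rewrite lieC; apply: subspaceN; first exact: npart_subspace.
    exact: npart_lie.
  rewrite -(inv_lie formB) (lieC (pos y)) (lin_formN _ (linl z)).
  by rewrite addNr.
rewrite add0r addr0.
apply: (cartan_ind (S := fun v =>
  cobracket (e i) v z = B (h i) v * B (e i) z)) cy.
  exact: lin_form_eq (cob z) (mul0 z).
move=> k; rewrite /cobracket (half_h _ (cartan_gen h k)) addr0.
rewrite (gens_he gens) (lin_formZ _ _ (half_linl z)) (inv_hh formB) (symA k i).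
by rewrite half_e //; apply: npart_gen.
Qed.

(** The Cartan element that corresponds to the weight [a] under the form. *)
Definition coweight (a : 'rV[int]_n) : M := \sum_i (a 0 i)%:~R *: h i.

Lemma coweightD a b : coweight (a + b) = coweight a + coweight b.
Proof.
rewrite /coweight -big_split; apply: eq_bigr => i _.
by rewrite mxE intrD scalerDl.
Qed.

Lemma coweight_simple i : coweight (simple_root i) = h i.
Proof.
rewrite /coweight (bigD1 i) //= mxE !eqxx scale1r big1 ?addr0 // => j /negPf ji.
by rewrite mxE ji andbF scale0r.
Qed.

Lemma lie_coweight a i : lie (e i) (coweight a) = - (pairing A i a)%:~R *: e i.
Proof.
rewrite /coweight lie_sumr /pairing rmorph_sum /= -sumrN scaler_suml.
apply: eq_bigr => j _.
by rewrite lieZr lieC (gens_he gens) scalerN scalerA intrM symA scaleNr mulrC.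
Qed.

(** The cobracket of a homogeneous positive element [x], minus its component
    with a Cartan factor, is a tensor [Z] in elements of lower degree, and the
    bracket maps it to a multiple of [x]: on the Borel subalgebra the cobracket is
    a cocycle and the bracket is equivariant, so that their composition is a
    derivation. It multiplies each generator by 2, hence [x] by twice its number
    of letters; the component with a Cartan factor accounts for the norm of [a]. *)
Lemma cobracket_tensor k a x : word e k a x -> exists Z : seq (M * M),
  [/\ {in Z, forall s, words e k s.1 /\ words e k s.2},
      \sum_(s <- Z) lie s.1 s.2 =
        ((2 * k.+1)%:Z - weight_form A a a)%:~R *: x &
      forall y z, \sum_(s <- Z) B s.1 y * B s.2 z + B (coweight a) y * B x z =
        cobracket x y z].
Proof.
elim=> {k a x}.
- move=> i; exists [::]; split=> // [|y z]; rewrite big_nil.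
    by rewrite weight_form_simplel pairing_simple diagA scale0r.
  by rewrite add0r cobracket_gen coweight_simple.
- move=> k a; exists [::]; split=> // [|y z]; rewrite big_nil ?scaler0 //.
  rewrite (lin_form0 (linl z)) mulr0 add0r /cobracket !lie0r.
  by rewrite (lin_form0 (half_linl z)) (lin_form0 (half_linr y)) addr0.
- move=> k a x y _ [Z1 [U1 S1 B1]] _ [Z2 [U2 S2 B2]]; exists (Z1 ++ Z2); split.
  + by move=> s; rewrite mem_cat => /orP[/U1|/U2].
  + by rewrite big_cat /= S1 S2 scalerDr.
  + move=> u v; rewrite big_cat cobracketD -B1 -B2 /= (lin_formD _ _ (linl v)).
    by ring.
- move=> k a c x _ [Z [UZ SZ BZ]]; exists [seq (c *: s.1, s.2) | s <- Z]; split.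
  + move=> s /mapP[t /UZ[U1 U2] ->]; split=> //.
    by have [_ _ Zw] := words_subspace e k; apply: Zw.
  + rewrite big_map /= scalerA mulrC -scalerA -SZ scaler_sumr.
    by apply: eq_bigr => s _; rewrite lieZl.
  + move=> y z; rewrite cobracketZ -BZ big_map /= mulrDr mulr_sumr.
    rewrite (lin_formZ _ _ (linl z)); congr (_ + _); last by ring.
    by apply: eq_bigr => s _; rewrite (lin_formZ _ _ (linl y)); ring.
- move=> i k a x wx [Z [UZ SZ BZ]].
  have [w0 wD wZ] := words_subspace e k.+1; pose c : K := (pairing A i a)%:~R.
  (* The last two terms come from [e i] acting on the Cartan factor of the
     cobracket of [x], and [x] acting on that of the cobracket of [e i]. *)
  exists ([seq (lie (e i) s.1, s.2) | s <- Z] ++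
    [seq (s.1, lie (e i) s.2) | s <- Z] ++ [:: (c *: x, e i); (- c *: e i, x)]).
  have wx' : words e k.+1 x by apply: word_words wx.
  have we : words e k.+1 (e i) by apply: word_words (ltn0Sn k) (word_gen e i).
  split.
  + move=> s; rewrite !mem_cat => /or3P[].
    * move=> /mapP[t /UZ[U1 U2] ->]; split; first exact: words_lie.
      exact: wordsW U2.
    * move=> /mapP[t /UZ[U1 U2] ->]; split; last exact: words_lie.
      exact: wordsW U1.
    * rewrite !inE => /orP[] /eqP -> /=; split=> //; exact: wZ.
  + rewrite !big_cat !big_map /= !big_cons big_nil /= addr0 addrA -big_split /=.
    under eq_bigr do rewrite -lieA.
    rewrite -lie_sumr SZ lieZr !lieZl (lieC x) scalerN -scaleNr -!scalerDl.
    congr (_ *: _); rewrite weight_formDl !weight_formDr !weight_form_simplel.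
    rewrite pairing_simple diagA.
    rewrite (weight_formC a (simple_root i) symA) weight_form_simplel /c.
    rewrite !(intrB, intrD); ring.
  + move=> y z; rewrite !big_cat !big_map /= !big_cons big_nil /= addr0.
    rewrite cobracket_lie -!BZ !cobracket_gen coweightD coweight_simple.
    have H1 : B (coweight a) (lie y (e i)) = - c * B (e i) y.
      by rewrite -(inv_lie formB) lie_coweight (lin_formZ _ _ (linl _)).
    have H2 : B x (lie z (e i)) = B (lie (e i) x) z by rewrite (inv_lie formB).
    have H3 : B (h i) (lie y x) = - (c * B x y).
      rewrite -(inv_lie formB) lieC (word_weight gens wx).
      by rewrite (lin_formN _ (linl _)) (lin_formZ _ _ (linl _)).
    have H4 : B (e i) (lie z x) = - B (lie (e i) x) z.
      by rewrite -(inv_lie formB) lieC (lin_formN _ (linl _)).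
    rewrite H1 H2 H3 H4 (lin_formD _ _ (linl y)).
    rewrite !(lin_formZ _ _ (linl y)).
    have -> : \sum_(s <- Z) B (lie (e i) s.1) y * B s.2 z =
        \sum_(s <- Z) B s.1 (lie y (e i)) * B s.2 z.
      by apply: eq_bigr => s _; rewrite (inv_lie formB).
    have -> : \sum_(s <- Z) B s.1 y * B (lie (e i) s.2) z =
        \sum_(s <- Z) B s.1 y * B s.2 (lie z (e i)).
      by apply: eq_bigr => s _; rewrite (inv_lie formB).
    by ring.
Qed.

End Cobracket.

Section GabberKac.
Variables (K : fieldType) (n : nat) (A : 'M[int]_n) (M L : lieAlgType K).
Hypothesis char0 : [pchar K] =i pred0.
Hypothesis symA : forall i j, A i j = A j i.
Hypothesis diagA : forall i, A i i = 2.
Hypothesis detA : \det A != 0.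
Variable phi : {linear M -> L}.
Hypothesis phi_lie : forall x y, phi (lie x y) = lie (phi x) (phi y).

(** There are no lowest weight vectors of positive weight: this is what
    integrability gives. *)
Definition no_positive_lowest (f h : 'I_n -> M) := forall i (y : L) (m : int),
  0 < m -> lie (phi (h i)) y = m%:~R *: y -> lie (phi (f i)) y = 0 -> y = 0.

Section OneSign.
Variables (e f h : 'I_n -> M) (B : M -> M -> K).
Hypothesis gens : chevalley_gens A e f h.
Hypothesis gen : generated e f h.
Hypothesis formB : invariant_form A e f h B.
Hypothesis integrable : no_positive_lowest f h.

(** If [x] is in the radical, its cobracket pairs to zero with everything, so it
    is a tensor with factors in the radical, of lower degree and hence killed by
    [phi]. The bracket of the cobracket is then killed, but that is [x] times the
    integer [2 * k.+1 - (a, a)]. If this is zero, [a] has positive norm, so it is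
    positive on some coroot [h i]. Lowering [x] by [f i] gives an element of the
    radical of lower degree, so [phi x] is a lowest weight vector of positive
    weight, and it vanishes by integrability. *)
Lemma radical_word k a x :
  (forall y, words e k y -> radical B y -> phi y = 0) ->
  word e k a x -> radical B x -> phi x = 0.
Proof.
move=> IH wx Rx; have linl y := inv_linl formB y.
have [[R0 RD RZ] RL] := (radical_subspace formB, radical_ideal formB).
have /choice[g gP] : forall x, exists t : M * M * M,
    [/\ x = t.1.1 + t.1.2 + t.2, npart f t.1.1, cartan_part h t.1.2 &
        npart e t.2].
  by move=> y; have [u [v [w H]]] := triangular_span gens gen y; exists (u, v, w).
have [Z [UZ SZ BZ]] := cobracket_tensor symA diagA gens formB gP wx.
have phiZ : \sum_(s <- Z) lie (phi s.1) (phi s.2) = 0.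
  apply: (tensor_radical linl (words_subspace e k) IH UZ) => y z.
  have := BZ y z; rewrite Rx mulr0 addr0 => ->.
  have [_ _ _ RI] := RL; rewrite /cobracket (half_formE formB gP).
  rewrite (RI y x Rx) add0r /half_form -(inv_lie formB) lieC.
  by rewrite (lin_formN _ (linl z)) (RI _ x Rx) oppr0.
have : phi (\sum_(s <- Z) lie s.1 s.2) = 0.
  by rewrite raddf_sum -[RHS]phiZ; apply: eq_bigr => s _; apply: phi_lie.
rewrite SZ linearZZ => /eqP; rewrite scaler_eq0 => /orP[/eqP c0|/eqP//].
have {c0} /eqP := intr_inj0 char0 c0; rewrite subr_eq0 => /eqP aa.
have [->|[a0 _]] := word_positive wx; first by rewrite raddf0.
have [i ai] : exists i, 0 < pairing A i a.
  apply: contrapT => na; have : weight_form A a a <= 0.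
    rewrite /weight_form -oppr_ge0 -sumrN; apply: sumr_ge0 => i _.
    rewrite -mulrN mulr_ge0 // oppr_ge0 leNgt; apply/negP => ai.
    by apply: na; exists i.
  by rewrite -aa.
apply: (integrable ai).
  by rewrite -phi_lie (word_weight gens wx) linearZZ.
rewrite -phi_lie; have [c [y [fx wy]]] := word_lower gens i wx.
have [_ Rc Ry] : [/\ radical B 0, radical B (c *: h i) & radical B y].
  have [_ _ _ RI] := RL; have [_ _ CZ] := cartan_subspace h.
  apply: (radical_parts gens gen formB).
  - by have [] := npart_subspace f.
  - exact/CZ/cartan_gen.
  - by exists k.
  - by rewrite add0r -fx; apply: RI.
have [_ _ CZ] := cartan_subspace h.
rewrite fx raddfD /= (IH y) // addr0.
by rewrite (radical_cartan formB char0 detA _ Rc) ?raddf0 //; apply/CZ/cartan_gen.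
Qed.

(** The radical is graded by the weights, so the homogeneous case suffices. *)
Lemma radical_words k x : words e k x -> radical B x -> phi x = 0.
Proof.
elim: k x => [|k IH] x wx Rx.
  by case: wx => [|//]; rewrite raddf0.
have [l Ex wl] := words_list wx.
have Rl a : radical B (\sum_(s <- l | s.1 == a) s.2).
  apply: (separate_weights char0 detA (radical_subspace formB)) => [j y Ry|s sl|].
  - by have [_ _ _] := radical_ideal formB; apply.
  - by have [j _ ws] := wl s sl; apply: word_weight gens _ _ _ ws.
  - by rewrite -Ex.
have phil a : phi (\sum_(s <- l | s.1 == a) s.2) = 0.
  have [dk|kd] := leqP (degree a) k.
    have wa : word e (degree a) a (\sum_(s <- l | s.1 == a) s.2).
      rewrite big_seq_cond; apply: (big_ind (word e (degree a) a)).
      - exact: word_0.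
      - exact: word_add.
      - move=> s /andP[sl /eqP sa]; have [j _] := wl s sl.
        by rewrite sa => /word_degree[].
    apply: (radical_word _ wa (Rl a)) => y wy; apply: IH.
    exact: wordsW wy.
  rewrite big_seq_cond big1 ?raddf0 // => s /andP[sl /eqP sa].
  have [j jk] := wl s sl; rewrite sa => /word_degree[[//|dj] _].
  by move: jk; rewrite ltnS leqNgt -dj kd.
suff -> : x = \sum_(a <- undup [seq s.1 | s <- l]) \sum_(s <- l | s.1 == a) s.2.
  by rewrite raddf_sum big1 // => a _; apply: phil.
rewrite Ex; under [RHS]eq_bigr do rewrite big_mkcond.
rewrite exchange_big /= big_seq [RHS]big_seq; apply: eq_bigr => s sl.
rewrite (bigD1_seq s.1) ?undup_uniq ?mem_undup ?map_f //= eqxx.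
by rewrite big1 ?addr0 // => a; rewrite eq_sym => /negPf ->.
Qed.

End OneSign.

(** The radical is the largest ideal that meets the Cartan subalgebra trivially;
    so an integrable representation of Chevalley generators automatically
    factors through the Kac-Moody algebra. *)
Theorem radical_integrable (e f h : 'I_n -> M) (B : M -> M -> K) :
  chevalley_gens A e f h -> generated e f h -> invariant_form A e f h B ->
  no_positive_lowest f h -> no_positive_lowest e (\- h) ->
  forall x, radical B x -> phi x = 0.
Proof.
move=> gens gen formB intf inte x.
have [u [v [w [-> nu cv nw]]]] := triangular_span gens gen x.
move=> /(radical_parts gens gen formB nu cv nw)[Ru Rv Rw].
rewrite (radical_cartan formB char0 detA cv Rv) addr0 raddfD /=.
have [[j wu] [k ww]] := (nu, nw).
rewrite (radical_words gens gen formB intf ww Rw) addr0.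
exact: radical_words (gens_swap gens) (generated_swap gen) (form_swap formB)
  inte _ _ wu Ru.
Qed.

End GabberKac.

(** * Locally nilpotent elements *)

(** The Cauchy product of two finite sums. *)
Lemma triangle_sum (V : zmodType) (F : nat -> nat -> V) m d : (m + m <= d)%N ->
  (forall i j, (m <= i)%N \/ (m <= j)%N -> F i j = 0) ->
  \sum_(k < d) \sum_(i < k.+1) F i (k - i)%N = \sum_(i < m) \sum_(j < m) F i j.
Proof.
move=> md F0.
have F1 k : (k < d)%N -> \sum_(i < k.+1) F i (k - i)%N =
    \sum_(0 <= i < d) if (i <= k)%N then F i (k - i)%N else 0.
  move=> kd; rewrite (big_cat_nat (n := k.+1)) //= [X in _ + X]big_nat_cond.
  rewrite [X in _ + X]big1 ?addr0 => [|i]; last first.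
    by rewrite andbT => /andP[ki _]; rewrite leqNgt ki.
  rewrite -(big_mkord xpredT (fun i => F i (k - i)%N)).
  rewrite [LHS]big_nat_cond [RHS]big_nat_cond.
  by apply: eq_bigr => i; rewrite andbT ltnS => /andP[_ ->].
under eq_bigr => k _ do rewrite (F1 k (ltn_ord k)).
rewrite exchange_big /= (big_cat_nat (n := m)) //=; last first.
  exact: leq_trans (leq_addr m m) md.
rewrite [X in _ + X]big_nat_cond [X in _ + X]big1 ?addr0 => [|i]; last first.
  rewrite andbT => /andP[mi _]; apply: big1 => k _.
  by case: ifP => // _; rewrite F0 //; left.
rewrite big_mkord; apply: eq_bigr => i _.
have im := ltn_ord i.
have id := leq_trans (ltnW im) (leq_trans (leq_addr m m) md).
rewrite -(big_mkord xpredT (fun k => if (i <= k)%N then F i (k - i)%N else 0)).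
rewrite (big_cat_nat (n := i)) //=.
rewrite big_nat_cond big1 ?add0r => [|k]; last first.
  by rewrite andbT => /andP[_ ki]; rewrite leqNgt ki.
rewrite -{1}[nat_of_ord i]add0n big_addn (big_cat_nat (n := m)) //=; last first.
  by rewrite leq_subRL // (leq_trans _ md) // leq_add2r ltnW.
rewrite [X in _ + X]big_nat_cond [X in _ + X]big1 ?addr0 => [|k]; last first.
  rewrite andbT => /andP[mk _]; rewrite leq_addl addnK F0 //; by right.
by rewrite big_mkord; apply: eq_bigr => k _; rewrite leq_addl addnK.
Qed.

Section LocallyNilpotent.
Variables (K : fieldType) (L : lieAlgType K).
Implicit Types x y z e f h : L.

Definition ad_nil x y := exists N, iter N (lie x) y = 0.
Definition locally_nilpotent x := forall y, ad_nil x y.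

Lemma iter_lie0 x N : iter N (lie x) 0 = 0.
Proof. by elim: N => //= N ->; rewrite lie0r. Qed.

Lemma iter_lieD x N y z :
  iter N (lie x) (y + z) = iter N (lie x) y + iter N (lie x) z.
Proof. by elim: N => //= N ->; rewrite lieDr. Qed.

Lemma iter_lieZ x N c y : iter N (lie x) (c *: y) = c *: iter N (lie x) y.
Proof. by elim: N => //= N ->; rewrite lieZr. Qed.

Lemma iter_lie_ge x N N' y : iter N (lie x) y = 0 -> (N <= N')%N ->
  iter N' (lie x) y = 0.
Proof. by move=> Ny /subnK <-; rewrite iterD Ny iter_lie0. Qed.

Lemma ad_nil_subalgebra x : subalgebra (ad_nil x).
Proof.
split; first split.
- by exists 0%N.
- move=> y z [N Ny] [N' Nz]; exists (N + N')%N.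
  rewrite iter_lieD (iter_lie_ge Ny (leq_addr _ _)).
  by rewrite (iter_lie_ge Nz (leq_addl _ _)) addr0.
- by move=> c y [N Ny]; exists N; rewrite iter_lieZ Ny scaler0.
move=> y z [N Ny] [N' Nz]; exists (N + N')%N.
elim: N N' y z Ny Nz => [|N IHN]; first by move=> N' y z /= -> _; rewrite lie0l iter_lie0.
elim=> [|N' IHN'] y z Ny Nz; first by rewrite /= in Nz; rewrite Nz lie0r iter_lie0.
rewrite addSn iterSr lieA iter_lieD IHN //; last by rewrite -iterSr.
by rewrite add0r addnS -addSn IHN' // -iterSr.
Qed.

Lemma locally_nilpotentN x : locally_nilpotent x -> locally_nilpotent (- x).
Proof.
move=> nx y; have [N Ny] := nx y; exists N.
have -> : iter N (lie (- x)) y = (-1) ^+ N *: iter N (lie x) y.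
  elim: N {Ny} => [|N IH] /=; first by rewrite scale1r.
  by rewrite IH lieZr lieNl scalerN -scaleNr exprS mulN1r.
by rewrite Ny scaler0.
Qed.

(** ** Strings of the three-dimensional simple Lie algebra *)

Lemma sl2_weight e h v (m : int) N : lie h e = 2 *: e -> lie h v = m%:~R *: v ->
  lie h (iter N (lie e) v) = (m + (2 * N)%:Z)%:~R *: iter N (lie e) v.
Proof.
move=> he hv; elim: N => [|N IH]; first by rewrite muln0 addr0.
rewrite [iter N.+1 _ _]/= lieA he lieZl IH lieZr -scalerDl; congr (_ *: _).
by rewrite mulnS !intrD; ring.
Qed.

Lemma sl2_lower e f h v (m : int) N : lie e f = h -> lie h e = 2 *: e ->
  lie h v = m%:~R *: v -> lie f v = 0 ->
  lie f (iter N.+1 (lie e) v) =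
    - (N.+1%:Z * (m + N%:Z))%:~R *: iter N (lie e) v.
Proof.
move=> ef he hv fv; elim: N => [|N IH].
  by rewrite /= lieA (lieC f) ef fv lie0r addr0 lieNl hv -scaleNr mul1r addr0.
rewrite [in LHS]iterS lieA (lieC f e) ef lieNl (sl2_weight _ he hv).
rewrite IH lieZr -iterS -scaleNr -scalerDl; congr (_ *: _).
rewrite !(mulnS, intrD, intrM, PoszD) -!opprD -(addn1 N.+1) -(addn1 N).
by rewrite !PoszD !intrD; ring.
Qed.

(** Lowering the end of the string of [y] under [e] gives a nonzero multiple of
    the term before it, so the string would never end. *)
Lemma nilpotent_no_positive_lowest e f h y (m : int) : [pchar K] =i pred0 ->
  locally_nilpotent e -> lie e f = h -> lie h e = 2 *: e -> 0 < m ->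
  lie h y = m%:~R *: y -> lie f y = 0 -> y = 0.
Proof.
move=> char0 ne ef he m0 hy fy; have [N] := ne y.
elim: N => [//|N IH] eNy; apply: IH.
have := sl2_lower N ef he hy fy; rewrite eNy lie0r => /esym/eqP.
rewrite scaler_eq0 oppr_eq0 => /orP[/eqP/(intr_inj0 char0)/eqP|/eqP //].
rewrite mulf_eq0 => /orP[//|/eqP mN]; exfalso.
by have := ltr_wpDr (ler0n int N) m0; rewrite natz mN ltxx.
Qed.

(** ** Exponentials *)

Section Exponential.
Hypothesis char0 : [pchar K] =i pred0.
Variable x : L.
Hypothesis nil : locally_nilpotent x.

Definition dpow N y : L := (N`!%:R : K)^-1 *: iter N (lie x) y.

(** The truncation depends on [y]; by [exp_adE], any larger one will do. *)
Definition exp_ad y : L := \sum_(i < projT1 (cid (nil y))) dpow i y.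

Lemma natK_neq0 N : (0 < N)%N -> (N%:R : K) != 0.
Proof. by move=> N0; rewrite ((pcharf0P K).1 char0) -lt0n. Qed.

Lemma dpowD N y z : dpow N (y + z) = dpow N y + dpow N z.
Proof. by rewrite /dpow iter_lieD scalerDr. Qed.

Lemma dpowZ N c y : dpow N (c *: y) = c *: dpow N y.
Proof. by rewrite /dpow iter_lieZ !scalerA mulrC. Qed.

Lemma dpow_ge N N' y : iter N (lie x) y = 0 -> (N <= N')%N -> dpow N' y = 0.
Proof. by move=> Ny le; rewrite /dpow (iter_lie_ge Ny le) scaler0. Qed.

Lemma sum_dpow N N' y : iter N (lie x) y = 0 -> (N <= N')%N ->
  \sum_(i < N') dpow i y = \sum_(i < N) dpow i y.
Proof.
move=> Ny /subnKC <-; rewrite big_split_ord /= [X in _ + X]big1 ?addr0 // => i _.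
by rewrite (dpow_ge Ny) // leq_addr.
Qed.

Lemma exp_adE N y : iter N (lie x) y = 0 -> exp_ad y = \sum_(i < N) dpow i y.
Proof.
move=> Ny; rewrite /exp_ad; case: (cid _) => N' /= N'y.
by have [le|/ltnW le] := leqP N N'; [|symmetry]; apply: sum_dpow.
Qed.

Lemma exp_ad_lin c y z : exp_ad (c *: y + z) = c *: exp_ad y + exp_ad z.
Proof.
have [[N Ny] [N' Nz]] := (nil y, nil z); pose m := maxn N N'.
have my := iter_lie_ge Ny (leq_maxl N N').
have mz := iter_lie_ge Nz (leq_maxr N N').
rewrite (exp_adE (N := m)) ?(exp_adE my) ?(exp_adE mz); last first.
  by rewrite iter_lieD iter_lieZ my mz scaler0 addr0.
rewrite scaler_sumr -big_split; apply: eq_bigr => i _.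
by rewrite dpowD dpowZ.
Qed.

Lemma dpowS N y : N.+1%:R *: dpow N.+1 y = lie x (dpow N y).
Proof.
rewrite /dpow lieZr scalerA factS natrM invfM mulrA mulfV ?natK_neq0 //.
by rewrite mul1r.
Qed.

(** The Leibniz rule, for divided powers. *)
Lemma dpow_lie N y z :
  dpow N (lie y z) = \sum_(i < N.+1) lie (dpow i y) (dpow (N - i) z).
Proof.
elim: N => [|N IH].
  by rewrite big_ord_recl big_ord0 addr0 /dpow /= invr1 !scale1r.
apply: (scalerI (natK_neq0 (ltn0Sn N))); rewrite dpowS IH lie_sumr.
under eq_bigr => i _ do
  rewrite lieA -!dpowS (lieZl i.+1%:R) (lieZr (N - i).+1%:R).
rewrite big_split /= scaler_sumr.
have -> : \sum_(i < N.+1) i.+1%:R *: lie (dpow i.+1 y) (dpow (N - i) z) =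
  \sum_(i < N.+2) i%:R *: lie (dpow i y) (dpow (N.+1 - i) z).
  by rewrite [RHS]big_ord_recl scale0r add0r; apply: eq_bigr.
have -> : \sum_(i < N.+1) (N - i).+1%:R *: lie (dpow i y) (dpow (N - i).+1 z) =
  \sum_(i < N.+2) (N.+1 - i)%:R *: lie (dpow i y) (dpow (N.+1 - i) z).
  rewrite [RHS]big_ord_recr /= subnn scale0r addr0; apply: eq_bigr => i _.
  by rewrite subSn // -ltnS.
rewrite -big_split; apply: eq_bigr => i _ /=.
by rewrite -scalerDl -natrD subnKC // -ltnS.
Qed.

Lemma exp_ad_lie y z : exp_ad (lie y z) = lie (exp_ad y) (exp_ad z).
Proof.
have [[N Ny] [N' Nz]] := (nil y, nil z); pose m := maxn N N'.
have my := iter_lie_ge Ny (leq_maxl N N').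
have mz := iter_lie_ge Nz (leq_maxr N N').
rewrite (exp_adE my) (exp_adE mz) lie_suml.
under [RHS]eq_bigr do rewrite lie_sumr.
have [d dyz] := nil (lie y z).
rewrite (exp_adE (N := (d + (m + m))%N)); last exact: iter_lie_ge dyz (leq_addr _ _).
under [LHS]eq_bigr do rewrite dpow_lie.
apply: (triangle_sum (F := fun i j => lie (dpow i y) (dpow j z))).
  exact: leq_addl.
by move=> i j [] le; rewrite ?(dpow_ge my le) ?(dpow_ge mz le) ?lie0l ?lie0r.
Qed.

(** The exponential is unipotent on every orbit of [ad x], hence onto. *)
Lemma exp_ad_surj y : exists z, exp_ad z = y.
Proof.
have expD u v : exp_ad (u + v) = exp_ad u + exp_ad v.
  by rewrite -[u]scale1r exp_ad_lin !scale1r.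
have exp0 : exp_ad 0 = 0 by rewrite (exp_adE (N := 0)) ?big_ord0.
have [N] := nil y; elim: N y => [|N IH] y Ny; first by exists 0; rewrite exp0 -Ny.
have /choice[g gE] : forall i, exists z, exp_ad z = dpow i.+1 y.
  move=> i; apply: IH; rewrite /dpow iter_lieZ -iterD.
  by rewrite (iter_lie_ge Ny) ?scaler0 // addnS ltnS leq_addr.
exists (y - \sum_(i < N) g i).
rewrite addrC -scaleN1r exp_ad_lin (big_morph exp_ad expD exp0).
have d0 : dpow 0 y = y by rewrite /dpow invr1 scale1r.
rewrite (exp_adE Ny) big_ord_recl [dpow _ _]d0 scaleN1r addrCA.
rewrite (eq_bigr (fun i : 'I_N => dpow i.+1 y)) => [|i _]; last exact: gE.
by rewrite addNr addr0.
Qed.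

End Exponential.
End LocallyNilpotent.

(** * Simple reflections *)

Section Weyl.
Variables (K : fieldType) (L : lieAlgType K).
Hypothesis char0 : [pchar K] =i pred0.
Implicit Types x y z e f h : L.

Record automorphism (s : L -> L) : Prop := Automorphism {
  aut_lin : forall c x y, s (c *: x + y) = c *: s x + s y;
  aut_lie : forall x y, s (lie x y) = lie (s x) (s y);
  aut_surj : forall y, exists x, s x = y }.

Lemma aut_comp s t : automorphism s -> automorphism t -> automorphism (s \o t).
Proof.
move=> [sl sm ss] [tl tm ts]; split=> [c x y|x y|y] /=.
- by rewrite tl sl.
- by rewrite tm sm.
- by have [x <-] := ss y; have [z <-] := ts x; exists z.
Qed.

Lemma aut0 s : automorphism s -> s 0 = 0.
Proof. by move=> a; have := aut_lin a (-1) 0 0; rewrite scaler0 addr0 scaleN1r addNr. Qed.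

Lemma autZ s c x : automorphism s -> s (c *: x) = c *: s x.
Proof. by move=> a; have := aut_lin a c x 0; rewrite !addr0 (aut0 a) addr0. Qed.

Lemma autD s x y : automorphism s -> s (x + y) = s x + s y.
Proof. by move=> a; have := aut_lin a 1 x y; rewrite !scale1r. Qed.

Lemma aut_nilpotent s x : automorphism s ->
  locally_nilpotent x -> locally_nilpotent (s x).
Proof.
move=> a nx y; have [z <-] := aut_surj a y; have [N Nz] := nx z; exists N.
have -> : iter N (lie (s x)) (s z) = s (iter N (lie x) z).
  by elim: N {Nz} => //= N ->; rewrite (aut_lie a).
by rewrite Nz aut0.
Qed.

Lemma exp_automorphism x (nx : locally_nilpotent x) : automorphism (exp_ad nx).
Proof. by split; [exact: exp_ad_lin|exact: exp_ad_lie|exact: exp_ad_surj]. Qed.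

Lemma exp_ad_step x (nx : locally_nilpotent x) y : lie x (lie x y) = 0 ->
  exp_ad nx y = y + lie x y.
Proof.
move=> xxy; rewrite (exp_adE nx (N := 2)) //.
by rewrite !big_ord_recl big_ord0 /dpow /= invr1 !scale1r addr0.
Qed.

(** The product [exp e * exp (- f) * exp e] lifts the nontrivial Weyl group
    element of the three-dimensional simple group. *)
Lemma reflection_exists e f h : locally_nilpotent e -> locally_nilpotent f ->
  lie e f = h -> lie h e = 2 *: e -> lie h f = - 2 *: f ->
  exists2 s, automorphism s &
    forall z c, lie z e = c *: e -> lie z f = - c *: f -> s z = z - c *: h.
Proof.
move=> ne nf ef he hf; have nNf := locally_nilpotentN nf.
pose E := exp_ad ne; pose F := exp_ad nNf.
have aE : automorphism E := exp_automorphism ne.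
have aF : automorphism F := exp_automorphism nNf.
exists (E \o (F \o E)) => [|z c ze zf /=]; first by do !apply: aut_comp.
have ez : lie e z = - c *: e by rewrite lieC ze scaleNr.
have eh : lie e h = - 2 *: e by rewrite lieC he scaleNr.
have fz : lie (- f) z = - c *: f by rewrite lieC lieNr opprK zf.
have Ez : E z = z + - c *: e.
  by rewrite /E exp_ad_step ez // lieZr liexx scaler0.
have Eh : E h = h + - 2 *: e.
  by rewrite /E exp_ad_step eh // lieZr liexx scaler0.
have Ee : E e = e by rewrite /E exp_ad_step liexx ?lie0r ?addr0.
have Fz : F z = z + - c *: f.
  by rewrite /F exp_ad_step fz // lieZr lieNl liexx oppr0 scaler0.
have n2 : (2 : K) != 0 by apply: (natK_neq0 char0 (N := 2)).
have Fe : F e = e + h - f.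
  have fe : lie (- f) e = h by rewrite lieC lieNr opprK.
  have fh : lie (- f) h = -2 *: f by rewrite lieC lieNr opprK.
  rewrite /F (exp_adE nNf (N := 3)) /=; last first.
    by rewrite fe fh lieZr lieNl liexx oppr0 scaler0.
  rewrite !big_ord_recl big_ord0 /dpow /= fe fh invr1 !scale1r addr0 addrA.
  by rewrite scalerA mulrN mulVf // scaleN1r.
rewrite Ez (autD _ _ aF) (autZ _ _ aF) Fz Fe.
have -> : z + - c *: f + - c *: (e + h - f) = z + (- c *: e + - c *: h).
  rewrite !scalerDr scalerN -!addrA; congr (_ + _).
  by rewrite addrC -!addrA addNr addr0.
rewrite !(autD _ _ aE, autZ _ _ aE) Ez Ee Eh !scalerDr !scalerA -addrA.
congr (_ + _); rewrite addrA -scalerDl addrCA -scalerDl.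
have -> : - c + - c + - c * -2 = 0 by ring.
by rewrite scale0r addr0 scaleNr.
Qed.

End Weyl.

Section RealRoots.
Variables (K : fieldType) (n : nat) (A : 'M[int]_n) (L : lieAlgType K).
Hypothesis char0 : [pchar K] =i pred0.
Hypothesis symA : forall i j, A i j = A j i.
Hypothesis diagA : forall i, A i i = 2.
Hypothesis detA : \det A != 0.
Variables (e f h : 'I_n -> L).
Hypothesis gens : chevalley_gens A e f h.
Hypothesis gen : generated e f h.

(** A root in the Weyl group orbit of a simple root, with root vectors carried
    along; instead of the orbit, the record asks for the properties of simple
    roots that reflections preserve. *)
Record real_root (b : 'rV[int]_n) (x y : L) : Prop := RealRoot {
  root_pos : weight_vector A h b x;
  root_neg : weight_vector A h (- b) y;
  root_coroot : lie x y = coweight h b;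
  root_norm : weight_form A b b = 2;
  root_nil_pos : locally_nilpotent x;
  root_nil_neg : locally_nilpotent y }.

Lemma coweight_weight a b x : weight_vector A h a x ->
  lie (coweight h b) x = (weight_form A b a)%:~R *: x.
Proof.
move=> wx; rewrite /coweight /weight_form lie_suml rmorph_sum /= scaler_suml.
by apply: eq_bigr => i _; rewrite lieZl wx scalerA intrM.
Qed.

Lemma weight_formN a b : weight_form A a (- b) = - weight_form A a b.
Proof.
apply/eqP; rewrite -addr_eq0 -weight_formDr addNr.
by rewrite /weight_form big1 // => i _; rewrite pairing0 mulr0.
Qed.

Lemma weight_formZr c a b : weight_form A a (c *: b) = c * weight_form A a b.
Proof.
rewrite /weight_form mulr_sumr; apply: eq_bigr => i _.
rewrite /pairing !mulr_sumr; apply: eq_bigr => j _.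
by rewrite mxE; ring.
Qed.

Definition root_reflect i b : 'rV[int]_n := b - pairing A i b *: simple_root i.

Lemma pairing_reflect i k b :
  pairing A k (root_reflect i b) = pairing A k b - pairing A i b * A k i.
Proof.
rewrite /root_reflect pairingD pairingN; congr (_ - _).
rewrite -pairing_simple /pairing mulr_sumr; apply: eq_bigr => j _.
by rewrite mxE; ring.
Qed.

Lemma coweight_reflect i b :
  coweight h (root_reflect i b) = coweight h b - (pairing A i b)%:~R *: h i.
Proof.
rewrite /root_reflect (coweightD h); congr (_ + _).
rewrite -coweight_simple /coweight scaler_sumr -sumrN; apply: eq_bigr => j _.
by rewrite !mxE intrN intrM scaleNr scalerA.
Qed.

Lemma reflect_norm i b : weight_form A (root_reflect i b) (root_reflect i b) =
  weight_form A b b.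
Proof.
have E a : weight_form A a (root_reflect i b) =
    weight_form A a b - pairing A i b * weight_form A a (simple_root i).
  by rewrite /root_reflect weight_formDr weight_formN weight_formZr.
rewrite E (weight_formC _ _ symA) E (weight_formC (root_reflect i b) _ symA) E.
rewrite (weight_formC b (simple_root i) symA).
by rewrite !weight_form_simplel pairing_simple diagA; ring.
Qed.

Lemma simple_real_root i : locally_nilpotent (e i) -> locally_nilpotent (f i) ->
  real_root (simple_root i) (e i) (f i).
Proof.
move=> ne nf; split=> //.
- exact: word_weight gens _ _ _ (word_gen e i).
- by apply/weight_swap/(word_weight (gens_swap gens))/word_gen.
- by rewrite (gens_ef gens) eqxx coweight_simple.
- by rewrite weight_form_simplel pairing_simple.
Qed.

Lemma real_root_reflect i b x y :
  locally_nilpotent (e i) -> locally_nilpotent (f i) ->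
  real_root b x y -> exists x' y', real_root (root_reflect i b) x' y'.
Proof.
move=> ne nf [wx wy xy nb nx ny].
have he : lie (h i) (e i) = 2 *: e i by rewrite (gens_he gens) diagA.
have hf : lie (h i) (f i) = - 2 *: f i by rewrite (gens_hf gens) diagA.
have ef : lie (e i) (f i) = h i by rewrite (gens_ef gens) eqxx.
have [s aut sE] := reflection_exists char0 ne nf ef he hf.
have sh k : s (h k) = h k - (A k i)%:~R *: h i.
  by apply: sE; rewrite ?(gens_he gens) ?(gens_hf gens).
have shi : s (h i) = - h i.
  rewrite sh diagA -{1}[h i]scale1r -scalerBl -scaleN1r; congr (_ *: _).
  by ring.
have shk k : s (h k - (A k i)%:~R *: h i) = h k.
  rewrite -scaleNr (autD _ _ aut) (autZ _ _ aut) sh shi.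
  by rewrite scalerN scaleNr opprK subrK.
have wE a z : weight_vector A h a z -> weight_vector A h (root_reflect i a) (s z).
  move=> wz k; rewrite -[in LHS](shk k) -(aut_lie aut) lieBl lieZl !wz.
  rewrite scalerA -scalerBl (autZ _ _ aut) pairing_reflect intrB intrM.
  by rewrite (mulrC (A k i)%:~R).
have rN : - root_reflect i b = root_reflect i (- b).
  by rewrite /root_reflect opprB pairingN scaleNr opprK addrC.
exists (s x), (s y); split.
- exact: wE.
- by rewrite rN; apply: wE.
- rewrite -(aut_lie aut) xy coweight_reflect; apply: sE.
  + rewrite (coweight_weight (a := simple_root i)).
      by rewrite (weight_formC _ _ symA) weight_form_simplel.
    exact: word_weight gens _ _ _ (word_gen e i).
  + rewrite (coweight_weight (a := - simple_root i)).
      by rewrite weight_formN (weight_formC _ _ symA) weight_form_simplel mulrNz.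
    by apply/weight_swap/(word_weight (gens_swap gens))/word_gen.
- by rewrite reflect_norm.
- exact: aut_nilpotent.
- exact: aut_nilpotent.
Qed.

(** ** Weights that do not occur *)

(** The triangular decomposition has only positive and negative words besides
    the Cartan part; so a weight that neither of them has does not occur. *)
Lemma weight_absent a x : weight_vector A h a x -> a <> 0 ->
  (forall k y, word e k a y -> y = 0) ->
  (forall k y, word f k (- a) y -> y = 0) -> x = 0.
Proof.
move=> wx a0 ea fa.
have [u [v [w [Ex nu cv nw]]]] := triangular_span gens gen x.
have [k /words_list[lu Eu wu]] := nu.
have [j /words_list[lw Ew ww]] := nw.
have T0 := subspace0 L.
apply: (separate_weight char0 detA T0 _ (a := a) (l :=
   [seq (- s.1, - s.2) | s <- lu] ++ (0, - v) :: [seq (s.1, - s.2) | s <- lw])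
   (h := h)) => //.
- by move=> i y ->; rewrite lie0r.
- have WN b y : weight_vector A h b y -> weight_vector A h b (- y).
    by apply: subspaceN; apply: weight_subspace.
  move=> s; rewrite mem_cat inE => /or3P[/mapP[t tl ->]|/eqP ->|/mapP[t tl ->]] /=.
  + have [i _ wt] := wu t tl; split.
      by apply/WN/weight_swap/(word_weight (gens_swap gens) wt).
    have [ta|ta] := pselect (- t.1 = a); last by right.
    by left; rewrite (fa i t.2) ?oppr0 // -ta opprK.
  + split; last by right=> a0'; apply: a0.
    exact/WN/(cartan_weight gens).
  + have [i _ wt] := ww t tl; split; first exact/WN/(word_weight gens wt).
    have [ta|ta] := pselect (t.1 = a); last by right.
    by left; rewrite (ea i t.2) ?oppr0 // -ta.
- rewrite big_cat big_cons !big_map /= !sumrN -Eu -Ew Ex.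
  by rewrite -!opprD addrA subrr.
Qed.

(** The bracket of a generator with itself vanishes. *)
Lemma word_multiple k a i y : word e k a y -> (forall j, j != i -> a 0 j = 0) ->
  y = 0 \/ a = simple_root i.
Proof.
move=> wy ai.
suff : y = 0 \/ a = simple_root i /\ exists c, y = c *: e i.
  by case=> [|[]]; [left|right].
elim: wy ai => {k a y} [j|k a|k a x y _ IHx _ IHy|k a c x _ IH|j k a x wx IH] ai.
- right; have [->|ji] := eqVneq j i; first by split=> //; exists 1; rewrite scale1r.
  by have := ai j ji; rewrite mxE !eqxx.
- by left.
- case: (IHx ai) => [->|[ea [c ->]]]; first by rewrite add0r; apply: IHy.
  case: (IHy ai) => [->|[_ [d ->]]]; right; split=> //.
    by exists c; rewrite addr0.
  by exists (c + d); rewrite scalerDl.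
- case: (IH ai) => [->|[ea [d ->]]]; first by left; rewrite scaler0.
  by right; split=> //; exists (c * d); rewrite scalerA.
- left; have [->|[a0 _]] := word_positive wx; first by rewrite lie0r.
  have H j' : j' != i -> a 0 j' = 0 /\ j != j'.
    move=> j'i; have := ai j' j'i; rewrite !mxE eqxx /= eq_sym.
    case: (j =P j') => [_|_] /=; last by rewrite addr0.
    by move=> E; have := ltr_wpDl (a0 j') ltr01; rewrite [X in _ < X]E ltxx.
  have [->|[_ [c ->]]] := IH (fun j' ji => (H j' ji).1); first by rewrite lie0r.
  have -> : j = i by apply/eqP; apply: contraT => /H[_]; rewrite eqxx.
  by rewrite lieZr liexx scaler0.
Qed.

End RealRoots.

(** * Kac-Moody algebras *)

Record symmetric_gcm n (A : 'M[int]_n) : Prop := SymmetricGCM {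
  gcm_sym : forall i j, A i j = A j i;
  gcm_diag : forall i, A i i = 2;
  gcm_off : forall i j, i != j -> A i j <= 0;
  gcm_det : \det A != 0 }.

Section KacMoodyAlgebra.
Variables (K : fieldType) (n : nat) (A : 'M[int]_n).
Hypothesis char0 : [pchar K] =i pred0.
Hypothesis gcmA : symmetric_gcm A.

Let symA := gcm_sym gcmA.
Let diagA := gcm_diag gcmA.
Let detA := gcm_det gcmA.

Notation tilde := (presented (@km_tilde_rel K n A)).
Notation km := (presented (@km_rel K n A)).

Definition tilde_e : 'I_n -> tilde := km_gen (@km_tilde_rel K n A) (@Ce n).
Definition tilde_f : 'I_n -> tilde := km_gen (@km_tilde_rel K n A) (@Cf n).
Definition tilde_h : 'I_n -> tilde := km_gen (@km_tilde_rel K n A) (@Ch n).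
Definition km_e : 'I_n -> km := km_gen (@km_rel K n A) (@Ce n).
Definition km_f : 'I_n -> km := km_gen (@km_rel K n A) (@Cf n).
Definition km_h : 'I_n -> km := km_gen (@km_rel K n A) (@Ch n).

Lemma tilde_contragredient :
  contragredient A tilde_e tilde_f tilde_h (@tilde_coord K n A).
Proof.
split; [exact: presented_gens|exact: presented_generated|].
exact: tilde_coordinates.
Qed.

Lemma km_gens : chevalley_gens A km_e km_f km_h.
Proof. by apply: presented_gens => t u; apply: km_tildeW. Qed.

Lemma km_generated : generated km_e km_f km_h.
Proof. exact: presented_generated. Qed.

Let tgens := contra_gens tilde_contragredient.
Let tgen := contra_generated tilde_contragredient.

Lemma tilde_cartan_part c : cartan_part tilde_h (km_tilde_cartan A c).
Proof. by exists c. Qed.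

Lemma tilde_cartan_inj (c : 'rV[K]_n) : km_tilde_cartan A c = 0 -> c = 0.
Proof.
move=> c0; apply/rowP=> k; rewrite mxE.
have := coord_cartan tilde_contragredient k (fun j => c 0 j).
move=> <-; rewrite -[X in tilde_coord k X]/(km_tilde_cartan A c) c0.
exact: lin_form0 (coord_lin (contra_coord tilde_contragredient) k).
Qed.

Section Quotient.
Variable B : tilde -> tilde -> K.
Hypothesis formB : invariant_form A tilde_e tilde_f tilde_h B.

Lemma km_ideal_radical (I : km_tilde K A -> Prop) : lie_ideal I ->
  (forall c, I (km_tilde_cartan A c) -> km_tilde_cartan A c = 0) ->
  forall x, I x -> radical B x.
Proof.
move=> idI I0; apply: (ideal_radical tgens tgen formB char0 detA diagA idI).
by move=> _ [c ->]; apply: I0.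
Qed.

Lemma radical_km_rel t : radical B (pclass t) -> km_rel A t Tzero.
Proof.
move=> Rt; apply: (km_radical (I := radical B)) => //.
  exact: radical_ideal formB.
by move=> c; apply: (radical_cartan formB char0 detA); apply: tilde_cartan_part.
Qed.

(** The congruence that defines the algebra is that of the radical. *)
Lemma km_cong_radical t u :
  cong (@km_rel K n A) t u -> radical B (pclass t - pclass u).
Proof.
have RS := radical_subspace formB; have [R0 RD RZ] := RS.
have [_ _ _ RI] := radical_ideal formB.
have eqR v w : cong (@km_tilde_rel K n A) v w ->
    radical B (pclass v - pclass w : tilde).
  by move=> vw; rewrite (_ : pclass v = pclass w) ?subrr //; apply/pclassP.
have RIr x y : radical B x -> radical B (lie x y).
  by move=> Rx; rewrite lieC; apply/(subspaceN RS)/RI.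
elim=> {t u}; try by move=> *; apply: eqR; constructor.
- move=> t u [v w vw|I v idI I0 Iv]; first by apply/eqR/cong_rel.
  rewrite presented_0E subr0.
  exact: km_ideal_radical idI I0 _ Iv.
- by move=> t u _ R; rewrite -opprB; apply: (subspaceN RS).
- move=> t u v _ R1 _ R2.
  by rewrite -(subrK (pclass u : tilde) (pclass t)) -addrA; apply: RD.
- by move=> t t' _ R; rewrite !presentedE -opprD; apply: (subspaceN RS).
- move=> t t' u u' _ R1 _ R2; rewrite !presentedE opprD addrACA.
  exact: RD.
- by move=> c t t' _ R; rewrite !presentedE -scalerBr; apply: RZ.
- move=> t t' u u' _ R1 _ R2; rewrite !presentedE.
  set x := pclass t : tilde; set x' := pclass t' : tilde.
  rewrite (_ : _ - _ = lie (x - x') (pclass u) + lie x' (pclass u - pclass u')).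
    by apply: RD; [apply: RIr|apply: RI].
  by rewrite lieBl lieBr addrA subrK.
Qed.

Lemma km_projection : exists pi : {linear tilde -> km},
  [/\ forall x y, pi (lie x y) = lie (pi x) (pi y),
      forall t, pi (pclass t) = pclass t &
      forall x, pi x = 0 <-> radical B x].
Proof.
have evE t : eval (M := km) (fun g => pgen (@km_rel K n A) g) t = pclass t.
  elim: t => //= [t ->|t -> u ->|c t ->|t -> u ->]; rewrite ?presentedE //.
have [|pi [pi_lie piE]] :=
    @presented_universal K _ (@km_tilde_rel K n A) km
      (fun g => pgen (@km_rel K n A) g).
  by move=> t u tu; rewrite !evE; apply/pclassP/cong_rel/km_tildeW.
have piE' t : pi (pclass t) = pclass t by rewrite piE evE.
exists pi; split=> // x; rewrite -[x]preprK piE' -presented_0E; split.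
  move/pclassP/km_cong_radical; rewrite presented_0E subr0.
  by [].
by move=> Rx; apply/pclassP/cong_rel/radical_km_rel.
Qed.

End Quotient.

Lemma tilde_form : exists B, invariant_form A tilde_e tilde_f tilde_h B.
Proof. exact: (invariant_form_exists symA tilde_contragredient). Qed.

Lemma km_cartan_inj (c : 'rV[K]_n) : cartan A c = 0 -> c = 0.
Proof.
have [B formB] := tilde_form; have [pi [pi_lie piE piK]] := km_projection formB.
move=> c0; apply/tilde_cartan_inj/(radical_cartan formB char0 detA).
  exact: tilde_cartan_part.
apply/piK; rewrite -[RHS]c0 /km_tilde_cartan /cartan raddf_sum.
apply: eq_bigr => i _; apply: (etrans (linearZZ pi (c 0 i) (tilde_h i))).
by congr (_ *: _); apply: piE.
Qed.

(** ** The Serre relations *)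

Section Serre.
Variables (M : lieAlgType K) (e f h : 'I_n -> M) (B : M -> M -> K).
Hypothesis gens : chevalley_gens A e f h.
Hypothesis gen : generated e f h.
Hypothesis formB : invariant_form A e f h B.

(** The Serre element is annihilated by all lowering operators: by [f i] since it
    is the first vector past the end of a finite string for the three-dimensional
    subalgebra of [i], and by the others since these commute with [e i] and leave
    at most a coroot of the innermost letter, which is annihilated then. *)
Lemma serre_radical i j N : i != j -> A i j = - N%:Z ->
  radical B (iter N.+1 (lie (e i)) (e j)).
Proof.
move=> ij AijN; apply: (radical_singular gens gen formB char0 diagA).
  by elim: N {AijN} => [|N IH]; rewrite iterS; apply: npart_lie; [apply: npart_gen|].
move=> k; have he : lie (h i) (e i) = 2 *: e i by rewrite (gens_he gens) diagA.
have ef : lie (e i) (f i) = h i by rewrite (gens_ef gens) eqxx.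
have hj : lie (h i) (e j) = (- N%:Z)%:~R *: e j by rewrite (gens_he gens) AijN.
have fj : lie (f i) (e j) = 0.
  by rewrite lieC (gens_ef gens) eq_sym (negPf ij) oppr0.
have [->|ki] := eqVneq k i.
  by rewrite (sl2_lower N ef he hj fj) addNr mulr0 oppr0 scale0r.
have comm v : lie (f k) (lie (e i) v) = lie (e i) (lie (f k) v).
  by rewrite lieA (lieC (f k)) (gens_ef gens) eq_sym (negPf ki) oppr0 lie0l add0r.
have -> : lie (f k) (iter N.+1 (lie (e i)) (e j)) =
    iter N.+1 (lie (e i)) (lie (f k) (e j)).
  by elim: N.+1 => //= m IH; rewrite comm IH.
rewrite (lieC (f k)) (gens_ef gens); case: eqP => [jk|_]; last first.
  by rewrite oppr0 iter_lie0.
rewrite iterSr lieNr (lieC _ (h j)) opprK (gens_he gens) -[A j i]symA AijN.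
case: N {AijN hj} => [|N]; first by rewrite /= oppr0 scale0r.
by rewrite iterSr lieZr liexx scaler0 iter_lie0.
Qed.

End Serre.

(** Stated for abstract generators of the algebra without Serre relations, so that
    it applies with the signs exchanged. *)
Lemma km_nilpotent (e f h : 'I_n -> tilde) B (pi : {linear tilde -> km}) :
  chevalley_gens A e f h -> generated e f h -> invariant_form A e f h B ->
  (forall x y, pi (lie x y) = lie (pi x) (pi y)) ->
  (forall x, pi x = 0 <-> radical B x) ->
  generated (pi \o e) (pi \o f) (pi \o h) ->
  forall i, locally_nilpotent (pi (e i)).
Proof.
move=> gens gen formB pi_lie piK kgen i.
have pi_iter N x : iter N (lie (pi (e i))) (pi x) = pi (iter N (lie (e i)) x).
  by elim: N => //= N ->; rewrite pi_lie.
apply: kgen; first exact: ad_nil_subalgebra.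
have he : lie (e i) (h i) = - 2 *: e i.
  by rewrite lieC (gens_he gens) diagA scaleNr.
move=> j; split.
- have [->|ij] := eqVneq j i; first by exists 1%N; rewrite pi_iter /= liexx raddf0.
  have [N AN] : exists N : nat, A i j = - N%:Z.
    have := gcm_off gcmA (negbT (negPf ij)); rewrite symA.
    by case: (A i j) => [[|//]|m] _; [exists 0%N|exists m.+1; rewrite NegzE].
  exists N.+1; rewrite pi_iter; apply/piK.
  by apply: (serre_radical gens gen formB _ AN); rewrite eq_sym.
- exists 3; rewrite pi_iter /= (gens_ef gens); case: eqP => _; last first.
    by rewrite !lie0r raddf0.
  by rewrite he lieZr liexx scaler0 raddf0.
- exists 2; rewrite pi_iter /= (lieC (e i) (h j)) (gens_he gens) -scaleNr lieZr liexx.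
  by rewrite scaler0 raddf0.
Qed.

Lemma km_e_f_nilpotent i :
  locally_nilpotent (km_e i) /\ locally_nilpotent (km_f i).
Proof.
have [B formB] := tilde_form; have [pi [pi_lie piE piK]] := km_projection formB.
have Ee : pi \o tilde_e = km_e by apply/funext=> j; apply: piE.
have Ef : pi \o tilde_f = km_f by apply/funext=> j; apply: piE.
have Eh : pi \o tilde_h = km_h by apply/funext=> j; apply: piE.
have Eh' : pi \o (\- tilde_h) = (\- km_h).
  by apply/funext=> j /=; rewrite raddfN -Eh.
split.
  rewrite -Ee; apply: (km_nilpotent tgens tgen formB pi_lie piK).
  by rewrite Ee Ef Eh; apply: km_generated.
rewrite -Ef; apply: (km_nilpotent (gens_swap tgens) (generated_swap tgen)
  (form_swap formB) pi_lie piK).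
by rewrite Ee Ef Eh'; exact: generated_swap km_generated.
Qed.

End KacMoodyAlgebra.

(** * Subalgebras generated by real root vectors *)

Section Embedding.
Variables (K : fieldType) (n : nat) (A A' : 'M[int]_n).
Hypothesis char0 : [pchar K] =i pred0.
Hypothesis gcmA : symmetric_gcm A.
Hypothesis gcmA' : symmetric_gcm A'.

Notation km := (presented (@km_rel K n A)).

Variables (b : 'I_n -> 'rV[int]_n) (x y : 'I_n -> km).
Hypothesis roots : forall i, real_root A (@km_h K n A) (b i) (x i) (y i).
Hypothesis gram : forall i j, weight_form A (b i) (b j) = A' i j.
Hypothesis simple : forall i j, i != j -> lie (x i) (y j) = 0.

Let z i : km := coweight (@km_h K n A) (b i).
Let kgens := km_gens K A.

Lemma sub_gens : chevalley_gens A' x y z.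
Proof.
split=> i j.
- rewrite /z {2}/coweight lie_sumr big1 // => k _.
  rewrite lieZr /coweight lie_suml big1 ?scaler0 // => k' _.
  by rewrite lieZl (gens_hh kgens) scaler0.
- by case: eqVneq => [->|/simple //]; apply: root_coroot (roots j).
- by rewrite (coweight_weight _ (root_pos (roots j))) gram.
- by rewrite (coweight_weight _ (root_neg (roots j))) weight_formN gram mulrNz.
Qed.

Definition sub_gen (g : chevalley n) : km :=
  match g with Ce i => x i | Cf i => y i | Ch i => z i end.

Lemma sub_tilde_rel t u :
  @km_tilde_rel K n A' t u -> eval (M := km) sub_gen t = eval (M := km) sub_gen u.
Proof.
case=> i j /=.
- exact: gens_hh sub_gens i j.
- by rewrite (gens_ef sub_gens); case: eqP.
- exact: gens_he sub_gens i j.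
- exact: gens_hf sub_gens i j.
Qed.

Definition root_matrix : 'M[K]_n := \matrix_(i, j) (b i 0 j)%:~R.

Lemma root_matrix_gram :
  root_matrix *m map_mx intr A *m root_matrix^T = map_mx intr A'.
Proof.
apply/matrixP=> i j; rewrite !mxE -gram /weight_form rmorph_sum /=.
under eq_bigr do rewrite !mxE mulr_suml.
rewrite exchange_big; apply: eq_bigr => k _ /=.
rewrite /pairing rmorphM rmorph_sum /= mulr_sumr; apply: eq_bigr => l _.
by rewrite !mxE rmorphM mulrA.
Qed.

Lemma root_matrix_unit : root_matrix \in unitmx.
Proof.
have : (map_mx intr A' : 'M[K]_n) \in unitmx.
  by rewrite unitmxE unitfE; apply: detK_neq0 char0 _ _ (gcm_det gcmA').
by rewrite -root_matrix_gram -mulmxA unitmx_mul => /andP[].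
Qed.

Lemma sum_coroot (c : 'rV[K]_n) :
  \sum_i c 0 i *: z i = cartan A (c *m root_matrix).
Proof.
rewrite /z /coweight /cartan; under eq_bigr do rewrite scaler_sumr.
rewrite exchange_big; apply: eq_bigr => j _ /=.
rewrite mxE scaler_suml; apply: eq_bigr => i _.
by rewrite scalerA mxE.
Qed.

(** Real root vectors act locally nilpotently; so the homomorphism that they
    define on the algebra without Serre relations kills the radical, by
    [radical_integrable]. Its kernel is no larger, since the coroots of the roots
    are independent. *)
Theorem km_embedding : exists g : {linear kac_moody K A' -> kac_moody K A},
  lie_embedding g /\
  forall c, g (cartan A' c) = cartan A (c *m root_matrix).
Proof.
have [phi [phi_lie phiE]] := presented_universal sub_tilde_rel.
have [B formB] := tilde_form K gcmA'.
have data := tilde_contragredient K A'.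
have [symA' diagA' _ detA'] := gcmA'.
have he i : lie (z i) (x i) = 2 *: x i by rewrite (gens_he sub_gens) diagA'.
have hf i : lie (- z i) (y i) = 2 *: y i.
  by rewrite lieNl (gens_hf sub_gens) diagA' -scaleNr opprK.
have ef i : lie (x i) (y i) = z i by rewrite (gens_ef sub_gens) eqxx.
have fe i : lie (y i) (x i) = - z i by rewrite lieC ef.
have phi_e i : phi (tilde_e K A' i) = x i by rewrite phiE.
have phi_f i : phi (tilde_f K A' i) = y i by rewrite phiE.
have phi_h i : phi (tilde_h K A' i) = z i by rewrite phiE.
have kill u : radical B u -> phi u = 0.
  apply: (radical_integrable char0 symA' diagA' detA' phi_lie
    (contra_gens data) (contra_generated data) formB).
  - move=> i v m m0; rewrite phi_f phi_h => hv fv.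
    exact: (nilpotent_no_positive_lowest char0 (root_nil_pos (roots i))
      (ef i) (he i) m0 hv fv).
  - move=> i v m m0 /=; rewrite raddfN /= phi_e phi_h => hv fv.
    exact: (nilpotent_no_positive_lowest char0 (root_nil_neg (roots i))
      (fe i) (hf i) m0 hv fv).
have phi_cartan c : phi (km_tilde_cartan A' c) = cartan A (c *m root_matrix).
  rewrite -sum_coroot /km_tilde_cartan raddf_sum; apply: eq_bigr => i _.
  apply: (etrans (linearZZ phi (c 0 i) (tilde_h K A' i))).
  by congr (_ *: _); apply: phi_h.
have [t u|g [g_lie gE]] := @presented_universal K _ (@km_rel K n A') km sub_gen.
  case=> [v w /sub_tilde_rel //|I v idI I0 Iv].
  by rewrite -phiE; apply/kill/(km_ideal_radical char0 gcmA' formB idI I0).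
exists g; split; last first.
  move=> c; rewrite -phi_cartan /cartan /km_tilde_cartan !raddf_sum.
  apply: eq_bigr => i _.
  apply: (etrans (linearZZ g (c 0 i) (km_h K A' i))).
  apply: (etrans _ (esym (linearZZ phi (c 0 i) (tilde_h K A' i)))).
  congr (_ *: _); apply: (etrans _ (esym (phi_h i))).
  exact: (gE (Tgen (Ch i))).
split=> //; suff inj u : g u = 0 -> u = 0.
  move=> u v guv; apply/eqP; rewrite -subr_eq0; apply/eqP/inj.
  by rewrite raddfB /= guv subrr.
rewrite -[u]preprK gE -phiE => phiu.
rewrite -[RHS](presented_0E (@km_rel K n A')); apply/pclassP/cong_rel.
apply: (km_radical (I := fun v => phi v = 0)) => //.
- split=> [|v w pv pw|c v pv|v w pw]; first exact: raddf0.
  + by rewrite raddfD /= pv pw addr0.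
  + by apply: (etrans (linearZZ phi c v)); rewrite pv scaler0.
  + by apply: (etrans (phi_lie v w)); rewrite pw lie0r.
- move=> c; rewrite phi_cartan => /(km_cartan_inj char0 gcmA) c0.
  rewrite -[c](mulmxK root_matrix_unit) c0 mul0mx /km_tilde_cartan big1 // => i _.
  by rewrite mxE scale0r.
Qed.

End Embedding.

(** * Rank two *)

Section RankTwo.
Variables (a : nat).
Hypothesis a3 : (3 <= a)%N.

Let A := rank2_cartan_matrix a.

Definition vec (x y : int) : 'rV[int]_2 := \row_j (if j == 0 then x else y).

Lemma vecB x y x' y' : vec x y - vec x' y' = vec (x - x') (y - y').
Proof. by apply/rowP=> j; rewrite !mxE; case: (_ == _). Qed.

Lemma rank2_gcm : symmetric_gcm A.
Proof.
split=> [i j|i|i j ij|].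
- by rewrite !mxE eq_sym.
- by rewrite mxE eqxx.
- by rewrite mxE (negPf ij) oppr_le0.
rewrite (expand_det_row _ 0) !big_ord_recl big_ord0 /cofactor !det_mx11 !mxE /=.
rewrite /bump /= !expr0 !expr1.
apply/eqP; nia.
Qed.

Lemma pairing_vec i x y :
  pairing A i (vec x y) = if i == 0 then 2 * x - a%:Z * y else 2 * y - a%:Z * x.
Proof.
rewrite /pairing !big_ord_recl big_ord0 !mxE /=.
by case: i => [[|[|//]]] ? /=; ring.
Qed.

Lemma weight_form_vec x y x' y' : weight_form A (vec x y) (vec x' y') =
  2 * x * x' + 2 * y * y' - a%:Z * (x * y' + y * x').
Proof.
rewrite /weight_form !big_ord_recl big_ord0 !pairing_vec !mxE /=.
by ring.
Qed.

Lemma reflect_vec0 x y : root_reflect A 0 (vec x y) = vec (a%:Z * y - x) y.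
Proof.
rewrite /root_reflect pairing_vec eqxx; apply/rowP=> j; rewrite !mxE.
by case: j => [[|[|//]]] ? /=; ring.
Qed.

Lemma reflect_vec1 x y : root_reflect A 1 (vec x y) = vec x (a%:Z * x - y).
Proof.
rewrite /root_reflect pairing_vec /=; apply/rowP=> j; rewrite !mxE.
by case: j => [[|[|//]]] ? /=; ring.
Qed.

(** The coordinates of the real roots: Chebyshev polynomials of the second kind
    in [a / 2]. *)
Fixpoint cheb (n : nat) : int :=
  match n with
  | 0 => 0
  | 1 => 1
  | (m.+1 as m').+1 => a%:Z * cheb m' - cheb m
  end.

Lemma chebSS n : cheb n.+2 = a%:Z * cheb n.+1 - cheb n.
Proof. by []. Qed.

Lemma cheb_lt n : 0 <= cheb n /\ cheb n < cheb n.+1.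
Proof.
elim: n => [//|n [c0 c1]]; split; first by lia.
by rewrite chebSS; nia.
Qed.

Lemma cheb_gap n : cheb n + 2 <= cheb n.+2.
Proof. by have [c0 c1] := cheb_lt n; rewrite chebSS; nia. Qed.

(** The norm of a real root is 2. *)
Lemma cheb_norm n :
  cheb n.+1 ^+ 2 + cheb n ^+ 2 - a%:Z * cheb n.+1 * cheb n = 1.
Proof.
elim: n => [|n <-]; first by rewrite /=; ring.
by rewrite chebSS; ring.
Qed.

Variable K : fieldType.
Hypothesis char0 : [pchar K] =i pred0.
Notation km := (presented (@km_rel K 2 A)).
Notation is_real b := (exists x y : km, real_root A (@km_h K 2 A) b x y).

Lemma is_real_reflect i b : is_real b -> is_real (root_reflect A i b).
Proof.
have gcmA := rank2_gcm.
move=> [x [y rxy]]; have [ne nf] := km_e_f_nilpotent char0 gcmA i.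
exact: (real_root_reflect char0 (gcm_sym gcmA) (gcm_diag gcmA) (km_gens K A) ne nf rxy).
Qed.

Lemma is_real_simple i : is_real (simple_root i).
Proof.
have gcmA := rank2_gcm.
have [ne nf] := km_e_f_nilpotent char0 gcmA i.
exists (km_e K A i), (km_f K A i).
exact: (simple_real_root (gcm_diag gcmA) (km_gens K A) ne nf).
Qed.

(** The two simple reflections alternate, starting from the simple roots. *)
Lemma is_real_cheb n :
  is_real (vec (cheb n.+1) (cheb n)) /\ is_real (vec (cheb n) (cheb n.+1)).
Proof.
elim: n => [|n [r1 r2]].
  have -> : vec (cheb 1) (cheb 0) = simple_root 0.
    by apply/rowP=> j; rewrite !mxE; case: j => [[|[|//]]].
  have -> : vec (cheb 0) (cheb 1) = simple_root 1.
    by apply/rowP=> j; rewrite !mxE; case: j => [[|[|//]]].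
  by split; apply: is_real_simple.
split; first by have := is_real_reflect 0 r2; rewrite reflect_vec0.
by have := is_real_reflect 1 r1; rewrite reflect_vec1.
Qed.

(** The coordinates of the weight of a word all have the same sign. *)
Lemma mixed_absent b (x : km) i j : weight_vector A (@km_h K 2 A) b x ->
  0 < b 0 i -> b 0 j < 0 -> x = 0.
Proof.
move=> wx bi bj.
apply: (weight_absent char0 (gcm_det rank2_gcm) (km_gens K A)
  (@km_generated K 2 A) wx) => [b0|k y|k y].
- by move: bi; rewrite b0 mxE ltxx.
- by move/word_positive=> [//|[/(_ j)]]; rewrite leNgt bj.
- by move/word_positive=> [//|[/(_ i)]]; rewrite mxE oppr_ge0 leNgt bi.
Qed.

Lemma multiple_absent b (x : km) i : weight_vector A (@km_h K 2 A) b x ->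
  (forall j, j != i -> b 0 j = 0) -> 2 <= `|b 0 i| -> x = 0.
Proof.
move=> wx b0 bi.
apply: (weight_absent char0 (gcm_det rank2_gcm) (km_gens K A)
  (@km_generated K 2 A) wx) => [b0'|k y wy|k y wy].
- by move: bi; rewrite b0' mxE.
- have [//|bE] := word_multiple wy b0.
  by move: bi; rewrite bE mxE !eqxx.
- have [j ji|//|bE] := word_multiple wy (i := i).
    by rewrite mxE b0 ?oppr0.
  have := congr1 (fun v : 'rV[int]_2 => v 0 i) bE; rewrite !mxE !eqxx /= => E.
  by move: bi; rewrite -normrN E.
Qed.

End RankTwo.

Section RankTwoEmbedding.
Variables (K : fieldType) (a a' : nat).
Hypothesis char0 : [pchar K] =i pred0.
Hypothesis a3 : (3 <= a)%N.
Hypothesis a3' : (3 <= a')%N.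
Let A := rank2_cartan_matrix a.
Let A' := rank2_cartan_matrix a'.
Notation km := (presented (@km_rel K 2 A)).

Definition pair_vec (b0 b1 : 'rV[int]_2) (i : 'I_2) := if i == 0 then b0 else b1.

Definition root_pair_embeds b0 b1 :=
  (forall i j, weight_form A (pair_vec b0 b1 i) (pair_vec b0 b1 j) = A' i j) /\
  exists g : {linear kac_moody K A' -> kac_moody K A}, lie_embedding g /\
    forall c, g (cartan A' c) = cartan A (c *m root_matrix K (pair_vec b0 b1)).

Lemma rank2_embedding b0 b1 :
  (exists x y : km, real_root A (@km_h K 2 A) b0 x y) ->
  (exists x y : km, real_root A (@km_h K 2 A) b1 x y) ->
  weight_form A b0 b1 = - a'%:Z ->
  (forall x : km, weight_vector A (@km_h K 2 A) (b0 - b1) x -> x = 0) ->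
  (forall x : km, weight_vector A (@km_h K 2 A) (b1 - b0) x -> x = 0) ->
  root_pair_embeds b0 b1.
Proof.
move=> [x0 [y0 r0]] [x1 [y1 r1]] b01 abs01 abs10.
have gcm := rank2_gcm a3.
have gram i j : weight_form A (pair_vec b0 b1 i) (pair_vec b0 b1 j) = A' i j.
  have n0 := root_norm r0; have n1 := root_norm r1; rewrite !mxE /pair_vec.
  case: i => [[|[|//]]] i2; case: j => [[|[|//]]] j2 //=.
  by rewrite (weight_formC _ _ (gcm_sym gcm)).
split=> //.
apply: (@km_embedding K 2 A A' char0 gcm (rank2_gcm a3') _
   (fun i => if i == 0 then x0 else x1) (fun i => if i == 0 then y0 else y1)) => //.
- by move=> i; rewrite /pair_vec; case: (i == 0).
- move=> i j; rewrite /pair_vec.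
  case: i => [[|[|//]]] i2; case: j => [[|[|//]]] j2 //= _.
    exact/abs01/(weight_lie (root_pos r0) (root_neg r1)).
  exact/abs10/(weight_lie (root_pos r1) (root_neg r0)).
Qed.

Lemma cheb_gtr n (x : km) : 
  weight_vector A (@km_h K 2 A)
    (vec (cheb a n.+1) (cheb a n) - vec (cheb a n) (cheb a n.+1)) x -> x = 0.
Proof.
have [_] := cheb_lt a3 n; rewrite vecB.
move: (cheb a n.+1) (cheb a n) => d c lt wx.
by apply: (mixed_absent a3 char0 wx (i := 0) (j := 1)); rewrite mxE /=; lia.
Qed.

Lemma cheb_ltr n (x : km) : 
  weight_vector A (@km_h K 2 A)
    (vec (cheb a n) (cheb a n.+1) - vec (cheb a n.+1) (cheb a n)) x -> x = 0.
Proof.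
have [_] := cheb_lt a3 n; rewrite vecB.
move: (cheb a n.+1) (cheb a n) => d c lt wx.
by apply: (mixed_absent a3 char0 wx (i := 1) (j := 0)); rewrite mxE /=; lia.
Qed.

(** The difference of these two roots has coordinates of opposite signs. *)
Lemma odd_embedding n :
  (a%:Z ^+ 2 - 4) * (cheb a n.+1 * cheb a n) + a%:Z = a'%:Z ->
  root_pair_embeds (vec (cheb a n.+1) (cheb a n)) (vec (cheb a n) (cheb a n.+1)).
Proof.
move=> E; have [r1 r2] := is_real_cheb a3 char0 n.
apply: (rank2_embedding r1 r2).
- rewrite weight_form_vec -E; have := cheb_norm a n.
  set c := cheb a n; set d := cheb a n.+1 => N.
  have -> : d * d + c * c = 1 + a%:Z * d * c.
    by rewrite -N; ring.
  by ring.
- exact: cheb_gtr.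
- exact: cheb_ltr.
Qed.

(** The difference of these two roots is a multiple of the second simple root by
    an integer less than -1. *)
Lemma even_embedding n :
  (a%:Z ^+ 2 - 4) * cheb a n.+1 ^+ 2 + 2 = a'%:Z ->
  root_pair_embeds (vec (cheb a n.+1) (cheb a n)) (vec (cheb a n.+1) (cheb a n.+2)).
Proof.
move=> E; have [r1 _] := is_real_cheb a3 char0 n.
have [_ r2] := is_real_cheb a3 char0 n.+1.
have gap := cheb_gap a3 n.
apply: (rank2_embedding r1 r2).
- rewrite weight_form_vec -E chebSS; have := cheb_norm a n.
  set c := cheb a n; set d := cheb a n.+1 => N.
  transitivity (- (a%:Z ^+ 2 - 4) * d ^+ 2 - 2 * (d ^+ 2 + c ^+ 2 - a%:Z * d * c)).
    by ring.
  by rewrite N; ring.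
- move=> x; rewrite vecB; move: gap.
  move: (cheb a n.+2) (cheb a n.+1) (cheb a n) => c2 c1 c gap wx.
  apply: (multiple_absent a3 char0 wx (i := 1)) => [j|]; rewrite mxE /=.
    by case: j => [[|[|//]]] j2 //= _; rewrite subrr.
  by lia.
- move=> x; rewrite vecB; move: gap.
  move: (cheb a n.+2) (cheb a n.+1) (cheb a n) => c2 c1 c gap wx.
  apply: (multiple_absent a3 char0 wx (i := 1)) => [j|]; rewrite mxE /=.
    by case: j => [[|[|//]]] j2 //= _; rewrite subrr.
  by lia.
Qed.

End RankTwoEmbedding.

(** ** Root spaces *)

Section RootSpaces.
Variables (R : realType) (n : nat) (A A' : 'M[int]_n).
Variable b : 'I_n -> 'rV[int]_n.
Notation C := (complex R).
Hypothesis gcmA : symmetric_gcm A.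
Hypothesis gcmA' : symmetric_gcm A'.
Hypothesis gram : forall i j, weight_form A (b i) (b j) = A' i j.

Lemma charC : [pchar C] =i pred0.
Proof. exact: pchar_num. Qed.

Let M : 'M[C]_n := root_matrix C b.

(** The coroots of the roots [b i] span the Cartan subalgebra; so a weight for
    their action determines a weight for the whole. *)
Lemma root_space_image (g : {linear kac_moody C A' -> kac_moody C A}) v x :
  (forall x y, g (lie x y) = lie (g x) (g y)) ->
  (forall c, g (cartan A' c) = cartan A (c *m M)) ->
  root_space v x -> root_space (v *m root_matrix rat b) (g x).
Proof.
move=> g_lie gE vx c; have uM := root_matrix_unit charC gcmA' gram.
rewrite -[c in LHS](mulmxKV uM) -gE -g_lie vx.
apply: (etrans (linearZZ g _ x)); congr (_ *: _).
have evalE (B : 'M[int]_n) (w : 'rV[rat]_n) (d : 'rV[C]_n) :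
    weight_eval B w d = (d *m map_mx intr B *m (map_mx ratr w)^T) 0 0.
  rewrite /weight_eval mxE; under [RHS]eq_bigr do rewrite mxE mulr_suml.
  rewrite exchange_big; apply: eq_bigr => i _; apply: eq_bigr => j _.
  by rewrite !mxE mulrAC.
rewrite !evalE map_mxM /= trmx_mul.
have -> : map_mx ratr (root_matrix rat b) = M.
  by apply/matrixP=> i j; rewrite !mxE ratr_int.
rewrite -(root_matrix_gram C gram) -/M !mulmxA.
by rewrite mulmxKV.
Qed.

End RootSpaces.

(** * Units of the real quadratic field *)

Section ChebyshevUnits.
Variables (F : fieldType) (a : nat) (x y : F).
Hypothesis xy : x * y = 1.
Hypothesis xDy : x + y = a%:R.
Notation c n := ((cheb a n)%:~R : F).

(** If [x] and [y] are inverse to each other with sum [a], then [cheb a n] is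
    [(x ^ n - y ^ n) / (x - y)]: both satisfy the recurrence whose characteristic
    roots are [x] and [y]. *)
Lemma chebK n : c n.+2 = (x + y) * c n.+1 - c n.
Proof. by rewrite chebSS intrB intrM xDy. Qed.

Lemma cheb_exp n : c n.+1 * x - c n = x ^+ n.+1.
Proof.
elim: n => [|n IH]; first by rewrite /= mul1r subr0 expr1.
rewrite chebK exprS -IH -[c n.+1 in X in _ - X = _]mulr1 -xy; ring.
Qed.

End ChebyshevUnits.

Section ChebyshevPairs.
Variables (F : fieldType) (a : nat) (x y : F).
Hypothesis xy : x * y = 1.
Hypothesis xDy : x + y = a%:R.
Notation c n := ((cheb a n)%:~R : F).

Let yx : y * x = 1. Proof. by rewrite mulrC. Qed.
Let yDx : y + x = a%:R. Proof. by rewrite addrC. Qed.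

Lemma cheb_exp_conj n : c n * x - c n.+1 = - y ^+ n.
Proof.
case: n => [|n]; first by rewrite /= mul0r sub0r expr0.
by rewrite -(cheb_exp yx yDx) (chebK xDy); ring.
Qed.

Lemma cheb_diff n : c n * (x - y) = x ^+ n - y ^+ n.
Proof.
case: n => [|n]; first by rewrite /= mul0r subrr.
by rewrite -(cheb_exp xy xDy) -(cheb_exp yx yDx); ring.
Qed.

Let disc : (a%:R ^+ 2 - 4 : F) = (x - y) ^+ 2.
Proof.
have E : 4 = 4 * (x * y) by rewrite xy mulr1.
by rewrite -xDy [X in _ - X]E; ring.
Qed.

Lemma cheb_even n :
  (a%:R ^+ 2 - 4) * c n ^+ 2 + 2 = x ^+ (2 * n) + y ^+ (2 * n).
Proof.
rewrite disc -exprMn [_ * c n]mulrC cheb_diff.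
have E : x ^+ n * y ^+ n = 1 by rewrite -exprMn xy expr1n.
rewrite !(mulnC 2) !exprM.
have -> : 2 = 2 * (x ^+ n * y ^+ n) by rewrite E mulr1.
by ring.
Qed.

Lemma cheb_odd n : (a%:R ^+ 2 - 4) * (c n.+1 * c n) + a%:R =
  x ^+ (2 * n).+1 + y ^+ (2 * n).+1.
Proof.
have E : x ^+ n * y ^+ n = 1 by rewrite -exprMn xy expr1n.
have -> : (a%:R ^+ 2 - 4) * (c n.+1 * c n) =
    (c n.+1 * (x - y)) * (c n * (x - y)) by rewrite disc; ring.
rewrite !cheb_diff !exprS !(mulnC 2) !exprM -xDy.
have -> : x + y = (x + y) * (x ^+ n * y ^+ n) by rewrite E mulr1.
by ring.
Qed.

End ChebyshevPairs.

Section Quadratic.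
Variables (R : realType) (p : nat).
Hypotheses (hp : prime p) (hodd : odd p).
Notation sqrtp := (Num.sqrt p%:R : R).

Lemma sqrtp_sqr : sqrtp ^+ 2 = p%:R.
Proof. by rewrite sqr_sqrtr // ler0n. Qed.

Lemma sqrtp_neq0 : sqrtp != 0.
Proof. by rewrite sqrtr_eq0 -ltNge ltr0n prime_gt0. Qed.

Lemma sqrt_prime_irrational (q : rat) : q ^+ 2 != p%:R.
Proof.
apply/eqP=> q2.
have E : (numq q ^+ 2 = p%:Z * denq q ^+ 2).
  apply: (@intr_inj rat); rewrite intrM !expr2 !intrM numqE.
  by rewrite mulrACA -expr2 q2 -pmulrn.
have {E} E : (absz (numq q) ^ 2 = p * absz (denq q) ^ 2)%N.
  by rewrite -!abszX E abszM.
have d0 : (0 < absz (denq q))%N by rewrite absz_gt0 denq_neq0.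
have p0 := prime_gt0 hp.
have := congr1 (fun m => odd (logn p m)) E.
by rewrite lognM ?expn_gt0 ?d0 // !lognX (logn_prime p hp) eqxx oddD !oddM.
Qed.

Lemma sqrtp_free (u v : rat) : ratr u + ratr v * sqrtp = 0 -> u = 0 /\ v = 0.
Proof.
move=> uv; suff v0 : v = 0.
  by move: uv; rewrite v0 rmorph0 mul0r addr0 => /eqP; rewrite fmorph_eq0 => /eqP.
apply/eqP; apply: contraT => v0.
have rv0 : ratr v != 0 :> R by rewrite fmorph_eq0.
have E : sqrtp = ratr (- u / v).
  rewrite rmorphM rmorphN fmorphV /=; apply: (mulIf rv0).
  by rewrite mulfVK // mulrC; apply/eqP; rewrite -addr_eq0 addrC uv.
have := sqrt_prime_irrational (- u / v).
rewrite -(inj_eq (fmorph_inj (ratr : rat -> R))) rmorphXn /= -E.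
by rewrite sqrtp_sqr ratr_nat eqxx.
Qed.

Lemma pell_ge3 (m t : nat) : pell_solution p m t -> (3 <= m)%N.
Proof.
case=> m0 t0 E.
have p3 : (2 < p)%N by rewrite odd_prime_gt2.
by rewrite leqNgt; apply/negP => m2; nia.
Qed.

Variables (eps : R) (a s : nat -> nat).
Hypothesis has : pell_enumeration p a s eps.
Notation eta := (eta R p a s).

Lemma a_ge3 k : (0 < k)%N -> (3 <= a k)%N.
Proof. by case: has => pell _ _ /pell/pell_ge3. Qed.

(** The second factor is the Galois conjugate. *)
Lemma eta_conj k : (0 < k)%N ->
  exists2 y, eta k * y = 1 & eta k + y = (a k)%:R.
Proof.
move=> k0; case: has => /(_ k k0)[_ _ E] _ _.
rewrite /Defs.eta -[k == 0%N]negbK -lt0n k0 /=.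
exists (((a k)%:R - (s k)%:R * sqrtp) / 2); last by field.
have ER : (a k)%:R ^+ 2 = (p%:R * (s k)%:R ^+ 2 + 4 : R).
  by rewrite -!natrX E natrD natrM.
transitivity (((a k)%:R ^+ 2 - (s k)%:R ^+ 2 * sqrtp ^+ 2) / 4 : R); first by field.
by rewrite sqrtp_sqr ER; field.
Qed.

Lemma eta_mul k j : (0 < k)%N -> eta (k * j) = eta k ^+ j.
Proof.
move=> k0; case: has => _ _ pow; case: j => [|j].
  by rewrite muln0 expr0 /Defs.eta eqxx.
rewrite pow ?muln_gt0 ?k0 // pow // -exprM.
by case: ifP => _ //; rewrite -mulnA.
Qed.

Lemma eta_neq0 k : (0 < k)%N -> eta k != 0.
Proof.
move=> /eta_conj[y E _]; apply/eqP=> e0; move: E; rewrite e0 mul0r.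
by move/esym/eqP; rewrite oner_eq0.
Qed.

Lemma a_eta k q y : (0 < k)%N -> (0 < q)%N -> eta k * y = 1 ->
  (a (k * q))%:R = eta k ^+ q + y ^+ q.
Proof.
move=> k0 q0 ky; have kq0 : (0 < k * q)%N by rewrite muln_gt0 k0.
have [z kz <-] := eta_conj kq0; rewrite eta_mul // in kz *; congr (_ + _).
apply: (mulfI (expf_neq0 q (eta_neq0 k0))).
by rewrite kz -exprMn ky expr1n.
Qed.

(** This is the irrationality of the square root of [p]. *)
Lemma psi_inj k : (0 < k)%N -> injective (psi R p a s k).
Proof.
move=> k0 v w E.
have [_ s0 _] : pell_solution p (a k) (s k) by case: has => + _ _; apply.
pose x := v 0 0 - w 0 0; pose y := v 0 1 - w 0 1.
have /sqrtp_free[y0 x0] : ratr (x * (a k)%:R / 2 - y) +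
    ratr (x * (s k)%:R / 2) * sqrtp = 0 :> R.
  have /eqP := E; rewrite -subr_eq0 /psi /Defs.eta -[k == 0%N]negbK -lt0n k0 /=.
  move=> /eqP E0.
  rewrite !(rmorphB, rmorphM, fmorphV) /= !(rmorphB, ratr_nat) /=.
  apply: (mulIf (invr_neq0 sqrtp_neq0)); rewrite mul0r -[RHS]E0.
  by field; rewrite sqrtp_neq0.
have {}x0 : x = 0.
  move/eqP: x0; rewrite !mulf_eq0 invr_eq0 !pnatr_eq0 orbF.
  by rewrite [s k == _]eqn0Ngt s0 orbF => /eqP.
have {}y0 : y = 0 by move: y0; rewrite x0 !mul0r sub0r => /eqP; rewrite oppr_eq0 => /eqP.
apply/rowP=> j; apply/eqP; rewrite -subr_eq0; apply/eqP.
by case: j => [[|[|//]]] j2; [rewrite -[RHS]x0|rewrite -[RHS]y0];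
  congr (v _ _ - w _ _); apply: val_inj.
Qed.

(** Comparing both sides on the two simple roots is enough. *)
Lemma psi_root_matrix (b0 b1 : 'rV[int]_2) k l (u : R) (v : 'rV[rat]_2) :
  u * ((b0 0 0)%:~R * eta k - (b0 0 1)%:~R) = eta l ->
  u * ((b1 0 0)%:~R * eta k - (b1 0 1)%:~R) = -1 ->
  psi R p a s l v = u * psi R p a s k (v *m root_matrix rat (pair_vec b0 b1)).
Proof.
move=> E0 E1; rewrite /psi !mxE !big_ord_recl !big_ord0 !mxE /pair_vec /= !addr0.
rewrite !(rmorphD, rmorphM) /= !ratr_int -E0.
have -> : lift ord0 ord0 = 1 :> 'I_2 by apply: val_inj.
transitivity ((ratr (v 0 0) * (u * ((b0 0 0)%:~R * eta k - (b0 0 1)%:~R)) +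
   ratr (v 0 1) * -1) / sqrtp); first by field; rewrite sqrtp_neq0.
by rewrite -E1; field; rewrite sqrtp_neq0.
Qed.

Lemma embedding_maps_root_spaces k l (b0 b1 : 'rV[int]_2) (u : R)
    (g : {linear H R (a l) -> H R (a k)}) : (0 < k)%N -> (0 < l)%N ->
  lie_embedding g ->
  (forall c, g (cartan (rank2_cartan_matrix (a l)) c) =
     cartan (rank2_cartan_matrix (a k))
       (c *m root_matrix (complex R) (pair_vec b0 b1))) ->
  (forall i j, weight_form (rank2_cartan_matrix (a k)) (pair_vec b0 b1 i)
     (pair_vec b0 b1 j) = rank2_cartan_matrix (a l) i j) ->
  u * ((b0 0 0)%:~R * eta k - (b0 0 1)%:~R) = eta l ->
  u * ((b1 0 0)%:~R * eta k - (b1 0 1)%:~R) = -1 ->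
  maps_root_spaces p s g u.
Proof.
move=> k0 l0 [g_inj g_lie] gE gram E0 E1 beta [beta0 [x bx x0]].
have gcmk := rank2_gcm (a_ge3 k0); have gcml := rank2_gcm (a_ge3 l0).
have u0 : u != 0.
  by apply/eqP=> u0; move/eqP: E1; rewrite u0 mul0r eq_sym oppr_eq0 oner_eq0.
pose Mq := root_matrix rat (pair_vec b0 b1).
have psiE v := psi_root_matrix v E0 E1.
have img y := root_space_image gcml gram g_lie gE (v := beta) (x := y).
exists (beta *m Mq); split=> [alpha'||y]; last exact: img.
- rewrite psiE; split=> [/(mulfI u0)/(psi_inj k0)/esym //|-> //].
- split; last first.
    exists (g x); first exact: img.
    by apply: contra_neq x0 => gx; apply: g_inj; rewrite gx raddf0.
  apply: contra_neq beta0 => bM.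
  have uM := root_matrix_unit (pchar_num rat) gcml gram.
  by rewrite -[beta](mulmxK uM) bM mul0mx.
Qed.

End Quadratic.

Section Final.
Variables (R : realType) (p : nat).
Hypotheses (hp : prime p) (hodd : odd p).
Variables (eps : R) (a s : nat -> nat).
Hypothesis has : pell_enumeration p a s eps.
Notation eta := (eta R p a s).

(** The simple roots go to the roots [beta] and [beta'] whose images under
    [psi k] are [eta k ^ (n+1)] and [- eta k ^ (-(n+1))], divided by the square root
    of [p]; multiplying by [eta k ^ (n+1)] gives the images of the simple roots
    under [psi (2 * k * n.+1)]. *)
Lemma even_case k n : (0 < k)%N ->
  exists g : {linear H R (a (2 * k * n.+1)) -> H R (a k)}, lie_embedding g /\
    maps_root_spaces p s g (eta (k * n.+1)).
Proof.
move=> k0; have l0 : (0 < 2 * k * n.+1)%N by rewrite !muln_gt0 k0.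
have [y ky kDy] := eta_conj has k0.
have lE : (2 * k * n.+1 = k * (2 * n.+1))%N by rewrite mulnAC mulnC mulnA.
have E : ((a k)%:Z ^+ 2 - 4) * cheb (a k) n.+1 ^+ 2 + 2 =
    (a (2 * k * n.+1))%:Z.
  apply: (@intr_inj R).
  rewrite -pmulrn lE (a_eta has k0 _ ky) // -(cheb_even ky kDy).
  by rewrite intrD intrM intrB !rmorphXn /=; ring.
have [gram [g [gL gE]]] := even_embedding (@charC R) (a_ge3 hp hodd has k0)
  (a_ge3 hp hodd has l0) E.
exists g; split=> //.
have V x z : (vec x z 0 0 = x) /\ (vec x z 0 1 = z) by rewrite !mxE.
apply: (embedding_maps_root_spaces hp hodd has k0 l0 gL gE gram).
- rewrite !(V _ _).1 !(V _ _).2 (cheb_exp ky kDy) (eta_mul has) // lE.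
  by rewrite (eta_mul has) // -exprD addnn -mul2n.
- rewrite !(V _ _).1 !(V _ _).2 (cheb_exp_conj ky kDy) (eta_mul has) //.
  by rewrite mulrN -exprMn ky expr1n.
Qed.

(** As before, with [eta k ^ (n+1)] and [- eta k ^ (-n)], multiplied by
    [eta k ^ n]. *)
Lemma odd_case k n : (0 < k)%N ->
  exists g : {linear H R (a (k * (2 * n).+1)) -> H R (a k)}, lie_embedding g /\
    maps_root_spaces p s g (eta (k * n)).
Proof.
move=> k0; have l0 : (0 < k * (2 * n).+1)%N by rewrite !muln_gt0 k0.
have [y ky kDy] := eta_conj has k0.
have E : ((a k)%:Z ^+ 2 - 4) * (cheb (a k) n.+1 * cheb (a k) n) + (a k)%:Z =
    (a (k * (2 * n).+1))%:Z.
  apply: (@intr_inj R).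
  rewrite -pmulrn (a_eta has k0 _ ky) // -(cheb_odd ky kDy).
  by rewrite intrD !intrM intrB !rmorphXn /=; ring.
have [gram [g [gL gE]]] := odd_embedding (@charC R) (a_ge3 hp hodd has k0)
  (a_ge3 hp hodd has l0) E.
exists g; split=> //.
have V x z : (vec x z 0 0 = x) /\ (vec x z 0 1 = z) by rewrite !mxE.
apply: (embedding_maps_root_spaces hp hodd has k0 l0 gL gE gram).
- rewrite !(V _ _).1 !(V _ _).2 (cheb_exp ky kDy) !(eta_mul has) //.
  by rewrite -exprD addnS addnn -mul2n.
- rewrite !(V _ _).1 !(V _ _).2 (cheb_exp_conj ky kDy) (eta_mul has) //.
  by rewrite mulrN -exprMn ky expr1n.
Qed.

End Final.

Theorem theorem5p5 (R : realType) (p : nat) (hp : prime p) (hodd : odd p)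
    (eps : R) (heps : fundamental_unit p eps)
    (a s : nat -> nat) (has : pell_enumeration p a s eps)
    (k l : nat) (hk : (0 < k)%N) (hl : (0 < l)%N) (hkl : (k %| l)%N) :
  exists g : {linear H R (a l) -> H R (a k)},
    [/\ lie_embedding g,
        forall j : nat, l = (2 * k * j)%N ->
          maps_root_spaces p s g (eta R p a s (k * j)) &
        forall j : nat, (0 < j)%N -> l = (k * (2 * j - 1))%N ->
          maps_root_spaces p s g (eta R p a s (k * (j - 1)))].
Proof.
have [q lE] : exists q, l = (k * q)%N.
  by have /dvdnP[q ->] := hkl; exists q; rewrite mulnC.
have q0 : (0 < q)%N by move: hl; rewrite lE muln_gt0 => /andP[].
have kq m : (k * q = k * m)%N -> q = m.
  by move/eqP; rewrite eqn_pmul2l // => /eqP.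
have qE := odd_double_half q; case: (boolP (odd q)) qE => [oq|oq] qE.
- have {}lE : l = (k * (2 * q./2).+1)%N by rewrite lE -{1}qE mul2n.
  subst l; have [g [gL gM]] := odd_case hp hodd has q./2 hk.
  exists g; split=> // j.
    move=> E; exfalso; move/eqP: E; rewrite -mulnA mulnCA eqn_pmul2l // => /eqP.
    by lia.
  move=> j0 E; have -> : (j - 1 = q./2)%N by move/eqP: E; rewrite eqn_pmul2l //; lia.
  exact: gM.
- case qh: q./2 qE => [|n] qE; first by move: q0; rewrite -qE.
  have {}lE : l = (2 * k * n.+1)%N.
    by rewrite lE -qE add0n -mul2n mulnCA mulnA.
  subst l; have [g [gL gM]] := even_case hp hodd has n hk.
  exists g; split=> // j.
    move=> E; have -> : j = n.+1; last exact: gM.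
    by move/eqP: E; rewrite eqn_pmul2l ?muln_gt0 ?hk // => /eqP.
  move=> j0 E; exfalso; move: E; rewrite -mulnA mulnCA => /eqP.
  by rewrite eqn_pmul2l // => /eqP; lia.
Qed.
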